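(* Let $k\ge3$ and let $V\subset\mathbb{C}^k$ be an algebraic variety of codimension $2$. Then there exist a point $p\in\mathbb{C}^k$ and a sequence $\{F_n\}_{n\ge0}$ of holomorphic automorphisms of $\mathbb{C}^k$, each having $p$ as an attracting fixed point, such that the basin of attraction \[ \Omega_{\{F_n\}}=\{z\in\mathbb{C}^k: F_n\circ\cdots\circ F_0(z)\to p \text{ as } n\to\infty\} \] is a piecewise smooth Short $\mathbb{C}^k$ with $\Omega_{\{F_n\}}\cap V=\emptyset$.
   Context: A Short $\mathbb{C}^k$ is a domain $\Omega\subset\mathbb{C}^k$ such that: (1) $\Omega=\bigcup_{j\ge1}\Omega_j$ with $\Omega_j\subset\Omega_{j+1}$ and each $\Omega_j$ biholomorphic to the unit ball of $\mathbb{C}^k$; (2) the infinitesimal Kobayashi pseudometric of $\Omega$ vanishes identically; (3) $\Omega$ carries a non-constant plurisubharmonic function that is bounded above. A domain $D\subset\mathbb{C}^k$ is piecewise smooth (pseudoconvex) if $D=\bigcap_{i=1}^n D_i$ where each $D_i=\{\rho_i<0\}$ is a pseudoconvex domain with $C^\infty$ boundary, $\rho_i$ a $C^\infty$ defining function with $\nabla\rho_i\neq0$ on $\partial D_i$, and $d\rho_{i_1}\wedge\cdots\wedge d\rho_{i_l}\ne0$ on $\{z\in\partial D:\rho_{i_1}(z)=\cdots=\rho_{i_l}(z)=0\}$ for all $1\le i_1<\cdots<i_l\le n$. *)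

(* Defs.v *)
From HB Require Import structures.
From mathcomp Require Import all_boot all_order all_algebra.
From mathcomp Require Import all_classical all_reals all_analysis.
From mathcomp Require Import complex.
From mathcomp Require mpoly.

Set Implicit Arguments.
Unset Strict Implicit.
Unset Printing Implicit Defensive.

Import Order.TTheory GRing.Theory Num.Theory.
Import numFieldNormedType.Exports.

Local Open Scope classical_set_scope.
Local Open Scope ring_scope.

Section SCV.
Variable R : realType.

(* A point of C^k in real coordinates: z = x + i y, with (x, y) : R^k * R^k. *)
Definition Cpt (k : nat) := ('rV[R]_k * 'rV[R]_k)%type.

Definition cmulI k (z : Cpt k) : Cpt k := (- z.2, z.1).

Definition cscale k (lam : Cpt 1) (b : Cpt k) : Cpt k :=
  let a := lam.1 0 0 in let c := lam.2 0 0 in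
  (a *: b.1 - c *: b.2, a *: b.2 + c *: b.1).

Definition cone : Cpt 1 := (\row_(j < 1) 1, 0).
Definition cexpi (t : R) : Cpt 1 := (\row_(j < 1) cos t, \row_(j < 1) sin t).

Definition hnorm2 k (z : Cpt k) : R := \sum_(j < k) (z.1 0 j ^+ 2 + z.2 0 j ^+ 2).
Definition cabs k (z : Cpt k) : R := Num.sqrt (hnorm2 z).

Definition unit_ball k : set (Cpt k) := [set z | hnorm2 z < 1].
Definition unit_disc : set (Cpt 1) := @unit_ball 1.
Definition closed_disc : set (Cpt 1) := [set z | hnorm2 z <= 1].

Definition toC k (z : Cpt k) : 'I_k -> R[i] := fun j => (z.1 0 j +i* z.2 0 j)%C.

(* holomorphic on an open set U: real (Frechet) differentiable with
   complex-linear differential, i.e. complex differentiable *)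
Definition holomorphic k m (U : set (Cpt k)) (f : Cpt k -> Cpt m) : Prop :=
  open U /\ forall z, U z ->
    differentiable f z /\ forall v, 'd f z (cmulI v) = cmulI ('d f z v).

Definition domain k (U : set (Cpt k)) : Prop := open U /\ connected U /\ U !=set0.

Definition biholomorphic k (A B : set (Cpt k)) : Prop :=
  exists (f g : Cpt k -> Cpt k),
    [/\ holomorphic A f, holomorphic B g,
        (forall z, A z -> B (f z)) /\ (forall w, B w -> A (g w)),
        (forall z, A z -> g (f z) = z) & (forall w, B w -> f (g w) = w)].

Definition hol_automorphism k (F : Cpt k -> Cpt k) : Prop :=
  exists G : Cpt k -> Cpt k,
    [/\ holomorphic setT F, holomorphic setT G, cancel F G & cancel G F].

Definition cjacobian k (F : Cpt k -> Cpt k) (p : Cpt k) : 'M[R[i]]_k :=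
  \matrix_(i < k, j < k)
    (let w := 'd F p ((\row_(l < k) (l == j)%:R, 0) : Cpt k) in
     (w.1 0 i +i* w.2 0 i)%C).

Definition attracting_fixed_point k (F : Cpt k -> Cpt k) (p : Cpt k) : Prop :=
  F p = p /\ forall lam : R[i], eigenvalue (cjacobian F p) lam -> `|lam| < 1.

Fixpoint compose_seq k (F : nat -> Cpt k -> Cpt k) (n : nat) (z : Cpt k) : Cpt k :=
  match n with
  | 0 => F 0%N z
  | n'.+1 => F n (compose_seq F n' z)
  end.

Definition basin k (F : nat -> Cpt k -> Cpt k) (p : Cpt k) : set (Cpt k) :=
  [set z | (fun n => compose_seq F n z) @ \oo --> p].

Definition kobayashi k (Om : set (Cpt k)) (z v : Cpt k) : R :=
  inf [set r : R | exists (f : Cpt 1 -> Cpt k) (a : Cpt 1),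
        [/\ holomorphic unit_disc f, (forall l, unit_disc l -> Om (f l)),
            f 0 = z, cscale a ('d f 0 cone) = v & r = cabs a]].

Definition usc_on k (U : set (Cpt k)) (u : Cpt k -> \bar R) : Prop :=
  forall z, U z -> forall c : R, (u z < c%:E)%E -> \forall w \near z, (u w < c%:E)%E.

Definition psh k (U : set (Cpt k)) (u : Cpt k -> \bar R) : Prop :=
  [/\ open U, (forall z, U z -> u z < +oo)%E, usc_on U u &
      forall a b : Cpt k, (forall l, closed_disc l -> U (a + cscale l b)) ->
        (u a <= ((2 * pi)^-1)%:E *
           \int[@lebesgue_measure R]_(t in `[0%R, (2 * pi)%R]) u (a + cscale (cexpi t) b)%R)%E].

Definition pseudoconvex k (D : set (Cpt k)) : Prop :=
  domain D /\ exists u : Cpt k -> R,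
    [/\ {within D, continuous u}, psh D (fun z => (u z)%:E) &
        forall c : R, compact (closure [set z | D z /\ u z < c]) /\
                      closure [set z | D z /\ u z < c] `<=` D].

Fixpoint iter_dder k (l : seq (Cpt k)) (f : Cpt k -> R) : Cpt k -> R :=
  match l with
  | [::] => f
  | v :: l' => fun x => 'D_v (iter_dder l' f) x
  end.

Definition smooth k (f : Cpt k -> R) : Prop :=
  forall l : seq (Cpt k),
    continuous (iter_dder l f) /\ forall x v, derivable (iter_dder l f) x v.

Definition boundary k (A : set (Cpt k)) : set (Cpt k) := closure A `\` interior A.

Definition piecewise_smooth k (D : set (Cpt k)) : Prop :=
  domain D /\
  exists (n : nat) (rho : 'I_n -> Cpt k -> R),
    [/\ (0 < n)%N,
        D = \bigcap_(i in [set: 'I_n]) [set z | rho i z < 0],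
        (forall i, smooth (rho i) /\ pseudoconvex [set z | rho i z < 0] /\
           forall z, boundary [set z | rho i z < 0] z ->
             exists v, 'd (rho i) z v != 0) &
        (* d rho_{i_1} /\ ... /\ d rho_{i_l} <> 0, i.e. linear independence *)
        forall (I : {set 'I_n}) (z : Cpt k),
          boundary D z -> (forall i, i \in I -> rho i z = 0) ->
          forall c : 'I_n -> R,
            (forall w, \sum_(i in I) c i * 'd (rho i) z w = 0) ->
            forall i, i \in I -> c i = 0].

Definition short_Ck k (Om : set (Cpt k)) : Prop :=
  [/\ domain Om,
      (exists Oms : nat -> set (Cpt k),
         [/\ (forall j, Oms j `<=` Oms j.+1),
             Om = \bigcup_j Oms j &
             forall j, biholomorphic (Oms j) (@unit_ball k)]),
      (forall z v, Om z -> kobayashi Om z v = 0) &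
      exists u : Cpt k -> \bar R,
        [/\ psh Om u, (exists M : R, forall z, Om z -> (u z <= M%:E)%E) &
            exists z w, [/\ Om z, Om w & u z <> u w]]].

Definition alg_set k (S : set (Cpt k)) : Prop :=
  exists ps : seq (mpoly.mpoly k R[i]),
    S = [set z | all (fun q => mpoly.meval (toC z) q == 0) ps].

Definition irreducible_alg k (S : set (Cpt k)) : Prop :=
  [/\ alg_set S, S !=set0 &
      forall A B, alg_set A -> alg_set B -> S = A `|` B -> S = A \/ S = B].

Definition has_chain k (S : set (Cpt k)) (d : nat) : Prop :=
  exists c : nat -> set (Cpt k),
    (forall i, (i <= d)%N -> irreducible_alg (c i) /\ c i `<=` S) /\
    (forall i, (i < d)%N -> c i `<` c i.+1).

Definition alg_dim k (S : set (Cpt k)) (d : nat) : Prop :=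
  has_chain S d /\ forall e, has_chain S e -> (e <= d)%N.

End SCV.

(* Main.v *)
(* Let K = k - 1.  After a polynomial change of coordinates L, every point of L(V) has
   its last two coordinates bounded by a power of the remaining ones.  Compose the maps
   f_n(z)_i = z_i^{d_n} + a_n z_{i+1} for i < K, f_n(z)_K = a_n z_0, and write
   phi_n = f_{n-1} o ... o f_0 o L, with components h_{n,i}.  The basin of 0 is the
   intersection over i < K of D_i = {h_{n,i} -> 0}.  If d_n grows fast and a_n is tiny,
   the growth condition persists for phi_n(V) (with larger exponents), so no point of V
   has its first K coordinates small, and V avoids the basin.
   Put rho_{n,i} = (|h_{n,i}|^2 - 1) / P_{n,i}, where P_{n+1,i} = P_{n,i} sum_{j<d_n} |h_{n,i}|^{2j}.
   Replacing h by h^d does not change this quotient, so rho_{n+1,i} - rho_{n,i} is O(a_n)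
   with all its derivatives, and for a_n chosen inductively rho_{n,i} converges smoothly
   to a defining function of D_i.  The vector fields that phi_n straightens to h_j d/dw_j
   are almost dual to the differentials of the rho_i, which gives transversality.
   D_i is exhausted by |z|^2 + sum_n |h_{n,i}|^4, and the basin by the preimages under
   phi_n of a ball that the f_n contract; discs through phi_n^{-1} make the Kobayashi metric
   vanish, and lim ln max(|h_{n,0}|, 16^{-N_n}) / N_n with N_n = d_0 ... d_{n-1} is a bounded
   nonconstant plurisubharmonic function. *)
Require Import Defs.
From HB Require Import structures.
From mathcomp Require Import all_boot all_order all_algebra.
From mathcomp Require mpoly.
Set Implicit Arguments.
Unset Strict Implicit.
Unset Printing Implicit Defensive.

(** The codimension enters through projections: if all but one of the coordinates satisfied no
    polynomial relation on [V], slicing by hyperplanes would produce a chain of irreducible sets of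
    length k - 1. Hence in every polynomial coordinate system K coordinates are related, and a
    relation bounds one coordinate by powers of the others; two systems used in turn bound two
    coordinates. Two are needed because f_n couples z_i to z_{i+1}: the bound on z_{K-1} closes the
    estimate for the first K - 1 coordinates, and the bound on z_K controls the new z_{K-1}. The
    obstacle in the limit is that weights and dual fields of stage n are bounded only on balls, by
    constants that grow with n. Each stage therefore fixes its ball, its bounds and its tolerance
    before the next a_n is chosen, and all later changes together stay below that tolerance. For
    plurisubharmonicity only polynomials are averaged, over roots of unity; the Lebesgue mean of a
    limit function is then reached through Riemann sums, without integral formulas. *)

Module PolynomialFunctions.
Import mpoly.
Import GRing.Theory.
Local Open Scope ring_scope.
Section PolynomialFunctions.
Variables (A : comNzRingType) (n : nat).
Implicit Types p q : mpoly.mpoly n A.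

Lemma meval_cst_ex c : exists q : mpoly.mpoly n A, forall v, mpoly.meval v q = c.
Proof. by exists (mpolyC n c) => v; rewrite mevalC. Qed.

Lemma meval_coord_ex i : exists q : mpoly.mpoly n A, forall v, mpoly.meval v q = v i.
Proof. by exists 'X_i => v; rewrite mevalXU. Qed.

Lemma meval_add_ex p q : exists r : mpoly.mpoly n A,
  forall v, mpoly.meval v r = mpoly.meval v p + mpoly.meval v q.
Proof. by exists (p + q) => v; rewrite mevalD. Qed.

Lemma meval_mul_ex p q : exists r : mpoly.mpoly n A,
  forall v, mpoly.meval v r = mpoly.meval v p * mpoly.meval v q.
Proof. by exists (p * q) => v; rewrite mevalM. Qed.

Lemma meval_sum_prod q : exists (s : seq (A * ('I_n -> nat))),
  forall v, mpoly.meval v q = \sum_(m <- s) m.1 * \prod_i v i ^+ m.2 i.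
Proof.
exists [seq (mcoeff m q, fun i : ordinal n => m i) | m <- msupp q] => v.
by rewrite mevalE [RHS]big_map.

Qed.
End PolynomialFunctions.
End PolynomialFunctions.

From mathcomp Require Import all_classical all_reals all_analysis.
From mathcomp Require Import complex.
From mathcomp Require Import ring lra zify.
Import Order.TTheory GRing.Theory Num.Theory.
Import numFieldNormedType.Exports.
Local Open Scope classical_set_scope.
Local Open Scope ring_scope.

(** * Noetherian induction for algebraic sets *)

Section Noeth.

Definition span_before (A : comNzRingType) (u : nat -> A) (n : nat) (x : A) :=
  exists c : nat -> A, x = \sum_(i < n) c i * u i.

(** A sequential form of the ascending chain condition: no sequence leaves the ideal of its
    predecessors at every step. It avoids ideals and is exactly what the descending chain condition
    for zero sets consumes. *)
Definition noetherian (A : comNzRingType) :=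
  forall u : nat -> A, exists n, span_before u n (u n).

Lemma field_noetherian (F : fieldType) : noetherian F.
Proof.
move=> u; case: (eqVneq (u 0%N) 0) => [u0|u0].
  by exists 0%N, (fun=> 0); rewrite big_ord0.
exists 1%N, (fun=> u 1%N / u 0%N).
by rewrite big_ord1 divfK.
Qed.

Section SpanTheory.
Variables (A : comNzRingType) (u : nat -> A).

Lemma span_before0 n : span_before u n 0.
Proof. by exists (fun=> 0); rewrite big1 // => i _; rewrite mul0r. Qed.

Lemma span_beforeD n x y :
  span_before u n x -> span_before u n y -> span_before u n (x + y).
Proof.
move=> [c ->] [d ->]; exists (fun i => c i + d i).
by rewrite -big_split; apply: eq_bigr => i _; rewrite mulrDl.
Qed.

Lemma span_beforeM n b x : span_before u n x -> span_before u n (b * x).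
Proof.
move=> [c ->]; exists (fun i => b * c i).
by rewrite mulr_sumr; apply: eq_bigr => i _; rewrite mulrA.
Qed.

Lemma span_before_sum n m (F : 'I_m -> A) :
  (forall i, span_before u n (F i)) -> span_before u n (\sum_i F i).
Proof.
move=> h; elim/big_ind: _ => //; first exact: span_before0.
exact: span_beforeD.
Qed.

Lemma span_before_gen n i : (i < n)%N -> span_before u n (u i).
Proof.
move=> lin; exists (fun j => (j == i)%:R).
rewrite (bigD1 (Ordinal lin)) //= eqxx mul1r big1 ?addr0 // => j ji.
by have := ji; rewrite -val_eqE /= => /negbTE ->; rewrite mul0r.
Qed.

Lemma span_beforeW n m x : (n <= m)%N -> span_before u n x -> span_before u m x.
Proof.
move=> nm [c ->]; apply: span_before_sum => i; apply: span_beforeM.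
by apply: span_before_gen; apply: leq_trans nm.
Qed.

End SpanTheory.

(* Hilbert's argument: pick f_n of least degree in the ideal outside the span of
   f_0, ..., f_{n-1}; a relation between leading coefficients lowers the degree. *)
Lemma poly_noetherian (A : comNzRingType) : noetherian A -> noetherian {poly A}.
Proof.
move=> nA u; apply: contrapT => /forallNP hu.
pose I x := exists n, span_before u n x.
have I0 : I 0 by exists 0%N; exact: span_before0.
have ID x y : I x -> I y -> I (x + y).
  move=> [n hn] [m hm]; exists (maxn n m).
  by apply: span_beforeD; [exact: (span_beforeW (leq_maxl _ _) hn)|
                           exact: (span_beforeW (leq_maxr _ _) hm)].
have IM b x : I x -> I (b * x) by move=> [n hn]; exists n; exact: span_beforeM.
have notfg (s : seq {poly A}) : (forall x, x \in s -> I x) ->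
    exists x, I x /\ ~ span_before (nth 0 s) (size s) x.
  move=> sI; apply: contrapT => /forallNP h.
  have [N hN] : exists N, forall x, x \in s -> span_before u N x.
    elim: s sI {h} => [|y s IH] sI; first by exists 0%N.
    have [|N hN] := IH; first by move=> x xs; apply: sI; rewrite inE xs orbT.
    have [M hM] : I y by apply: sI; rewrite mem_head.
    exists (maxn N M) => x; rewrite inE => /predU1P[->|xs].
      exact: (span_beforeW (leq_maxr _ _) hM).
    exact: (span_beforeW (leq_maxl _ _) (hN _ xs)).
  apply: (hu N); have : span_before (nth 0 s) (size s) (u N).
    apply: contrapT => h'; apply: (h (u N)); split => //.
    by exists N.+1; apply: span_before_gen.
  move=> [c ->]; apply: span_before_sum => i; apply: span_beforeM.
  by apply: hN; apply: mem_nth.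
(* The condition on [s] stands under the existential so that [choice] yields a total function on
   lists. *)
have minex (s : seq {poly A}) : exists x, (forall y, y \in s -> I y) ->
    [/\ I x, ~ span_before (nth 0 s) (size s) x &
     forall y, I y -> ~ span_before (nth 0 s) (size s) y -> (size x <= size y)%N].
  case: (pselect (forall y, y \in s -> I y)) => [sI|]; last by move=> h; exists 0.
  have [x0 [Ix0 nx0]] := notfg s sI.
  have ex : exists n, `[< exists x, [/\ I x, ~ span_before (nth 0 s) (size s) x & size x = n] >].
    by exists (size x0); apply/asboolP; exists x0.
  case: (ex_minnP ex) => n /asboolP [x [Ix nx sx]] hmin.
  exists x => _; split => // y Iy ny; rewrite sx; apply: hmin.
  by apply/asboolP; exists y.
have [g hg] := choice minex.
pose L := fix L n := if n is n'.+1 then rcons (L n') (g (L n')) else [::].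
pose f n := g (L n).
have sL n : size (L n) = n by elim: n => //= n IH; rewrite size_rcons IH.
have nL n i : (i < n)%N -> nth 0 (L n) i = f i.
  elim: n => // n IH; rewrite ltnS leq_eqVlt => /predU1P[->|lin] /=.
    by rewrite nth_rcons sL ltnn eqxx.
  by rewrite nth_rcons sL lin IH.
have LI n x : x \in L n -> I x.
  elim: n x => // n IH x /=; rewrite mem_rcons inE => /predU1P[->|/IH //].
  by have [] := hg _ IH.
have spf n x : span_before (nth 0 (L n)) (size (L n)) x <-> span_before f n x.
  by rewrite sL; split => -[c ->]; exists c; apply: eq_bigr => i _; rewrite nL.
have If n : I (f n) by have [] := hg _ (@LI n).
have nf n : ~ span_before f n (f n).
  by move/spf; have [_ h _] := hg _ (@LI n); apply: h.
have fmin n y : I y -> ~ span_before f n y -> (size (f n) <= size y)%N.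
  by move=> Iy ny; have [_ _ h] := hg _ (@LI n); apply: h => // /spf.
have fnz n : f n != 0 by apply/eqP => f0; apply: (nf n); rewrite f0; exact: span_before0.
have fmono i n : (i <= n)%N -> (size (f i) <= size (f n))%N.
  by move=> lin; apply: fmin => // h; apply: (nf n); apply: span_beforeW h.
have [n [c hc]] := nA (fun n => lead_coef (f n)).
pose q := \sum_(i < n) ((c i)%:P * 'X^(size (f n) - size (f i))) * f i.
have hq : span_before f n q by exists (fun i => (c i)%:P * 'X^(size (f n) - size (f i))).
have Iq : I q.
  by case: hq => b ->; elim/big_ind: _ => // i _; apply: IM.
have nfq : ~ span_before f n (f n - q).
  move=> h; apply: (nf n); rewrite -[f n](subrK q).
  exact: span_beforeD.
have Ifq : I (f n - q) by apply: ID => //; rewrite -mulN1r; exact: IM.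
have := fmin _ _ Ifq nfq; rewrite leqNgt => /negP; apply.
have sf0 : (0 < size (f n))%N by rewrite size_poly_gt0.
rewrite -(prednK sf0) ltnS; apply/leq_sizeP => j.
rewrite leq_eqVlt => /predU1P[<-|hj].
  rewrite coefB -/(lead_coef (f n)) hc /q coef_sum -sumrB big1 // => i _.
  have lfi : (0 < size (f i))%N by rewrite size_poly_gt0.
  have lifn : (size (f i) <= size (f n))%N by apply: fmono; apply: ltnW.
  rewrite -mulrA coefCM coefXnM.
  have -> : ((size (f n)).-1 < size (f n) - size (f i))%N = false.
    by apply/negbTE; rewrite -leqNgt; case: (size (f i)) lfi lifn => // s _; rewrite subnS => _; rewrite -!subn1 leq_sub2r // leq_subr.
  have -> : ((size (f n)).-1 - (size (f n) - size (f i)) = (size (f i)).-1)%N.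
    by rewrite -!subn1 subnAC subKn.
  by rewrite subrr.
rewrite coefB [(f n)`_j]nth_default ?sub0r; last by rewrite -(prednK sf0).
rewrite /q coef_sum big1 ?oppr0 // => i _.
have lifn : (size (f i) <= size (f n))%N by apply: fmono; apply: ltnW.
rewrite -mulrA coefCM coefXnM; case: ifP => _; first by rewrite mulr0.
rewrite nth_default ?mulr0 //.
have hj' : (size (f n) <= j)%N by rewrite -(prednK sf0).
by rewrite -{1}(subKn lifn) leq_sub2r.
Qed.

End Noeth.

(** * Iterated univariate polynomials, their zero sets and chains of irreducible sets *)

Section IteratedPolynomials.
Variable C : numClosedFieldType.

(** The iterated form makes leading coefficients and division in the last variable, as well as
    induction on the number of variables, immediate. [ev] reads its point from an infinite sequence,
    so that sets in different numbers of variables have a common type. *)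
Fixpoint itp (n : nat) : idomainType :=
  if n is n'.+1 then {poly itp n'} : idomainType else C : idomainType.

Fixpoint ev (n : nat) (x : nat -> C) : {rmorphism itp n -> C} :=
  if n is n'.+1 return {rmorphism itp n -> C}
  then (horner_eval (x n') \o map_poly (ev n' x)) : {rmorphism {poly itp n'} -> C}
  else (idfun : {rmorphism C -> C}).

Lemma evS n x (p : itp n.+1) : ev n.+1 x p = (map_poly (ev n x) (p : {poly itp n})).[x n].
Proof. by []. Qed.

Lemma ev_polyC n x (c : itp n) : ev n.+1 x (c%:P : {poly itp n}) = ev n x c.
Proof. by rewrite evS map_polyC hornerC. Qed.

Lemma ev_polyX n x : ev n.+1 x ('X : {poly itp n}) = x n.
Proof. by rewrite evS map_polyX hornerX. Qed.

Lemma ev_sum n x (p : itp n.+1) :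
  ev n.+1 x p = \sum_(i < size (p : {poly itp n})) ev n x (p : {poly itp n})`_i * x n ^+ i.
Proof.
rewrite {1}(_ : p = \sum_(i < size (p : {poly itp n}))
   ((p : {poly itp n})`_i)%:P * 'X^i); last first.
  by rewrite -[LHS]coefK poly_def; apply: eq_bigr => i _; rewrite mul_polyC.
rewrite rmorph_sum; apply: eq_bigr => i _.
by rewrite rmorphM rmorphXn ev_polyC ev_polyX.
Qed.

Lemma eq_ev n x y (p : itp n) : (forall i, (i < n)%N -> x i = y i) -> ev n x p = ev n y p.
Proof.
elim: n x y p => // n IH x y p h.
rewrite !ev_sum; apply: eq_bigr => i _; rewrite (h n) //; congr (_ * _).
by apply: IH => j jn; apply: h; apply: ltnW.
Qed.

Lemma itp_noetherian n : noetherian (itp n).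
Proof.
by elim: n => [|n IH]; [exact: field_noetherian|exact: poly_noetherian].
Qed.

Definition upd (x : nat -> C) (n : nat) (t : C) : nat -> C :=
  fun i => if i == n then t else x i.

Lemma poly_nonroot (A : idomainType) (f : nat -> A) (p : {poly A}) :
  injective f -> p != 0 -> exists n, ~~ root p (f n).
Proof.
move=> fI p0; apply: contrapT => /forallNP h.
have := max_poly_roots (rs := map f (iota 0 (size p))) p0.
rewrite size_map size_iota ltnn => H; suff : false by []. apply: H.
  by apply/allP => _ /mapP [i _ ->]; apply: contraT => /h.
by rewrite map_inj_uniq // iota_uniq.
Qed.

Lemma ev_neq0 n (p : itp n) : p != 0 -> exists x, ev n x p != 0.
Proof.
elim: n p => [|n IH] p p0; first by exists (fun=> 0).
have [x hx] := IH (lead_coef (p : {poly itp n})) ltac:(by rewrite lead_coef_eq0).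
have q0 : map_poly (ev n x) (p : {poly itp n}) != 0.
  by apply: contraNneq hx => q0; rewrite lead_coefE -coef_map q0 coef0.
have natI : injective (fun n : nat => n%:R : C) by move=> a b /eqP; rewrite eqr_nat => /eqP.
have [t ht] := poly_nonroot natI q0.
exists (upd x n t%:R); rewrite evS /upd eqxx.
rewrite (eq_map_poly (g := ev n x)) // => c.
by apply: eq_ev => i lin; rewrite ltn_eqF.
Qed.

Lemma ev_eq0 n (p : itp n) : (forall x, ev n x p = 0) -> p = 0.
Proof.
move=> h; apply/eqP; apply: contraT => /ev_neq0 [x]; by rewrite h eqxx.
Qed.

Fixpoint constp (n : nat) (c : C) : itp n :=
  if n is n'.+1 return itp n then (constp n' c)%:P : {poly itp n'} else c.

Lemma ev_constp n x c : ev n x (constp n c) = c.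
Proof. by elim: n => //= n IH; rewrite /horner_eval map_polyC hornerC. Qed.

Definition zeros n (ps : seq (itp n)) : set (nat -> C) :=
  [set x | forall p, p \in ps -> ev n x p = 0].

Definition algi n (S : set (nat -> C)) := exists ps : seq (itp n), S = zeros ps.

Lemma algi_ext n S x y : algi n S -> (forall i, (i < n)%N -> x i = y i) -> S x -> S y.
Proof. by move=> [ps ->] xy Sx p pin; rewrite -(eq_ev p xy); apply: Sx. Qed.

Definition irri n (S : set (nat -> C)) :=
  [/\ algi n S, S !=set0 &
      forall A B, algi n A -> algi n B -> S = A `|` B -> S = A \/ S = B].

Definition chaini n (S : set (nat -> C)) (d : nat) :=
  exists c : nat -> set (nat -> C),
    (forall i, (i <= d)%N -> irri n (c i) /\ c i `<=` S) /\
    (forall i, (i < d)%N -> c i `<` c i.+1).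

(** Zariski density of the projection of [S] to the first [n] coordinates. *)
Definition dominant n (S : set (nat -> C)) :=
  forall Q : itp n, (forall x, S x -> ev n x Q = 0) -> Q = 0.

(** Choose p_i vanishing on S_{i+1} but not at some x_i of S_i. Some p_N is a combination of earlier
    p_i; these all vanish at x_N, while p_N does not. *)
Lemma algi_dcc n (S : nat -> set (nat -> C)) : (forall i, algi n (S i)) ->
  ~ (forall i, S i.+1 `<` S i).
Proof.
move=> aS dS.
have dSle i j : (i <= j)%N -> S j `<=` S i.
  elim: j => [|j IH]; first by rewrite leqn0 => /eqP ->.
  rewrite leq_eqVlt => /predU1P[->//|/IH h]; apply: subset_trans h.
  by have [] := dS j.
have ex i : exists ux : itp n * (nat -> C),
    [/\ S i ux.2, ev n ux.2 ux.1 != 0 & forall x, S i.+1 x -> ev n x ux.1 = 0].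
  have [_ /existsNP [x /not_implyP [Sx nSx]]] := dS i.
  have [ps hps] := aS i.+1; rewrite hps in nSx.
  have /existsNP [p /not_implyP [pin /eqP px]] := nSx.
  by exists (p, x); split => // y; rewrite hps; apply.
have [ux hux] := choice ex.
have [N [c hc]] := itp_noetherian (fun i => (ux i).1).
have [SN /negP + _] := hux N; apply; rewrite hc rmorph_sum big1 //= => i _.
rewrite rmorphM; have [_ _ ->] := hux i; first by rewrite mulr0.
exact: (dSle i.+1 N).
Qed.

(** A minimal dominant algebraic subset is irreducible: if neither part of a decomposition were
    dominant, the product of two nonzero polynomials, one for each part, would vanish on the whole
    set. *)
Lemma dominant_irri n S : algi n.+1 S -> dominant n S ->
  exists S1, [/\ S1 `<=` S, irri n.+1 S1 & dominant n S1].
Proof.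
move=> aS dS.
have [S1 [[S1S aS1 dS1] S1min]] : exists S1, [/\ S1 `<=` S, algi n.+1 S1 & dominant n S1] /\
    forall A, A `<=` S1 -> algi n.+1 A -> dominant n A -> A = S1.
  apply: contrapT => /forallNP h.
  pose T := {A : set (nat -> C) | [/\ A `<=` S, algi n.+1 A & dominant n A]}.
  have step (A : T) : exists B : T, sval B `<` sval A.
    case: A => A' AS; apply: contrapT => /forallNP nB; apply: (h A'); split => // B BA aB dB.
    apply: contrapT => BnA.
    have BS : [/\ B `<=` S, algi n.+1 B & dominant n B].
      by split => //; apply: subset_trans BA _; have [] := AS.
    apply: (nB (exist _ B BS)) => /=; split; first exact: BA.
    by move=> AB; apply: BnA; apply/seteqP.
  have [g hg] := choice step.
  have ST : [/\ S `<=` S, algi n.+1 S & dominant n S] by split.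
  apply: (@algi_dcc n.+1 (fun i => sval (iter i g (exist _ S ST)))) => i.
    by have [] := svalP (iter i g (exist _ S ST)).
  by rewrite iterS; exact: hg.
exists S1; split => //; split => //.
  apply: contrapT => /nonemptyPn S10; move/eqP: (oner_neq0 (itp n)); apply.
  by apply: dS1 => x; rewrite S10.
move=> A B aA aB SAB.
have [dA|/existsNP [Q /not_implyP [QA /eqP Q0]]] := pselect (dominant n A).
  by left; rewrite -(S1min A) // SAB; apply: subsetUl.
right; rewrite -(S1min B) // ?SAB; first exact: subsetUr.
move=> Q' Q'B; have : Q * Q' = 0.
  apply: dS1 => x; rewrite SAB => -[xA|xB]; rewrite rmorphM /=.
    by rewrite QA ?mul0r.
  by rewrite Q'B ?mulr0.
by move/eqP; rewrite mulf_eq0 (negbTE Q0) => /eqP.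
Qed.

(* A nonzero element of least degree in the vanishing ideal divides every other
   element after multiplication by a power of its leading coefficient, so that
   its roots lift generic points of the base to [S]. *)
Lemma dominant_lift n S : algi n.+1 S -> dominant n S ->
  exists2 c : itp n, c != 0 & forall y, ev n y c != 0 -> exists t, S (upd y n t).
Proof.
move=> [ps ->] dS; set S' := zeros ps in dS *.
have evu y t (c : itp n) : ev n (upd y n t) c = ev n y c.
  by apply: eq_ev => i lin; rewrite /upd ltn_eqF.
case: (pselect (exists2 g : {poly itp n}, g != 0 & forall x, S' x -> ev n.+1 x g = 0)); last first.
  (* No nonzero polynomial vanishes on [S'], so all equations are zero and every base point
     lifts. *)
  move=> /forall2NP h; exists 1; first exact: oner_neq0.
  move=> y _; exists 0 => p pin; have [/negP|] := h p.
    by rewrite negbK => /eqP ->; rewrite rmorph0.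
  by case=> x; apply.
move=> [g0 g00 g0S].
have ex : exists s, `[< exists g : {poly itp n}, [/\ g != 0, size g = s & forall x, S' x -> ev n.+1 x g = 0] >].
  by exists (size g0); apply/asboolP; exists g0.
case: (ex_minnP ex) => s /asboolP [g [gn0 sg gS]] hmin.
exists (lead_coef g); first by rewrite lead_coef_eq0.
move=> y hy.
(* Were [g] constant in the last variable, it would be a nonzero polynomial in the base variables
   vanishing on [S], against dominance. *)
have sg1 : (1 < size g)%N.
  rewrite ltnNge; apply: contra gn0 => /size1_polyC gE; rewrite gE.
  by rewrite (_ : g`_0 = 0) // ; apply: dS => x /gS; rewrite {1}gE ev_polyC.
pose gy := map_poly (ev n y) g.
have sgy : size gy = size g by rewrite size_map_poly_id0.
have [t ht] := closed_rootP gy ltac:(by rewrite sgy neq_ltn sg1 orbT).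
exists t => p pin.
have hgt : ev n.+1 (upd y n t) g = 0.
  rewrite evS /upd eqxx (eq_map_poly (g := ev n y)) => [|c]; last exact: evu.
  by apply/eqP.
have := Pdiv.Idomain.divp_eq (p : {poly itp n}) g; set k := scalp _ _ => hd.
have r0 : (p : {poly itp n}) %% g = 0.
  apply/eqP; apply: contraT => rn0.
  have := hmin (size ((p : {poly itp n}) %% g)); rewrite -sg leqNgt Pdiv.CommonIdomain.ltn_modp gn0 => h.
  suff : false by []. apply: h; apply/asboolP; exists ((p : {poly itp n}) %% g); split => // x xS.
  have -> : ((p : {poly itp n}) %% g) = lead_coef g ^+ k *: (p : {poly itp n}) - (p : {poly itp n}) %/ g * g.
    by rewrite hd addrC addKr.
  rewrite -mul_polyC rmorphB 2!rmorphM.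
  by rewrite (gS _ xS) (xS _ pin) !mulr0 subr0.
move: hd; rewrite r0 addr0 => /(congr1 (ev n.+1 (upd y n t))).
rewrite -mul_polyC [LHS]rmorphM [RHS]rmorphM hgt mulr0 ev_polyC.
move/eqP; rewrite mulf_eq0 evu rmorphXn expf_eq0 (negbTE hy) andbF /=.
by move/eqP.
Qed.

Section Slice.
Variables (m : nat) (t0 : C).

(** The sliced coordinate [m] is the last of the base variables 0, ..., m. The fibre variable [m.+1]
    moves into its place, so that a slice is again a set over a base with one variable fewer. *)
Definition slice_in (x : nat -> C) : nat -> C :=
  fun j => if (j < m)%N then x j else if j == m then t0 else x j.-1.

Definition slice_out (x : nat -> C) : nat -> C :=
  fun j => if (j < m)%N then x j else x j.+1.

Lemma slice_inK x : slice_out (slice_in x) = x.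
Proof.
apply/funext => j; rewrite /slice_out /slice_in.
case: ltnP => // mj.
by rewrite ltnNge (leq_trans mj) //= gtn_eqF.
Qed.

Lemma slice_outK x : x m = t0 -> slice_in (slice_out x) = x.
Proof.
move=> xm; apply/funext => j; rewrite /slice_out /slice_in.
case: ltngtP => // [mj|->//].
case: j mj => // j; rewrite ltnS /= => mj.
by rewrite ltnNge mj.
Qed.

Definition slice_poly (p : itp m.+2) : itp m.+1 :=
  map_poly (horner_eval (constp m t0)) (p : {poly {poly itp m}}).

Definition lift_poly (p : itp m.+1) : itp m.+2 :=
  map_poly (polyC : itp m -> {poly itp m}) (p : {poly itp m}).

Lemma ev_slice_poly x p : ev m.+1 x (slice_poly p) = ev m.+2 (slice_in x) p.
Proof.
rewrite evS /slice_poly -map_poly_comp evS /= {3}/slice_in.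
rewrite ltnNge leqnSn /= gtn_eqF //; congr (_.[_]).
apply: eq_map_poly => c /=; rewrite /horner_eval /=.
rewrite {2}/slice_in ltnn eqxx.
rewrite (eq_map_poly (g := ev m x)); last first.
  by move=> a; apply: eq_ev => i im; rewrite /slice_in im.
by rewrite -[t0 in RHS](ev_constp m x) horner_map.
Qed.

Lemma ev_lift_poly x p : ev m.+2 x (lift_poly p) = ev m.+1 (slice_out x) p.
Proof.
rewrite evS /lift_poly -map_poly_comp evS /= {2}/slice_out ltnn; congr (_.[_]).
apply: eq_map_poly => c /=; rewrite /horner_eval map_polyC hornerC.
by apply: eq_ev => i im; rewrite /slice_out im.
Qed.

Definition coord_poly : itp m.+2 := ('X - (constp m t0)%:P : {poly itp m})%:P.

Lemma ev_coord_poly x : ev m.+2 x coord_poly = x m - t0.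
Proof. by rewrite ev_polyC rmorphB ev_polyX ev_polyC ev_constp. Qed.

Lemma algi_slice S : algi m.+2 S -> algi m.+1 [set x | S (slice_in x)].
Proof.
move=> [ps ->]; exists (map slice_poly ps); apply/seteqP; split => x /= h p.
  by move=> /mapP [q qin ->]; rewrite ev_slice_poly; apply: h.
by move=> pin; rewrite -ev_slice_poly; apply: h; exact: map_f.
Qed.

Lemma algi_lift S : algi m.+1 S -> algi m.+2 [set x | x m = t0 /\ S (slice_out x)].
Proof.
move=> [ps ->]; exists (coord_poly :: map lift_poly ps); apply/seteqP; split => x /=.
  move=> [xm h] p; rewrite inE => /predU1P[->|/mapP [q qin ->]].
    by rewrite ev_coord_poly xm subrr.
  by rewrite ev_lift_poly; apply: h.
move=> h; split.
  by apply/eqP; rewrite -subr_eq0 -ev_coord_poly; apply/eqP; apply: h; rewrite mem_head.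
by move=> p pin; rewrite -ev_lift_poly; apply: h; rewrite inE map_f ?orbT.
Qed.

Lemma irri_lift S : irri m.+1 S -> irri m.+2 [set x | x m = t0 /\ S (slice_out x)].
Proof.
move=> [aS [x0 Sx0] iS]; split; first exact: algi_lift.
  by exists (slice_in x0); rewrite /= slice_inK /slice_in ltnn eqxx.
have sub D : D `<=` [set x | x m = t0 /\ S (slice_out x)] ->
    S = [set x | D (slice_in x)] -> [set x | x m = t0 /\ S (slice_out x)] = D.
  move=> DZ SE; apply/seteqP; split => // x [xm]; rewrite SE /=.
  by rewrite slice_outK.
move=> A B aA aB ZAB.
have [|SA|SB] := iS _ _ (algi_slice aA) (algi_slice aB).
- apply/seteqP; split => x /=.
    move=> Sx; have : (A `|` B) (slice_in x).
      by rewrite -ZAB /= slice_inK /slice_in ltnn eqxx.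
    by [].
  move=> h; have : [set x | x m = t0 /\ S (slice_out x)] (slice_in x) by rewrite ZAB.
  by rewrite /= slice_inK => -[].
- by left; apply: sub => //; rewrite ZAB; apply: subsetUl.
- by right; apply: sub => //; rewrite ZAB; apply: subsetUr.
Qed.

End Slice.

(** Shrink to an irreducible dominant set and slice it at a value [t0] where the coefficient [c] of
    [dominant_lift] does not become the zero polynomial. The slice is still dominant, so induction
    gives a chain inside it, and the irreducible set itself goes on top. *)
Lemma dominant_chain m S : algi m.+1 S -> dominant m S -> chaini m.+1 S m.
Proof.
elim: m S => [|m IH] S aS dS.
  have [S1 [S1S iS1 dS1]] := dominant_irri aS dS.
  by exists (fun=> S1); split.
have [S1 [S1S iS1 dS1]] := dominant_irri aS dS.
have aS1 : algi m.+2 S1 by case: iS1.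
have [c c0 hc] := dominant_lift aS1 dS1.
have constpI : injective (fun i : nat => constp m i%:R).
  move=> i j /(congr1 (ev m (fun=> 0))); rewrite !ev_constp => /eqP.
  by rewrite eqr_nat => /eqP.
have [N hN] := poly_nonroot (p := (c : {poly itp m})) constpI c0.
set t0 : C := N%:R in hN.
have [|c' [hc' sc']] := IH [set x | S1 (slice_in m t0 x)] (algi_slice t0 aS1).
  (* Base points where c(., t0) is nonzero lift to the slice, so Q vanishes there; the product then
     vanishes everywhere. *)
  move=> Q QS; have : Q * (c : {poly itp m}).[constp m t0] = 0.
    apply: ev_eq0 => y; rewrite rmorphM /=.
    have [->|e0] := eqVneq (ev m y (c : {poly itp m}).[constp m t0]) 0; first by rewrite mulr0.
    suff [t ht] : exists t, S1 (slice_in m t0 (upd y m t)).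
      rewrite -(eq_ev (x := upd y m t)) ?(QS _ ht) ?mul0r // => i im.
      by rewrite /upd ltn_eqF.
    have [|t ht] := hc (upd y m t0).
      rewrite evS /upd eqxx (eq_map_poly (g := ev m y)) => [|a]; last first.
        by apply: eq_ev => i im; rewrite ltn_eqF.
      by rewrite -[X in _.[X]](ev_constp m y) horner_map.
    exists t; apply: algi_ext aS1 _ ht => j; rewrite ltnS leq_eqVlt => /predU1P[->|jm].
      by rewrite /upd /slice_in eqxx ltnNge leqnSn /= gtn_eqF //= eqxx.
    rewrite /upd /slice_in (ltn_eqF jm); by move: jm; rewrite ltnS; case: ltngtP.
  by move/eqP; rewrite mulf_eq0 -[X in _ || X]/(root _ _) (negbTE hN) orbF => /eqP.
pose Z i := [set x : nat -> C | x m = t0 /\ c' i (slice_out m x)].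
have ZS i : (i <= m)%N -> Z i `<=` S1.
  move=> im x [xm cx]; have [_ /(_ _ cx) /=] := hc' _ im.
  by rewrite slice_outK.
exists (fun i => if (i <= m)%N then Z i else S1); split => i.
  case: ifP => im _; last by [].
  split; last exact: subset_trans (ZS _ im) S1S.
  by apply: irri_lift; case: (hc' _ im).
rewrite ltnS => im; rewrite im; case: ltnP => im1.
  have [sub nsub] := sc' _ im1; split.
    by move=> x [xm cx]; split => //; apply: sub.
  move=> h; apply: nsub => x cx.
  have [] := h (slice_in m t0 x); last by rewrite slice_inK.
  by split; rewrite ?slice_inK // /slice_in ltnn eqxx.
have -> : i = m by apply/eqP; rewrite eqn_leq im.
split; first exact: ZS.
(* If the slice were all of [S1], the base polynomial x_m - t0 would vanish on a dominant set. *)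
move=> h; have : ('X - (constp m t0)%:P : {poly itp m}) = 0; last first.
  by move/eqP; rewrite polyXsubC_eq0.
apply: dS1 => x /h [xm _].
by rewrite rmorphB ev_polyX ev_polyC ev_constp xm subrr.
Qed.

End IteratedPolynomials.

(** * Polynomial maps of C^k *)

Section Modulus.
Variable R : realType.
Implicit Types x y : R[i].

(** The norm on [R[i]] takes its values in [R[i]]; estimates need a modulus with values in [R]. *)
Definition cmod x : R := Normc.normc x.

Lemma cmodE x : cmod x = Num.sqrt (complex.Re x ^+ 2 + complex.Im x ^+ 2).
Proof. by case: x. Qed.
Lemma sqr_cmod x : cmod x ^+ 2 = complex.Re x ^+ 2 + complex.Im x ^+ 2.
Proof. by rewrite cmodE sqr_sqrtr // addr_ge0 // sqr_ge0. Qed.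
Lemma cmod_ge0 x : 0 <= cmod x. Proof. by rewrite cmodE sqrtr_ge0. Qed.
Lemma cmodM : {morph cmod : x y / x * y}. Proof. exact: Normc.normcM. Qed.
Lemma cmodD x y : cmod (x + y) <= cmod x + cmod y. Proof. exact: le_normcD. Qed.
Lemma cmodN x : cmod (- x) = cmod x. Proof. exact: normcN. Qed.
Lemma cmod0 : cmod 0 = 0. Proof. by rewrite cmodE /= expr0n addr0 sqrtr0. Qed.
Lemma cmod1 : cmod 1 = 1. Proof. by rewrite cmodE /= expr0n expr1n addr0 sqrtr1. Qed.
Lemma cmodB x y : cmod (x - y) <= cmod x + cmod y.
Proof. by rewrite -(cmodN y) cmodD. Qed.
Lemma cmodX n x : cmod (x ^+ n) = cmod x ^+ n.
Proof. by elim: n => [|n IH]; rewrite ?expr0 ?cmod1 // !exprS cmodM IH. Qed.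
Lemma cmod_eq0 x : (cmod x == 0) = (x == 0).
Proof. by apply/eqP/eqP => [/Normc.eq0_normc|->] //; exact: cmod0. Qed.
Lemma cmod_gt0 x : (0 < cmod x) = (x != 0).
Proof. by rewrite lt0r cmod_ge0 andbT cmod_eq0. Qed.
Lemma cmod_real (r : R) : cmod r%:C%C = `|r|.
Proof. by rewrite cmodE /= expr0n addr0 sqrtr_sqr. Qed.
Lemma cmod_lbD x y : cmod x - cmod y <= cmod (x + y).
Proof.
by rewrite lerBlDr -{1}(addrK y x) (le_trans (cmodB _ _)).
Qed.
Lemma cmod_sum I (s : seq I) (P : pred I) (F : I -> R[i]) :
  cmod (\sum_(i <- s | P i) F i) <= \sum_(i <- s | P i) cmod (F i).
Proof.
elim/big_ind2: _ => [|x a y b hx hy|//]; first by rewrite cmod0.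
by apply: le_trans (cmodD _ _) _; exact: lerD.
Qed.
Lemma cmod_prod I (s : seq I) (P : pred I) (F : I -> R[i]) :
  cmod (\prod_(i <- s | P i) F i) = \prod_(i <- s | P i) cmod (F i).
Proof. by apply: (big_morph cmod cmodM cmod1). Qed.
Lemma Re_le_cmod x : `|complex.Re x| <= cmod x.
Proof. by rewrite cmodE -sqrtr_sqr ler_wsqrtr // lerDl sqr_ge0. Qed.
Lemma Im_le_cmod x : `|complex.Im x| <= cmod x.
Proof. by rewrite cmodE -sqrtr_sqr ler_wsqrtr // lerDr sqr_ge0. Qed.
Lemma cmod_le_ReIm x : cmod x <= `|complex.Re x| + `|complex.Im x|.
Proof.
rewrite cmodE -[leRHS]ger0_norm ?addr_ge0 // -sqrtr_sqr ler_wsqrtr //.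
by rewrite sqrrD !real_normK ?num_real // addrAC lerDl mulrn_wge0 // mulr_ge0.
Qed.

Lemma cReD x y : complex.Re (x + y) = complex.Re x + complex.Re y.
Proof. by case: x => a b; case: y. Qed.
Lemma cImD x y : complex.Im (x + y) = complex.Im x + complex.Im y.
Proof. by case: x => a b; case: y. Qed.
Lemma cReM x y : complex.Re (x * y) = complex.Re x * complex.Re y - complex.Im x * complex.Im y.
Proof. by case: x => a b; case: y. Qed.
Lemma cImM x y : complex.Im (x * y) = complex.Re x * complex.Im y + complex.Im x * complex.Re y.
Proof. by case: x => a b; case: y. Qed.
End Modulus.

Section Coordinates.
Variable R : realType.
Local Notation C := R[i].

(** Indexing by [nat] lets i and i + 1 be used without casts. Out of range [inord] gives coordinate
    0, so norm bounds hold for every index. *)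
Definition co k (z : Cpt R k.+1) (j : nat) : C :=
  (z.1 0 (inord j) +i* z.2 0 (inord j))%C.

Definition mk k (x : nat -> C) : Cpt R k.+1 :=
  (\row_j complex.Re (x j), \row_j complex.Im (x j)).

Lemma co_mk k x j : (j < k.+1)%N -> co (mk k x) j = x j.
Proof. by move=> jk; rewrite /co !mxE inordK //; case: (x j). Qed.

Lemma mk_co k (z : Cpt R k.+1) : mk k (co z) = z.
Proof.
case: z => a b; congr pair; apply/rowP => j; rewrite !mxE /= inord_val //.
Qed.

Lemma toCE k (z : Cpt R k.+1) (j : 'I_k.+1) : toC z j = co z j.
Proof. by rewrite /toC /co inord_val. Qed.

Lemma eq_mk k x y : (forall j, (j < k.+1)%N -> x j = y j) -> mk k x = mk k y.
Proof.
by move=> xy; rewrite /mk; congr pair; apply/rowP => j; rewrite !mxE xy.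
Qed.

Lemma co_inj k (z w : Cpt R k.+1) : (forall j, (j < k.+1)%N -> co z j = co w j) -> z = w.
Proof. by move=> h; rewrite -(mk_co z) -(mk_co w); apply: eq_mk. Qed.

(** Differentiability, local bounds and restriction to discs are then all proved by induction on the
    four constructors. *)
Inductive cpoly k : (Cpt R k.+1 -> C) -> Prop :=
| cpoly_cst c : cpoly (fun=> c)
| cpoly_co j : (j < k.+1)%N -> cpoly (fun z => co z j)
| cpolyD f g : cpoly f -> cpoly g -> cpoly (fun z => f z + g z)
| cpolyM f g : cpoly f -> cpoly g -> cpoly (fun z => f z * g z).

Lemma cpolyX k (f : Cpt R k.+1 -> C) n : cpoly f -> cpoly (fun z => f z ^+ n).
Proof.
move=> pf; elim: n => [|n IH]; first exact: cpoly_cst.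
by under eq_fun do rewrite exprS; apply: cpolyM.
Qed.

Lemma cpolyN k (f : Cpt R k.+1 -> C) : cpoly f -> cpoly (fun z => - f z).
Proof.
move=> pf; under eq_fun do rewrite -mulN1r.
by apply: cpolyM => //; exact: cpoly_cst.
Qed.

Lemma cpolyB k (f g : Cpt R k.+1 -> C) : cpoly f -> cpoly g -> cpoly (fun z => f z - g z).
Proof. by move=> pf pg; apply: cpolyD => //; exact: cpolyN. Qed.

Lemma cpoly_sum k I (s : seq I) (F : I -> Cpt R k.+1 -> C) :
  (forall i, cpoly (F i)) -> cpoly (fun z => \sum_(i <- s) F i z).
Proof.
move=> pF; elim: s => [|i s IH].
  by under eq_fun do rewrite big_nil; exact: cpoly_cst.
by under eq_fun do rewrite big_cons; apply: cpolyD.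
Qed.

Lemma cpoly_prod k I (s : seq I) (F : I -> Cpt R k.+1 -> C) :
  (forall i, cpoly (F i)) -> cpoly (fun z => \prod_(i <- s) F i z).
Proof.
move=> pF; elim: s => [|i s IH].
  by under eq_fun do rewrite big_nil; exact: cpoly_cst.
by under eq_fun do rewrite big_cons; apply: cpolyM.
Qed.

Lemma cpoly_ev k n (X : Cpt R k.+1 -> nat -> C) (p : itp C n) :
  (forall j, (j < n)%N -> cpoly (X ^~ j)) -> cpoly (fun z => ev n (X z) p).
Proof.
elim: n p => [|n IH] p pX; first exact: cpoly_cst.
under eq_fun do rewrite ev_sum.
apply: cpoly_sum => i; apply: cpolyM; last by apply: cpolyX; exact: pX.
by apply: IH => j jn; apply: pX; exact: ltnW.
Qed.

Lemma ev_cpoly k (f : Cpt R k.+1 -> C) : cpoly f ->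
  exists p : itp C k.+1, forall x, f (mk k x) = ev k.+1 x p.
Proof.
have coordp n j : (j < n)%N -> exists p : itp C n, forall x, ev n x p = x j.
  elim: n => // n IH; rewrite ltnS leq_eqVlt => /predU1P[->|/IH [p hp]].
    by exists ('X : {poly itp C n}) => x; rewrite ev_polyX.
  by exists (p%:P : {poly itp C n}) => x; rewrite ev_polyC.
elim=> [c|j jk|{}f g _ [p hp] _ [q hq]|{}f g _ [p hp] _ [q hq]].
- by exists (constp k.+1 c) => x; rewrite ev_constp.
- by have [p hp] := coordp _ _ jk; exists p => x; rewrite co_mk.
- by exists (p + q) => x; rewrite rmorphD hp hq.
- by exists (p * q) => x; rewrite rmorphM hp hq.
Qed.

Lemma cpoly_meval k (q : mpoly.mpoly k.+1 C) : cpoly (fun z => mpoly.meval (toC z) q).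
Proof.
have [s hs] := PolynomialFunctions.meval_sum_prod q.
under eq_fun do rewrite hs.
apply: cpoly_sum => m; apply: cpolyM; first exact: cpoly_cst.
apply: cpoly_prod => i; apply: cpolyX.
by under eq_fun do rewrite toCE; apply: cpoly_co.
Qed.

Lemma meval_cpoly k (f : Cpt R k.+1 -> C) : cpoly f ->
  exists q : mpoly.mpoly k.+1 C, forall z, mpoly.meval (toC z) q = f z.
Proof.
elim=> [c|j jk|{}f g _ [p hp] _ [q hq]|{}f g _ [p hp] _ [q hq]].
- have [q hq] := @PolynomialFunctions.meval_cst_ex C k.+1 c.
  by exists q => z; exact: hq.
- have [q hq] := PolynomialFunctions.meval_coord_ex C (Ordinal jk).
  by exists q => z; rewrite hq toCE.
- have [r hr] := PolynomialFunctions.meval_add_ex p q.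
  by exists r => z; rewrite hr hp hq.
- have [r hr] := PolynomialFunctions.meval_mul_ex p q.
  by exists r => z; rewrite hr hp hq.
Qed.

Definition polymap k l (T : Cpt R k.+1 -> Cpt R l.+1) :=
  forall j, (j < l.+1)%N -> cpoly (fun z => co (T z) j).

Lemma cpoly_comp k l (T : Cpt R k.+1 -> Cpt R l.+1) (f : Cpt R l.+1 -> C) :
  polymap T -> cpoly f -> cpoly (fun z => f (T z)).
Proof.
move=> pT; elim=> [c|j jk|{}f g _ pf _ pg|{}f g _ pf _ pg].
- exact: cpoly_cst.
- exact: pT.
- exact: cpolyD.
- exact: cpolyM.
Qed.

Lemma polymap_comp k l m (T : Cpt R k.+1 -> Cpt R l.+1) (S : Cpt R l.+1 -> Cpt R m.+1) :
  polymap T -> polymap S -> polymap (fun z => S (T z)).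
Proof. by move=> pT pS j jm; apply: (cpoly_comp pT (pS j jm)). Qed.

Lemma polymap_mk k l (X : nat -> Cpt R k.+1 -> C) :
  (forall j, (j < l.+1)%N -> cpoly (X j)) -> polymap (fun z => mk l (X ^~ z)).
Proof. by move=> pX j jl; under eq_fun do rewrite co_mk //; exact: pX. Qed.

Definition polyauto k (T S : Cpt R k.+1 -> Cpt R k.+1) :=
  [/\ polymap T, polymap S, cancel T S & cancel S T].

Lemma polyauto_comp k (T S T' S' : Cpt R k.+1 -> Cpt R k.+1) :
  polyauto T S -> polyauto T' S' -> polyauto (fun z => T' (T z)) (fun z => S (S' z)).
Proof.
move=> [pT pS TS ST] [pT' pS' TS' ST']; split.
- exact: polymap_comp.
- exact: polymap_comp.
- by move=> z; rewrite TS' TS.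
- by move=> z; rewrite ST ST'.
Qed.

Lemma polyauto_id k : polyauto (@idfun (Cpt R k.+1)) idfun.
Proof. by split=> // j jk; exact: cpoly_co. Qed.

Lemma alg_set_pull k (T : Cpt R k.+1 -> Cpt R k.+1) D : polymap T -> algi k.+1 D ->
  alg_set [set z | D (co (T z))].
Proof.
move=> pT [ps ->].
have exq (p : itp C k.+1) : exists q : mpoly.mpoly k.+1 C,
    forall z, mpoly.meval (toC z) q = ev k.+1 (co (T z)) p.
  by apply: meval_cpoly; apply: cpoly_ev => j jk; apply: pT.
have [q hq] := choice exq.
exists (map q ps); apply/seteqP; split => z /= h.
  by rewrite all_map; apply/allP => p pin /=; rewrite hq h.
move=> p pin; rewrite -hq; apply/eqP.
by move: h; rewrite all_map => /allP /(_ _ pin).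
Qed.

Lemma algi_push k (S : Cpt R k.+1 -> Cpt R k.+1) A : polymap S -> alg_set A ->
  algi k.+1 [set x | A (S (mk k x))].
Proof.
move=> pS [qs ->]; elim: qs => [|q qs [ps hps]].
  by exists [::]; apply/seteqP; split.
have [p hp] := ev_cpoly (cpoly_comp pS (cpoly_meval q)).
exists (p :: ps); apply/seteqP; split => x /=.
  move=> /andP [/eqP hq hqs] r; rewrite inE => /predU1P[->|rin]; first by rewrite -hp.
  have : zeros ps x by rewrite -hps.
  exact.
move=> h; apply/andP; split; first by rewrite hp h // mem_head.
have : zeros ps x by move=> r rin; apply: h; rewrite inE rin orbT.
by rewrite -hps.
Qed.

(** The codimension is used here: if the image of [V] under [T] were dominant over the first [k]
    coordinates, the chain of [dominant_chain], carried back by the automorphism, would be a chain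
    of length [k] in [V]. *)
Lemma has_chain_or_relation k (V : set (Cpt R k.+1)) T S :
  alg_set V -> ~ has_chain V k -> polyauto T S ->
  exists2 Q : itp C k, Q != 0 & forall z, V z -> ev k (co (T z)) Q = 0.
Proof.
move=> aV nV [pT pS TS ST].
have aW := algi_push pS aV; set W := [set x | _] in aW.
have [dW|/existsNP [Q /not_implyP [QW /eqP Q0]]] := pselect (dominant k W); last first.
  by exists Q => // z Vz; apply: QW; rewrite /W /= mk_co TS.
case: nV; have [c [ic sc]] := dominant_chain aW dW.
have ext i x : (i <= k)%N -> c i x -> c i (co (T (S (mk k x)))).
  move=> ik cx; have [[aci _ _] _] := ic _ ik.
  by apply: algi_ext aci _ cx => j jk; rewrite ST co_mk.
exists (fun i => [set z | c i (co (T z))]); split => i ik; last first.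
  have [sub nsub] := sc _ ik; split => [z /sub//|h].
  apply: nsub => x cx; have /= h1 := h (S (mk k x)) (ext _ _ ik cx).
  have [[aci _ _] _] := ic _ (ltnW ik).
  by apply: algi_ext aci _ h1 => j jk; rewrite ST co_mk.
have [[aci [x0 cx0] irr] sub] := ic _ ik; split; last first.
  by move=> z /= /sub; rewrite /W /= mk_co TS.
split; first exact: alg_set_pull.
  by exists (S (mk k x0)); exact: ext.
move=> A B aA aB ZAB.
have back (D : set (Cpt R k.+1)) : c i = [set x | D (S (mk k x))] ->
    [set z | c i (co (T z))] = D.
  by move=> ->; apply/seteqP; split => z /=; rewrite mk_co TS.
have [|cA|cB] := irr _ _ (algi_push pS aA) (algi_push pS aB).
- apply/seteqP; split => x /=.
    by move=> /(ext _ _ ik) h; have : (A `|` B) (S (mk k x)) by rewrite -ZAB.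
  move=> h; have : [set z | c i (co (T z))] (S (mk k x)) by rewrite ZAB.
  by move=> /= h1; apply: algi_ext aci _ h1 => j jk; rewrite ST co_mk.
- by left; apply: back.
- by right; apply: back.
Qed.

End Coordinates.

(** * Coordinates adapted to the variety *)

Section Growth.
Variable R : realType.
Local Notation C := R[i].

Lemma le_pow2 (M : R) : exists e, forall s : R, 2 <= s -> M <= s ^+ e.
Proof.
exists (Num.bound `|M|) => s s2.
have h : M <= (Num.bound `|M|)%:R by apply: ltW; apply: le_lt_trans (ler_norm _) _; apply: archi_boundP.
apply: le_trans h _; apply: (@le_trans _ _ (2 ^+ Num.bound `|M|)).
  by rewrite -natrX ler_nat ltnW // ltn_expl.
by apply: lerXn2r; rewrite // nnegrE; lra.
Qed.

Lemma pow_addl (s : R) a b : 2 <= s -> s ^+ a + s ^+ b <= s ^+ (maxn a b).+1.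
Proof.
move=> s2; rewrite exprS.
have s1 : 1 <= s by lra.
have := ler_weXn2l s1 (leq_maxl a b); have := ler_weXn2l s1 (leq_maxr a b).
have : 0 <= s ^+ maxn a b by apply: exprn_ge0; lra.
nra.
Qed.

(* [f] grows at most like [t ^ D] in [t = |x_0|], with a coefficient that is
   polynomial in a bound [s] of the other coordinates. *)
Definition grows (D : nat) (f : (nat -> C) -> R) := exists E, forall x (s : R),
  2 <= s -> 1 <= cmod (x 0%N) -> (forall j, (0 < j)%N -> cmod (x j) <= s) ->
  f x <= s ^+ E * cmod (x 0%N) ^+ D.

Lemma growsD D f g : grows D f -> grows D g -> grows D (fun x => f x + g x).
Proof.
move=> [E hE] [F hF]; exists (maxn E F).+1 => x s s2 t1 xs.
apply: le_trans (lerD (hE _ _ s2 t1 xs) (hF _ _ s2 t1 xs)) _.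
by rewrite -mulrDl; apply: ler_wpM2r; [exact/exprn_ge0/cmod_ge0|exact: pow_addl].
Qed.

Lemma growsM D D' f g : (forall x, 0 <= f x) -> (forall x, 0 <= g x) ->
  grows D f -> grows D' g -> grows (D + D') (fun x => f x * g x).
Proof.
move=> f0 g0 [E hE] [F hF]; exists (E + F)%N => x s s2 t1 xs.
rewrite !exprD mulrACA; apply: ler_pM => //.
- exact: hE.
- exact: hF.
Qed.

Lemma growsW D D' f : (D <= D')%N -> grows D f -> grows D' f.
Proof.
move=> DD [E hE]; exists E => x s s2 t1 xs; apply: le_trans (hE _ _ s2 t1 xs) _.
by rewrite ler_wpM2l ?exprn_ge0 ?ler_weXn2l //; lra.
Qed.

Lemma grows_le D f g : (forall x, f x <= g x) -> grows D g -> grows D f.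
Proof.
by move=> fg [E hE]; exists E => x s s2 t1 xs; apply: le_trans (fg x) (hE _ _ s2 t1 xs).
Qed.

Lemma grows_cst D c : grows D (fun=> c).
Proof.
apply: (@growsW 0) => //; have [e he] := le_pow2 c.
by exists e => x s s2 _ _; rewrite expr0 mulr1 he.
Qed.

Lemma grows_sum D n (F : nat -> (nat -> C) -> R) : (forall i, (i < n)%N -> grows D (F i)) ->
  grows D (fun x => \sum_(i < n) F i x).
Proof.
elim: n => [|n IH] h; first by under eq_fun do rewrite big_ord0; exact: grows_cst.
under eq_fun do rewrite big_ord_recr /=.
by apply: growsD; [apply: IH => i lin; apply: h; exact: ltnW|exact: h].
Qed.

Lemma grows_t n : grows n (fun x => cmod (x 0%N) ^+ n).
Proof. by exists 0%N => x s _ _ _; rewrite expr0 mul1r. Qed.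

Lemma grows_coord j : (0 < j)%N -> grows 0 (fun x => cmod (x j)).
Proof. by move=> j0; exists 1%N => x s _ _ xs; rewrite expr1 expr0 mulr1 xs. Qed.

Lemma growsX D f n : (forall x, 0 <= f x) -> grows D f -> grows (D * n) (fun x => f x ^+ n).
Proof.
move=> f0 gf; elim: n => [|n IH].
  by under eq_fun do rewrite expr0; exact: grows_cst.
under eq_fun do rewrite exprS; rewrite mulnS; apply: growsM => // x.
exact: exprn_ge0.
Qed.

(** The substitution of Noether normalisation: for suitable exponents a nonzero polynomial becomes a
    constant times a power of [x 0], up to terms of lower order. *)
Definition shear (r : nat -> nat) (x : nat -> C) : nat -> C :=
  fun j => if j == 0%N then x 0%N else x j + x 0%N ^+ r j.

Lemma grows_shear r j : exists D, grows D (fun x => cmod (shear r x j)).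
Proof.
case: j => [|j]; first by exists 1%N; exact: (grows_t 1).
exists (r j.+1); apply: (grows_le (fun x => cmodD _ _)).
apply: growsD; first exact: growsW (grows_coord _).
by under eq_fun do rewrite cmodX; exact: grows_t.
Qed.

Lemma grows_ev r n (p : itp C n) : exists D, grows D (fun x => cmod (ev n (shear r x) p)).
Proof.
elim: n p => [|n IH] p; first by exists 0%N; exact: grows_cst.
have [Dn hDn] := grows_shear r n.
have [B hB] := choice (fun i : nat => IH ((p : {poly itp C n})`_i)).
pose N := size (p : {poly itp C n}).
exists (\sum_(i < N) (B i + Dn * i))%N.
apply: (@grows_le _ _ (fun x => \sum_(i < N)
   (cmod (ev n (shear r x) ((p : {poly itp C n})`_i)) * cmod (shear r x n) ^+ i))).
  move=> x; rewrite ev_sum; apply: le_trans (cmod_sum _ _ _) _.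
  by apply: ler_sum => i _; rewrite cmodM cmodX.
apply: (@grows_sum _ N (fun i x => cmod (ev n (shear r x) ((p : {poly itp C n})`_i))
   * cmod (shear r x n) ^+ i)) => i iN.
apply: (@growsW (B i + Dn * i)); first by rewrite (bigD1 (Ordinal iN)) //= leq_addr.
apply: growsM; try by move=> x; rewrite ?exprn_ge0 ?cmod_ge0.
  exact: hB.
by apply: growsX => // x; exact: cmod_ge0.
Qed.

Lemma grows_uniform n (F : nat -> (nat -> C) -> R) : (forall i, exists D, grows D (F i)) ->
  exists D, forall i, (i < n)%N -> grows D (F i).
Proof.
move=> h; have [B hB] := choice h; exists (\sum_(i < n) B i)%N => i lin.
by apply: growsW (hB i); rewrite (bigD1 (Ordinal lin)) //= leq_addr.
Qed.

Lemma subrXX_cmod (u v : C) n : u ^+ n - v ^+ n = (u - v) * \sum_(i < n) u ^+ (n.-1 - i) * v ^+ i.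
Proof. by rewrite subrXX. Qed.

Lemma ev_sum_recr n (p : {poly itp C n}) e x : size p = e.+1 ->
  ev n.+1 x p = \sum_(i < e) ev n x p`_i * x n ^+ i + ev n x (lead_coef p) * x n ^+ e.
Proof. by move=> sp; rewrite ev_sum sp big_ord_recr lead_coefE sp. Qed.

Lemma leading_split (S a U c T V : C) :
  S + a * U - c * (T * V) = S + (a - c * T) * U + c * T * (U - V).
Proof. ring. Qed.

(* With the exponent of the last variable chosen larger than the growth of all the
   coefficients, the leading term in [x_0] comes from the leading coefficient only. *)
Lemma shear_leading n (Q : itp C n.+1) : Q != 0 -> exists r D (c : C),
  c != 0 /\ grows D (fun x => cmod (ev n.+1 (shear r x) Q - c * x 0%N ^+ D) * cmod (x 0%N)).
Proof.
elim: n Q => [|n IH] Q Q0.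
  pose q : {poly C} := Q; pose D := (size q).-1.
  have sq : size q = D.+1 by rewrite prednK // size_poly_gt0.
  exists (fun=> 0%N), D, (lead_coef q); split; first by rewrite lead_coef_eq0.
  apply: (@grows_le _ _ (fun x => (\sum_(i < D) cmod (q`_i) * cmod (x 0%N) ^+ i) * cmod (x 0%N))).
    move=> x; rewrite ler_wpM2r ?cmod_ge0 // ev_sum -/q sq big_ord_recr /= -/q.
    rewrite -[shear _ x 0%N]/(x 0%N) lead_coefE sq /= addrK.
    apply: le_trans (cmod_sum _ _ _) _.
    by apply: ler_sum => i _; rewrite cmodM cmodX.
  under eq_fun do rewrite mulr_suml.
  apply: (@grows_sum _ D (fun i x => cmod q`_i * cmod (x 0%N) ^+ i * cmod (x 0%N))) => i iD.
  apply: (@growsW (0 + i + 1)); first by rewrite add0n addn1.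
  apply: growsM; try by move=> x; rewrite ?mulr_ge0 ?exprn_ge0 ?cmod_ge0.
    apply: growsM; try by move=> x; rewrite ?exprn_ge0 ?cmod_ge0.
      exact: grows_cst.
    exact: grows_t.
  exact: (grows_t 1).
pose q : {poly itp C n.+1} := Q; pose e := (size q).-1.
have sq : size q = e.+1 by rewrite prednK // size_poly_gt0.
have [r [D [c [c0 hD]]]] := IH (lead_coef q) ltac:(by rewrite lead_coef_eq0).
have [B hB] := grows_uniform e (fun i => grows_ev r q`_i).
pose rho := B.+1.
pose r' j := if j == n.+1 then rho else r j.
have evr x (a : itp C n.+1) : ev n.+1 (shear r' x) a = ev n.+1 (shear r x) a.
  by apply: eq_ev => i lin; rewrite /shear /r' (ltn_eqF lin).
pose u x : C := x n.+1 + x 0%N ^+ rho.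
have ur x : shear r' x n.+1 = u x by rewrite /shear /r' eqxx.
have gu : grows rho (fun x => cmod (u x)).
  apply: (grows_le (fun x => cmodD _ _)); apply: growsD.
    exact: growsW (grows_coord _).
  by under eq_fun do rewrite cmodX; exact: grows_t.
exists r', (D + rho * e)%N, c; split => //.
(* [t1] bounds the lower powers of the last variable, [t2] the error in the leading coefficient, and
   [t3] the replacement of u^e by a pure power of x_0. *)
pose t1 x := \sum_(i < e) (cmod (ev n.+1 (shear r x) q`_i) * cmod (u x) ^+ i * cmod (x 0%N)).
pose t2 x := cmod (ev n.+1 (shear r x) (lead_coef q) - c * x 0%N ^+ D) * cmod (x 0%N) * cmod (u x) ^+ e.
pose t3 x := cmod c * cmod (x 0%N) ^+ D * (\sum_(i < e) (cmod (x n.+1) * (cmod (u x) ^+ (e.-1 - i) * cmod (x 0%N) ^+ (rho * i)) * cmod (x 0%N))).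
apply: (@grows_le _ _ (fun x => t1 x + t2 x + t3 x)) => [x|].
  rewrite (ev_sum_recr _ sq) ur evr.
  set a := ev _ _ (lead_coef q); set t := x 0%N.
  have -> : \sum_(i < e) ev n.+1 (shear r' x) q`_i * u x ^+ i + a * u x ^+ e - c * t ^+ (D + rho * e)
     = \sum_(i < e) ev n.+1 (shear r x) q`_i * u x ^+ i + (a - c * t ^+ D) * u x ^+ e
       + c * t ^+ D * (u x ^+ e - (t ^+ rho) ^+ e).
    under eq_bigr do rewrite evr.
    by rewrite exprD exprM; apply: leading_split.
  apply: le_trans (ler_wpM2r (cmod_ge0 _) (cmodD _ _)) _.
  rewrite mulrDl; apply: lerD.
    apply: le_trans (ler_wpM2r (cmod_ge0 _) (cmodD _ _)) _.
    rewrite mulrDl; apply: lerD.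
      rewrite /t1 -mulr_suml ler_wpM2r ?cmod_ge0 //; apply: le_trans (cmod_sum _ _ _) _.
      by apply: ler_sum => i _; rewrite cmodM cmodX.
    by rewrite cmodM cmodX mulrAC.
  rewrite /t3 -mulr_suml cmodM [cmod (c * _)]cmodM cmodX -[leLHS]mulrA ler_wpM2l ?mulr_ge0 ?exprn_ge0 ?cmod_ge0 //.
  rewrite ler_wpM2r ?cmod_ge0 // subrXX_cmod mulr_sumr; apply: le_trans (cmod_sum _ _ _) _.
  apply: ler_sum => i _.
  have -> : u x - t ^+ rho = x n.+1 by rewrite /u addrK.
  by rewrite !cmodM !cmodX exprM.
apply: growsD; first apply: growsD.
- apply: (@grows_sum _ e (fun i x => cmod (ev n.+1 (shear r x) q`_i) * cmod (u x) ^+ i * cmod (x 0%N))) => i ie.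
  apply: (@growsW (B + rho * i + 1)).
    have : (rho * i.+1 <= rho * e)%N by rewrite leq_mul2l ie orbT.
    by rewrite mulnS /rho; lia.
  apply: growsM; try by move=> x; rewrite ?mulr_ge0 ?exprn_ge0 ?cmod_ge0.
    apply: growsM; try by move=> x; rewrite ?exprn_ge0 ?cmod_ge0.
      exact: hB.
    by apply: growsX => // x; rewrite cmod_ge0.
  exact: (grows_t 1).
- apply: growsM; try by move=> x; rewrite ?mulr_ge0 ?exprn_ge0 ?cmod_ge0.
    exact: hD.
  by apply: growsX => // x; rewrite cmod_ge0.
- apply: growsM.
  + by move=> x; rewrite ?mulr_ge0 ?exprn_ge0 ?cmod_ge0.
  + by move=> x; apply: sumr_ge0 => i _; rewrite ?mulr_ge0 ?exprn_ge0 ?cmod_ge0.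
  + apply: (@growsM 0); try by move=> x; rewrite ?exprn_ge0 ?cmod_ge0.
      exact: grows_cst.
    exact: grows_t.
  + apply: (@grows_sum _ e (fun i x => cmod (x n.+1) * (cmod (u x) ^+ (e.-1 - i) * cmod (x 0%N) ^+ (rho * i)) * cmod (x 0%N))) => i ie.
    apply: (@growsW (0 + (rho * (e.-1 - i) + rho * i) + 1)).
      by rewrite -mulnDr add0n subnK; [case: e ie {t1 t2 t3 sq hB} => // e' _; rewrite mulnS /= addnC leq_add2r /rho|rewrite -ltnS prednK //; apply: leq_ltn_trans ie].
    apply: growsM; try by move=> x; rewrite ?mulr_ge0 ?exprn_ge0 ?cmod_ge0.
      apply: growsM; try by move=> x; rewrite ?mulr_ge0 ?exprn_ge0 ?cmod_ge0.
        exact: grows_coord.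
      apply: growsM; try by move=> x; rewrite ?mulr_ge0 ?exprn_ge0 ?cmod_ge0.
        by apply: growsX => // x; rewrite cmod_ge0.
      exact: grows_t.
    exact: (grows_t 1).
Qed.

(** With t = |x_0| and Q = 0, [shear_leading] reads |c| t^D t <= s^E t^D. Its additional factor t is
    what survives as the bound. *)
Lemma shear_bound n (Q : itp C n.+1) : Q != 0 -> exists r E, forall x s,
  2 <= s -> (forall j, (0 < j)%N -> (j <= n)%N -> cmod (x j) <= s) ->
  ev n.+1 (shear r x) Q = 0 -> cmod (x 0%N) <= s ^+ E.
Proof.
move=> Q0; have [r [D [c [c0 [E hE]]]]] := shear_leading Q0.
have [e he] := le_pow2 (cmod c)^-1.
exists r, (E + e)%N => x s s2 xs Qx.
have s1 : 1 <= s by lra.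
have [t1|t1] := ltP (cmod (x 0%N)) 1.
  by apply: le_trans (ltW t1) _; rewrite exprn_ege1.
(* [grows] asks for bounds on all coordinates, but only those up to [n] are controlled; the others
   do not affect the evaluation and are set to 0. *)
pose x' j := if (j <= n)%N then x j else 0.
have xx : ev n.+1 (shear r x') Q = 0.
  rewrite -[RHS]Qx; apply: eq_ev => i; rewrite ltnS => lin.
  by rewrite /shear /x' lin leq0n.
have xs' j : (0 < j)%N -> cmod (x' j) <= s.
  by rewrite /x'; case: ifP => jn j0; [exact: xs|rewrite cmod0; lra].
have := hE x' s s2 t1 xs'; rewrite xx sub0r cmodN -[x' 0%N]/(x 0%N) => h.
rewrite cmodM cmodX mulrAC in h.
have tD : 0 < cmod (x 0%N) ^+ D by apply: exprn_gt0; lra.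
rewrite ler_pM2r // in h.
have c1 : 0 < cmod c by rewrite cmod_gt0.
rewrite -ler_pdivlMl // in h.
by apply: le_trans h _; rewrite mulrC exprD ler_wpM2l ?he // exprn_ge0 //; lra.
Qed.

End Growth.

(** * Two dependent coordinates and an avoided polydisc *)

Section GoodCoordinates.
Variables (R : realType) (m : nat).
Local Notation C := R[i].
Local Notation K := m.+2.
Local Notation pt := (Cpt R K.+1).

(** After unshearing, the bounded coordinate x_0 moves to the last place and the others shift down,
    so that a second stage bounds a different coordinate. *)
Definition stage (r : nat -> nat) (z : pt) : pt :=
  mk K (fun j => if j == K then co z 0 else co z j.+1 - co z 0 ^+ r j.+1).

Definition unstage (r : nat -> nat) (w : pt) : pt :=
  mk K (fun j => if j == 0%N then co w K else co w j.-1 + co w K ^+ r j).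

Lemma stage_auto r : polyauto (stage r) (unstage r).
Proof.
split.
- apply: polymap_mk => j jK; case: eqP => [_|jK']; first exact: cpoly_co.
  apply: cpolyB; first by apply: cpoly_co; lia.
  by apply: cpolyX; exact: cpoly_co.
- apply: polymap_mk => j jK; case: eqP => [_|j0]; first exact: cpoly_co.
  apply: cpolyD; first by apply: cpoly_co; lia.
  by apply: cpolyX; exact: cpoly_co.
- move=> z; apply: co_inj => j jK; rewrite co_mk // /stage.
  case: eqP => [->|/eqP j0]; first by rewrite co_mk // eqxx.
  rewrite !co_mk ?eqxx //; last by lia.
  have -> : (j.-1 == K) = false by apply/negbTE; lia.
  by rewrite prednK ?lt0n // subrK.
- move=> w; apply: co_inj => j jK; rewrite co_mk // /unstage.
  case: eqP => [->|/eqP jK']; first by rewrite co_mk // eqxx.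
  by rewrite !co_mk ?eqxx //=; [rewrite addrK|lia].
Qed.

Lemma stage_growth (V : set pt) T S : alg_set V -> ~ has_chain V K -> polyauto T S ->
  exists r E, forall z (s : R), V z -> 2 <= s ->
   (forall j, (j <= m)%N -> cmod (co (stage r (T z)) j) <= s) ->
   cmod (co (stage r (T z)) K) <= s ^+ E.
Proof.
move=> aV nV aT; have [Q Q0 hQ] := has_chain_or_relation aV nV aT.
have [r [E hE]] := shear_bound Q0.
exists r, E => z s Vz s2 hs.
pose x j := if j == 0%N then co (T z) 0 else co (T z) j - co (T z) 0 ^+ r j.
rewrite co_mk // eqxx -[co _ _]/(x 0%N); apply: hE => // [j j0 jm|].
  have := hs j.-1; rewrite co_mk; last by lia.
  have -> : (j.-1 == K) = false by apply/negbTE; lia.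
  by rewrite prednK // /x eqn0Ngt j0 /=; apply; lia.
rewrite -[RHS](hQ z Vz); apply: eq_ev => i iK.
by rewrite /shear /x; case: eqP => [->//|_]; rewrite eqxx subrK.
Qed.

(** The second stage bounds w_0. Undoing its shear bounds w_1, ..., w_m, which are the inputs of the
    first stage and give a bound for w_K. Up to the shear, w_K and w_0 are the last two final
    coordinates. *)
Lemma algebraic_coordinates (V : set pt) : alg_set V -> ~ has_chain V K ->
  exists T S E, polyauto T S /\ forall z (s : R), V z -> 2 <= s ->
   (forall j, (j <= m)%N -> cmod (co (T z) j) <= s) ->
   cmod (co (T z) m.+1) <= s ^+ E /\ cmod (co (T z) K) <= s ^+ E.
Proof.
move=> aV nV.
have [r1 [E1 h1]] := stage_growth aV nV (polyauto_id R K).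
have [r2 [E2 h2]] := stage_growth aV nV (stage_auto r1).
pose F := (\sum_(j < K.+1) E2 * r2 j + E2 + 2)%N.
have rF j : (j < K.+1)%N -> (E2 * r2 j < F.-1)%N.
  by move=> jK; rewrite /F (bigD1 (Ordinal jK)) //=; lia.
exists (fun z => stage r2 (stage r1 z)), (fun z => unstage r1 (unstage r2 z)).
exists (F * E1 + F).+1; split.
  exact: (polyauto_comp (stage_auto r1) (stage_auto r2)).
move=> z s Vz s2 hs; set w := stage r1 z in hs *.
have s1 : 1 <= s by lra.
have s0 : 0 <= s by lra.
have w0 : cmod (co w 0) <= s ^+ E2.
  by have := h2 _ _ Vz s2 hs; rewrite co_mk // eqxx.
have wX n : cmod (co w 0 ^+ n) <= s ^+ (E2 * n).
  by rewrite cmodX exprM lerXn2r // ?nnegrE ?cmod_ge0 ?exprn_ge0.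
have ws j : (j <= m)%N -> cmod (co w j) <= s ^+ F.
  case: j => [_|j jm].
    by apply: le_trans w0 _; rewrite ler_weXn2l // /F; lia.
  have := hs j (ltnW jm); rewrite co_mk; last by lia.
  have -> : (j == K) = false by apply/negbTE; lia.
  move=> hj; rewrite -(subrK (co w 0 ^+ r2 j.+1) (co w j.+1)).
  apply: le_trans (cmodD _ _) _; apply: le_trans (lerD hj (wX _)) _.
  rewrite -{1}(expr1 s); apply: le_trans (pow_addl _ _ s2) _.
  by rewrite ler_weXn2l //; have := rF j.+1; lia.
have wK : cmod (co w K) <= s ^+ (F * E1).
  rewrite exprM; apply: h1 => //.
  by apply: le_trans s2 _; rewrite -{1}(expr1 s) ler_weXn2l // /F; lia.
split; rewrite co_mk //; last first.
  by rewrite eqxx; apply: le_trans w0 _; rewrite ler_weXn2l // /F; lia.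
have -> : (m.+1 == K) = false by apply/negbTE; lia.
apply: le_trans (cmodB _ _) _; apply: le_trans (lerD wK (wX _)) _.
apply: le_trans (pow_addl _ _ s2) _.
by rewrite ler_weXn2l //; have := rF K; lia.
Qed.

Lemma ev_lipschitz n (p : itp C n) c : exists M : R, forall (x : nat -> C) (d : R), d <= 1 ->
  (forall j, (j < n)%N -> cmod (x j - c j) <= d) -> cmod (ev n x p - ev n c p) <= M * d.
Proof.
have dge0 (x : nat -> C) (d : R) n' : (n' > 0)%N -> (forall j, (j < n')%N -> cmod (x j - c j) <= d) -> 0 <= d.
  by move=> n0 /(_ 0%N n0); apply: le_trans; exact: cmod_ge0.
elim: n p => [|n IH] p.
  by exists 0 => x d _ _; rewrite subrr cmod0 mul0r.
pose L (f : (nat -> C) -> C) := exists M : R, forall (x : nat -> C) (d : R), d <= 1 ->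
  (forall j, (j < n.+1)%N -> cmod (x j - c j) <= d) -> cmod (f x - f c) <= M * d.
have LM f g : L f -> L g -> L (fun x => f x * g x).
  move=> [M hM] [N hN]; exists (`|M| * (`|N| + cmod (g c)) + cmod (f c) * `|N|) => x d d1 hx.
  have d0 : 0 <= d by exact: dge0 hx.
  have -> : f x * g x - f c * g c = (f x - f c) * ((g x - g c) + g c) + f c * (g x - g c) by ring.
  apply: le_trans (cmodD _ _) _; rewrite !cmodM mulrDl; apply: lerD.
    have hf : cmod (f x - f c) <= `|M| * d.
      by apply: le_trans (hM _ _ d1 hx) _; rewrite ler_wpM2r // ler_norm.
    have hg : cmod (g x - g c + g c) <= `|N| + cmod (g c).
      apply: le_trans (cmodD _ _) _; rewrite lerD2r; apply: le_trans (hN _ _ d1 hx) _.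
      by apply: le_trans (ler_wpM2r d0 (ler_norm N)) _; rewrite ler_piMr.
    by rewrite mulrAC; apply: ler_pM; rewrite ?cmod_ge0.
  rewrite -mulrA ler_wpM2l ?cmod_ge0 //; apply: le_trans (hN _ _ d1 hx) _.
  by rewrite ler_wpM2r // ler_norm.
have LX : L (fun x => x n) by exists 1 => x d d1 hx; rewrite mul1r hx.
have Lsum k (F : nat -> (nat -> C) -> C) : (forall i, L (F i)) -> L (fun x => \sum_(i < k) F i x).
  move=> hF; elim: k => [|k [M hM]].
    by exists 0 => x d _ _; rewrite !big_ord0 subrr cmod0 mul0r.
  have [N hN] := hF k; exists (M + N) => x d d1 hx; rewrite !big_ord_recr /=.
  rewrite opprD addrACA mulrDl; apply: le_trans (cmodD _ _) _.
  by apply: lerD; [exact: hM|exact: hN].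
suff [M hM] : L (fun x => ev n.+1 x p).
  by exists M => x d d1 hx; exact: hM.
have -> : (fun x => ev n.+1 x p) = (fun x => \sum_(i < size (p : {poly itp C n}))
   ev n x (p : {poly itp C n})`_i * x n ^+ i) by apply/funext => x; rewrite ev_sum.
apply: (Lsum _ (fun i x => ev n x (p : {poly itp C n})`_i * x n ^+ i)) => i; apply: (LM _ _).
  have [M hM] := IH ((p : {poly itp C n})`_i); exists M => x d d1 hx.
  by apply: hM => // j jn; apply: hx; exact: ltnW.
elim: i => [|i Li]; first by exists 0 => x d _ _; rewrite !expr0 subrr cmod0 mul0r.
have -> : (fun x : nat -> C => x n ^+ i.+1) = (fun x => x n * x n ^+ i).
  by apply/funext => x; rewrite exprS.
exact: LM.
Qed.

Definition affine (t : C) (c : nat -> C) (z : pt) : pt := mk K (fun j => t * (co z j - c j)).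
Definition unaffine (t : C) (c : nat -> C) (w : pt) : pt := mk K (fun j => t^-1 * co w j + c j).

Lemma affine_auto t c : t != 0 -> polyauto (affine t c) (unaffine t c).
Proof.
move=> t0; split.
- apply: polymap_mk => j jK; apply: cpolyM; first exact: cpoly_cst.
  by apply: cpolyB; [exact: cpoly_co|exact: cpoly_cst].
- apply: polymap_mk => j jK; apply: cpolyD; last exact: cpoly_cst.
  by apply: cpolyM; [exact: cpoly_cst|exact: cpoly_co].
- by move=> z; apply: co_inj => j jK; rewrite !co_mk // mulKf // subrK.
- by move=> z; apply: co_inj => j jK; rewrite !co_mk // addrK mulVKf.
Qed.

(** Both clauses persist under the iteration, the first with a larger exponent [E], the second with
    the same radius 2. The second clause separates [V] from the basin; the first is what makes it
    persist. *)
Definition tame_at (W : set (nat -> C)) (E : nat) :=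
  (forall w (s : R), W w -> 2 <= s -> (forall j, (j <= m)%N -> cmod (w j) <= s) ->
     cmod (w m.+1) <= s ^+ E /\ cmod (w K) <= s ^+ E) /\
  (forall w, W w -> ~ (forall j, (j < K)%N -> cmod (w j) <= 2)).

(** The relation [Q] is nonzero at some [c], hence on a polydisc of radius [d] around it, which [V]
    must avoid. Moving [c] to 0 and scaling by 2/d makes this the polydisc of radius 2. *)
Lemma good_coordinates (V : set pt) : alg_set V -> ~ has_chain V K ->
  exists T S E, polyauto T S /\ tame_at [set co (T z) | z in V] E.
Proof.
move=> aV nV; have [T [S [E [aT hT]]]] := algebraic_coordinates aV nV.
have [Q Q0 hQ] := has_chain_or_relation aV nV aT.
have [c hc] := ev_neq0 Q0.
have [M hM] := ev_lipschitz Q c.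
have evc : 0 < cmod (ev K c Q) by rewrite cmod_gt0.
pose d : R := Num.min 1 (cmod (ev K c Q) / (2 * (1 + `|M|))).
have M1 : 0 < 2 * (1 + `|M|) by have := normr_ge0 M; lra.
have d0 : 0 < d by rewrite /d lt_min ltr01 divr_gt0.
have d1 : d <= 1 by rewrite /d ge_min lexx.
have dM : M * d < cmod (ev K c Q).
  have : d <= cmod (ev K c Q) / (2 * (1 + `|M|)) by rewrite /d ge_min lexx orbT.
  rewrite ler_pdivlMr // => h.
  have := ler_norm M; nra.
have d20 : (2 / d)%:C%C != 0 :> C.
  by rewrite -cmod_eq0 cmod_real normr_eq0 mulf_neq0 ?invr_eq0 // gt_eqF.
have cd : cmod ((2 / d)%:C)%C = 2 / d by rewrite cmod_real ger0_norm // divr_ge0 // ltW.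
pose c' j := if (j < K)%N then c j else 0.
have [e he] := le_pow2 (\sum_(j < K.+1) cmod (c' j) + 2 / d).
have ce j (s : R) : (j <= K)%N -> 2 <= s -> cmod (c' j) <= s ^+ e.
  move=> jK s2; apply: le_trans (he s s2).
  rewrite (bigD1 (Ordinal (jK : (j < K.+1)%N))) //= -addrA lerDl; apply: addr_ge0.
    by apply: sumr_ge0 => i _; exact: cmod_ge0.
  by rewrite divr_ge0 // ltW.
have de (s : R) : 2 <= s -> 2 / d <= s ^+ e.
  move=> s2; apply: le_trans (he s s2); rewrite lerDr.
  by apply: sumr_ge0 => i _; exact: cmod_ge0.
exists (fun z => affine (2 / d)%:C%C c' (T z)), (fun z => S (unaffine (2 / d)%:C%C c' z)).
pose F := (maxn 1 e).+1.
exists (e + (maxn (F * E) e).+1)%N; split.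
  exact: polyauto_comp aT (affine_auto _ _).
split=> [_ s [z Vz <-] s2 hs|_ [z Vz <-] hs].
  have hv j : (j <= m)%N -> cmod (co (T z) j) <= s ^+ F.
    move=> jm; have jK : (j < K.+1)%N by lia.
    have := hs j jm; rewrite co_mk // cmodM cd => h.
    rewrite -(subrK (c' j) (co (T z) j)); apply: le_trans (cmodD _ _) _.
    apply: le_trans (pow_addl 1 e s2); apply: lerD; last exact: ce.
    rewrite expr1; apply: le_trans h; rewrite ler_peMl ?cmod_ge0 //.
    by rewrite ler_pdivlMr //; lra.
  have s1 : 1 <= s by lra.
  have sF : 2 <= s ^+ F by apply: (le_trans s2); rewrite -{1}(expr1 s) ler_weXn2l.
  have [b1 b2] := hT z (s ^+ F) Vz sF hv.
  have fin j : (j <= K)%N -> cmod (co (T z) j) <= (s ^+ F) ^+ E ->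
     cmod (co (affine (2 / d)%:C%C c' (T z)) j) <= s ^+ (e + (maxn (F * E) e).+1).
    move=> jK hj; rewrite co_mk // cmodM cd exprD; apply: ler_pM.
    - by rewrite divr_ge0 // ltW.
    - exact: cmod_ge0.
    - exact: de.
    - apply: le_trans (cmodB _ _) _; apply: le_trans (pow_addl _ _ s2).
      by apply: lerD; [rewrite exprM|exact: ce].
  by split; apply: fin.
have /hM : forall j, (j < K)%N -> cmod (co (T z) j - c j) <= d.
  move=> j jK; have := hs j jK; rewrite co_mk; last exact: ltnW.
  rewrite cmodM cd /c' jK.
  rewrite mulrAC ler_pdivrMr // ler_pM2l //.
rewrite (hQ _ Vz) sub0r cmodN => /(_ d1); lra.
Qed.

End GoodCoordinates.

(** * Differential calculus and smooth limits *)

Section RealCoordinates.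
Variable R : realType.
Local Notation C := R[i].

Lemma norm_entry_le m n (M : 'M[R]_(m, n)) i j : `|M i j| <= `|M|.
Proof.
rewrite [leRHS]mx_normrE; apply/bigmax_geP; right => /=.
by exists (i, j).
Qed.

Lemma norm_mx_le m n (M : 'M[R]_(m, n)) (r : R) : 0 <= r ->
  (forall i j, `|M i j| <= r) -> `|M| <= r.
Proof.
by move=> r0 h; rewrite [leLHS]mx_normrE; apply: bigmax_le => //= -[i j] _; exact: h.
Qed.

Lemma cmod_co_le k (z : Cpt R k.+1) j : cmod (co z j) <= 2 * `|z|.
Proof.
apply: le_trans (cmod_le_ReIm _) _; rewrite /= mulr2n mulrDl mul1r.
apply: lerD; (apply: le_trans (norm_entry_le _ _ _) _); rewrite prod_normE le_max lexx //.
by rewrite orbT.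
Qed.

Lemma norm_le_co k (z : Cpt R k.+1) (r : R) : 0 <= r ->
  (forall j, (j < k.+1)%N -> cmod (co z j) <= r) -> `|z| <= r.
Proof.
move=> r0 h; rewrite prod_normE ge_max; apply/andP; split; apply: norm_mx_le => // i j;
  rewrite (ord1 i); have := h j (ltn_ord j); apply: le_trans.
  by apply: le_trans (Re_le_cmod _); rewrite /co /= inord_val.
by apply: le_trans (Im_le_cmod _); rewrite /co /= inord_val.
Qed.

Lemma hnorm2E k (z : Cpt R k.+1) : hnorm2 z = \sum_(j < k.+1) cmod (co z j) ^+ 2.
Proof. by apply: eq_bigr => j _; rewrite sqr_cmod /co inord_val. Qed.

Definition re_co k j (z : Cpt R k.+1) : R := z.1 0 (inord j).
Definition im_co k j (z : Cpt R k.+1) : R := z.2 0 (inord j).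

Lemma re_co_is_linear k j : linear (@re_co k j).
Proof. by move=> a x y; rewrite /re_co !mxE. Qed.
Lemma im_co_is_linear k j : linear (@im_co k j).
Proof. by move=> a x y; rewrite /im_co !mxE. Qed.
HB.instance Definition _ k j := GRing.isLinear.Build R (Cpt R k.+1) R _ (@re_co k j) (@re_co_is_linear k j).
HB.instance Definition _ k j := GRing.isLinear.Build R (Cpt R k.+1) R _ (@im_co k j) (@im_co_is_linear k j).

Lemma lin_bounded_continuous (V W : normedModType R) (f : {linear V -> W}) (M : R) :
  (forall x, `|f x| <= M * `|x|) -> continuous f.
Proof.
move=> h; apply/linear_bounded_continuous/linear_boundedP.
near=> N => x; apply: le_trans (h x) _.
by rewrite ler_wpM2r //; near: N; apply: nbhs_pinfty_ge; rewrite num_real.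
Unshelve. all: end_near. Qed.

Lemma re_co_continuous k j : continuous (@re_co k j).
Proof.
apply: (@lin_bounded_continuous _ _ _ 1) => x; rewrite mul1r.
by apply: le_trans (norm_entry_le _ _ _) _; rewrite prod_normE le_max lexx.
Qed.
Lemma im_co_continuous k j : continuous (@im_co k j).
Proof.
apply: (@lin_bounded_continuous _ _ _ 1) => x; rewrite mul1r.
by apply: le_trans (norm_entry_le _ _ _) _; rewrite prod_normE le_max lexx orbT.
Qed.

Lemma is_diff_re_co k j z : is_diff z (@re_co k j) (@re_co k j).
Proof.
apply: DiffDef; first exact: linear_differentiable (@re_co_continuous k j).
by rewrite diff_lin //; exact: re_co_continuous.
Qed.
Lemma is_diff_im_co k j z : is_diff z (@im_co k j) (@im_co k j).
Proof.
apply: DiffDef; first exact: linear_differentiable (@im_co_continuous k j).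
by rewrite diff_lin //; exact: im_co_continuous.
Qed.

Definition is_cder k (f : Cpt R k.+1 -> C) z (L : Cpt R k.+1 -> C) :=
  is_diff z (fun z => complex.Re (f z)) (fun v => complex.Re (L v)) /\
  is_diff z (fun z => complex.Im (f z)) (fun v => complex.Im (L v)).

Definition cder k (f : Cpt R k.+1 -> C) (z v : Cpt R k.+1) : C :=
  ('d (fun z => complex.Re (f z)) z v +i* 'd (fun z => complex.Im (f z)) z v)%C.

Lemma is_cderE k (f : Cpt R k.+1 -> C) z L : is_cder f z L -> cder f z = L.
Proof.
move=> [[_ h1] [_ h2]]; apply/funext => v; rewrite /cder h1 h2.
by case: (L v).
Qed.

Lemma is_cder_cst k (c : C) (z : Cpt R k.+1) : is_cder (fun=> c) z (fun=> 0).
Proof. by split; exact: is_diff_cst. Qed.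

Lemma is_cder_co k j z : is_cder (fun z => co z j) z (fun v : Cpt R k.+1 => co v j).
Proof. by split; [exact: is_diff_re_co|exact: is_diff_im_co]. Qed.

Lemma is_diff_ext (V W : normedModType R) (f f' df df' : V -> W) x :
  is_diff x f df -> f =1 f' -> df =1 df' -> is_diff x f' df'.
Proof. by move=> h /funext <- /funext <-. Qed.

Lemma is_cderD k (f g : Cpt R k.+1 -> C) z L M : is_cder f z L -> is_cder g z M ->
  is_cder (fun z => f z + g z) z (fun v => L v + M v).
Proof.
move=> [f1 f2] [g1 g2]; split.
  by apply: is_diff_ext (is_diffD f1 g1) _ _ => x /=; rewrite cReD.
by apply: is_diff_ext (is_diffD f2 g2) _ _ => x /=; rewrite cImD.
Qed.

Lemma is_cderM k (f g : Cpt R k.+1 -> C) z L M : is_cder f z L -> is_cder g z M ->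
  is_cder (fun z => f z * g z) z (fun v => f z * M v + g z * L v).
Proof.
move=> [f1 f2] [g1 g2]; split.
  apply: is_diff_ext (is_diffB (is_diffM f1 g1) (is_diffM f2 g2)) _ _ => x.
    by rewrite cReM.
  rewrite cReD !cReM /= !fctE /GRing.scale /=; ring.
apply: is_diff_ext (is_diffD (is_diffM f1 g2) (is_diffM f2 g1)) _ _ => x.
  by rewrite cImM.
rewrite cImD !cImM /= !fctE /GRing.scale /=; ring.
Qed.

Lemma cpoly_is_cder k (f : Cpt R k.+1 -> C) z : cpoly f -> is_cder f z (cder f z).
Proof.
move=> pf; suff [L hL] : exists L, is_cder f z L by rewrite (is_cderE hL).
elim: pf => [c|j jk|{}f g _ [L hL] _ [M hM]|{}f g _ [L hL] _ [M hM]].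
- by eexists; exact: is_cder_cst.
- by eexists; exact: is_cder_co.
- by eexists; exact: is_cderD hL hM.
- by eexists; exact: is_cderM hL hM.
Qed.

Lemma cder_cst k (c : C) (z v : Cpt R k.+1) : cder (fun=> c) z v = 0.
Proof. by rewrite (is_cderE (is_cder_cst c z)). Qed.
Lemma cder_co k j (z v : Cpt R k.+1) : cder (fun z => co z j) z v = co v j.
Proof. by rewrite (is_cderE (is_cder_co j z)). Qed.

Section Rules.
Variables (k : nat) (f g : Cpt R k.+1 -> C).
Hypotheses (pf : cpoly f) (pg : cpoly g).
Variables (z v : Cpt R k.+1).

Lemma cderD : cder (fun z => f z + g z) z v = cder f z v + cder g z v.
Proof. by rewrite (is_cderE (is_cderD (cpoly_is_cder z pf) (cpoly_is_cder z pg))). Qed.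

Lemma cderM : cder (fun z => f z * g z) z v = f z * cder g z v + g z * cder f z v.
Proof. by rewrite (is_cderE (is_cderM (cpoly_is_cder z pf) (cpoly_is_cder z pg))). Qed.

Lemma cderMl c : cder (fun z => c * f z) z v = c * cder f z v.
Proof.
rewrite (is_cderE (is_cderM (is_cder_cst c z) (cpoly_is_cder z pf))).
by rewrite mulr0 addr0.
Qed.

Lemma cderX n : cder (fun z => f z ^+ n) z v = n%:R * f z ^+ n.-1 * cder f z v.
Proof.
elim: n => [|n IH]; first by under eq_fun do rewrite expr0; rewrite cder_cst !mul0r.
under eq_fun do rewrite exprS.
rewrite (is_cderE (is_cderM (cpoly_is_cder z pf) (cpoly_is_cder z (cpolyX n pf)))).
rewrite IH /= -addn1 natrD; case: n {IH} => [|n] /=; first by rewrite !expr0; ring.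
by rewrite exprS; ring.
Qed.

End Rules.

Lemma complex_ext (x y : C) : complex.Re x = complex.Re y -> complex.Im x = complex.Im y -> x = y.
Proof. by case: x => a b; case: y => c d /= -> ->. Qed.

Definition cs k (c : C) (v : Cpt R k.+1) : Cpt R k.+1 := mk k (fun j => c * co v j).

Lemma co_cs k c (v : Cpt R k.+1) j : (j < k.+1)%N -> co (cs c v) j = c * co v j.
Proof. by move=> jk; rewrite co_mk. Qed.

Lemma cmulIE k (v : Cpt R k.+1) : cmulI v = cs 'i%C v.
Proof.
apply: co_inj => j jk; rewrite co_cs //; apply: complex_ext.
  by rewrite cReM /co /= !mxE mul0r mul1r sub0r.
by rewrite cImM /co /= mul0r mul1r add0r.
Qed.

Lemma cscaleE k (l : Cpt R 1) (b : Cpt R k.+1) : Defs.cscale l b = cs (co l 0) b.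
Proof.
have i0 : inord 0 = 0 :> 'I_1 by apply: val_inj; rewrite /= inordK.
apply: co_inj => j jk; rewrite co_cs //; apply: complex_ext.
  by rewrite cReM /Defs.cscale /co /= i0 !mxE.
by rewrite cImM /Defs.cscale /co /= i0 !mxE.
Qed.

Lemma cder_cs k (f : Cpt R k.+1 -> C) z c v : cpoly f -> cder f z (cs c v) = c * cder f z v.
Proof.
elim=> [a|j jk|{}f g pf hf pg hg|{}f g pf hf pg hg].
- by rewrite !cder_cst mulr0.
- by rewrite !cder_co co_cs.
- by rewrite !cderD // hf hg mulrDr.
- by rewrite !cderM // hf hg mulrDr; congr (_ + _); rewrite mulrCA.
Qed.

Lemma coD k (v w : Cpt R k.+1) j : co (v + w) j = co v j + co w j.
Proof. by rewrite /co /= !mxE. Qed.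

Lemma is_diff_sum (V W : normedModType R) n (f df : 'I_n -> V -> W) x :
  (forall i, is_diff x (f i) (df i)) ->
  is_diff x (fun y => \sum_i f i y) (fun y => \sum_i df i y).
Proof.
elim: n f df => [|n IH] f df h.
  by apply: is_diff_ext (is_diff_cst 0 x) _ _ => y; rewrite big_ord0.
apply: is_diff_ext (is_diffD (IH _ _ (fun i => h (widen_ord (leqnSn n) i))) (h ord_max)) _ _ => y /=;
  by rewrite big_ord_recr.
Qed.

Lemma is_diffZl (V W : normedModType R) (f df : V -> R) (w : W) x :
  is_diff x f df -> is_diff x (fun y => f y *: w) (fun y => df y *: w).
Proof.
move=> [h1 h2]; apply: DiffDef; first exact: differentiableZl.
by rewrite diffZl // h2.
Qed.

Lemma is_diff_mk k l (X : nat -> Cpt R k.+1 -> C) (L : nat -> Cpt R k.+1 -> C) z :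
  (forall j, (j < l.+1)%N -> is_cder (X j) z (L j)) ->
  is_diff z (fun z => mk l (X ^~ z)) (fun v => mk l (L ^~ v)).
Proof.
move=> hX.
pose E (f : C -> R) (x : nat -> C) : 'rV[R]_l.+1 := \sum_(j < l.+1) f (x j) *: delta_mx 0 j.
have mkE x : mk l x = (E (@complex.Re R) x, E (@complex.Im R) x).
  by congr pair; rewrite [LHS]row_sum_delta; apply: eq_bigr => j _; rewrite mxE.
apply: (@is_diff_ext _ _ (fun z => (E (@complex.Re R) (X ^~ z), E (@complex.Im R) (X ^~ z))) _
          (fun z => (E (@complex.Re R) (L ^~ z), E (@complex.Im R) (L ^~ z)))) => [|v|v].
- apply: is_diff_pair; apply: is_diff_sum => j; apply: is_diffZl.
    by have [] := hX j (ltn_ord j).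
  by have [] := hX j (ltn_ord j).
- by rewrite mkE.
- by rewrite mkE.
Qed.

Lemma polymap_is_diff k l (T : Cpt R k.+1 -> Cpt R l.+1) z : polymap T ->
  is_diff z T (fun v => mk l (fun j => cder (fun z => co (T z) j) z v)).
Proof.
move=> pT; apply: is_diff_ext (is_diff_mk (X := fun j z => co (T z) j) _) _ _.
- by move=> j jl; apply: cpoly_is_cder; exact: pT.
- by move=> y /=; rewrite mk_co.
- by [].
Qed.

Lemma co_diff k l (T : Cpt R k.+1 -> Cpt R l.+1) z v j : polymap T -> (j < l.+1)%N ->
  co ('d T z v) j = cder (fun z => co (T z) j) z v.
Proof. by move=> pT jl; have [_ ->] := polymap_is_diff z pT; rewrite co_mk. Qed.

Lemma polymap_differentiable k l (T : Cpt R k.+1 -> Cpt R l.+1) z :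
  polymap T -> differentiable T z.
Proof. by move=> pT; have [] := polymap_is_diff z pT. Qed.

Lemma polymap_holomorphic k l (T : Cpt R k.+1 -> Cpt R l.+1) U : polymap T -> open U ->
  holomorphic U T.
Proof.
move=> pT oU; split=> // z _; split; first exact: polymap_differentiable.
move=> v; rewrite !cmulIE; apply: co_inj => j jl.
by rewrite co_cs // !co_diff // cder_cs //; exact: pT.
Qed.

Lemma polymap_continuous k l (T : Cpt R k.+1 -> Cpt R l.+1) : polymap T -> continuous T.
Proof. by move=> pT z; apply: differentiable_continuous; exact: polymap_differentiable. Qed.

Lemma cder_comp k l (T : Cpt R k.+1 -> Cpt R l.+1) (f : Cpt R l.+1 -> C) z v :
  polymap T -> cpoly f -> cder (fun z => f (T z)) z v = cder f (T z) ('d T z v).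
Proof.
move=> pT; elim=> [a|j jk|{}f g pf hf pg hg|{}f g pf hf pg hg].
- by rewrite !cder_cst.
- by rewrite !cder_co co_diff.
- by rewrite !cderD ?hf ?hg //; exact: cpoly_comp.
- by rewrite !cderM ?hf ?hg //; exact: cpoly_comp.
Qed.

Lemma cpoly_cmod_continuous k (f : Cpt R k.+1 -> C) : cpoly f -> continuous (fun z => cmod (f z)).
Proof.
move=> pf z; under eq_fun do rewrite cmodE.
have [[h1 _] [h2 _]] := cpoly_is_cder z pf.
apply: continuous_comp; last exact: sqrt_continuous.
apply: cvgD; apply: (@continuous_comp _ _ _ _ (fun x : R => x ^+ 2)); try exact: exprn_continuous.
  exact: differentiable_continuous.
exact: differentiable_continuous.
Qed.

Lemma cpoly_bounded k (f : Cpt R k.+1 -> C) (r : R) : cpoly f ->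
  exists M, 0 <= M /\ forall z, `|z| <= r -> cmod (f z) <= M.
Proof.
elim=> [c|j jk|{}f g _ [M [M0 hM]] _ [N [N0 hN]]|{}f g _ [M [M0 hM]] _ [N [N0 hN]]].
- by exists (cmod c); split=> [|z _]; rewrite ?cmod_ge0.
- exists (2 * `|r|); split=> [|z zr]; first by rewrite mulr_ge0.
  by apply: le_trans (cmod_co_le _ _) _; rewrite ler_pM2l // (le_trans zr) // ler_norm.
- exists (M + N); split=> [|z zr]; first exact: addr_ge0.
  by apply: le_trans (cmodD _ _) _; apply: lerD; [exact: hM|exact: hN].
- exists (M * N); split=> [|z zr]; first exact: mulr_ge0.
  by rewrite cmodM; apply: ler_pM; rewrite ?cmod_ge0 ?hM ?hN.
Qed.

Lemma cder_bounded k (f : Cpt R k.+1 -> C) (r : R) : cpoly f ->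
  exists M, 0 <= M /\ forall z v, `|z| <= r -> cmod (cder f z v) <= M * `|v|.
Proof.
elim=> [c|j jk|{}f g pf [M [M0 hM]] pg [N [N0 hN]]|{}f g pf [M [M0 hM]] pg [N [N0 hN]]].
- by exists 0; split=> // z v _; rewrite cder_cst cmod0 mul0r.
- by exists 2; split=> // z v _; rewrite cder_co cmod_co_le.
- exists (M + N); split=> [|z v zr]; first exact: addr_ge0.
  rewrite cderD // mulrDl; apply: le_trans (cmodD _ _) _.
  by apply: lerD; [exact: hM|exact: hN].
- have [A [A0 hA]] := cpoly_bounded r pf; have [B [B0 hB]] := cpoly_bounded r pg.
  exists (A * N + B * M); split=> [|z v zr]; first by rewrite addr_ge0 // mulr_ge0.
  rewrite (cderM pf pg) mulrDl; apply: le_trans (cmodD _ _) _; rewrite !cmodM -!mulrA.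
  by apply: lerD; apply: ler_pM; rewrite ?cmod_ge0 ?hA ?hB ?hM ?hN.
Qed.

End RealCoordinates.

(** * Differentiation of locally uniform limits *)

Section Limits.
Variable R : realType.

Lemma half_gt0 n : 0 < 2^-1 ^+ n :> R. Proof. by rewrite exprn_gt0. Qed.

Lemma cvg_half : (fun n => 2^-1 ^+ n : R) @ \oo --> (0 : R).
Proof. by apply: cvg_expr; rewrite ger0_norm //; lra. Qed.

Lemma telescope_half (u : nat -> R) c n0 :
  (forall n, (n0 <= n)%N -> `|u n.+1 - u n| <= c * 2^-1 ^+ n.+1) ->
  forall n m, (n0 <= n)%N -> (n <= m)%N -> `|u m - u n| <= c * (2^-1 ^+ n - 2^-1 ^+ m).
Proof.
move=> hu n m n0n; elim: m => [|m IH].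
  by rewrite leqn0 => /eqP ->; rewrite !subrr normr0 mulr0.
rewrite leq_eqVlt => /predU1P[<-|]; first by rewrite !subrr normr0 mulr0.
rewrite ltnS => nm; have := IH nm; have := hu m (leq_trans n0n nm).
have -> : u m.+1 - u n = (u m.+1 - u m) + (u m - u n) by ring.
rewrite exprS; have := half_gt0 m; have := half_gt0 n.
move=> h1 h2 h3 h4; apply: le_trans (ler_normD _ _) _; nra.
Qed.

Lemma halving_cvg (u : nat -> R) c n0 : 0 <= c ->
  (forall n, (n0 <= n)%N -> `|u n.+1 - u n| <= c * 2^-1 ^+ n.+1) ->
  u @ \oo --> limn u /\ forall n, (n0 <= n)%N -> `|limn u - u n| <= c * 2^-1 ^+ n.
Proof.
move=> c0 hu; have tu := telescope_half hu.
have cu : cvgn u.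
  apply/cauchy_cvgP/cauchy_exP => e e0.
  have : (fun n => c * 2^-1 ^+ n : R) @ \oo --> c * (0 : R) by apply: cvgM; [exact: cvg_cst|exact: cvg_half].
  rewrite mulr0 => /cvgr0Pnorm_lt /(_ _ e0) [N _ hN].
  pose M := maxn N n0; exists (u M); exists M => // m /= Mm.
  rewrite /ball /= distrC; apply: le_lt_trans (tu _ _ (leq_maxr _ _) Mm) _.
  have := hN M (leq_maxl _ _); rewrite ger0_norm ?mulr_ge0 ?exprn_ge0 //.
  by apply: le_lt_trans; rewrite ler_wpM2l // lerBlDr lerDl ltW // half_gt0.
split=> // n n0n.
have h : (fun m => `|u m - u n|) @ \oo --> `|limn u - u n|.
  by apply: cvg_norm; apply: cvgB => //; exact: cvg_cst.
apply: (cvgr_to_le h); near=> m.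
have nm : (n <= m)%N by near: m; exact: nbhs_infty_ge.
apply: le_trans (tu _ _ n0n nm) _.
by rewrite ler_wpM2l // lerBlDr lerDl ltW // half_gt0.
Unshelve. all: end_near. Qed.

Lemma is_diff_epsP (V : normedModType R) (f L : V -> R) x :
  linear L -> (exists C, forall v, `|L v| <= C * `|v|) ->
  (forall e : R, 0 < e -> exists2 d : R, 0 < d &
     forall h, `|h| <= d -> `|f (h + x) - f x - L h| <= e * `|h|) ->
  is_diff x f L.
Proof.
move=> lL [C hC] h.
pose LM := GRing.isLinear.Build _ _ _ _ _ lL.
pose LL : {linear V -> R} := HB.pack L LM.
have cL : continuous LL by apply: (@lin_bounded_continuous _ _ _ _ C).
have hf : f \o shift x = cst (f x) + LL +o_ 0 id.
  apply/eqaddoP => e e0; have [d d0 hd] := h e e0.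
  near=> v; rewrite /= -[X in `|X|]/(f (v + x) - (f x + L v)) opprD addrA.
  apply: hd; near: v; exact: nbhs0_le.
apply: DiffDef; last exact: (diff_unique cL hf).
by apply/diff_locallyP; rewrite (diff_unique cL hf).
Unshelve. all: end_near. Qed.

Lemma differentiable_eps (V : normedModType R) (f : V -> R) x : differentiable f x ->
  forall e : R, 0 < e -> exists2 d : R, 0 < d &
     forall h, `|h| <= d -> `|f (h + x) - f x - 'd f x h| <= e * `|h|.
Proof.
move=> df e e0; have [_ hf] := (diff_locallyP _ _).1 df.
move/eqaddoP: hf => /(_ e e0) /nbhs_norm0P [d /= d0 hd].
exists (d / 2); first by rewrite divr_gt0.
move=> h hh; have hd' : `|h| < d by apply: le_lt_trans hh _; lra.
have /= := hd h hd'; rewrite -[X in `|X| <= _ -> _]/(f (h + x) - (f x + 'd f x h)).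
by rewrite opprD addrA.
Qed.

Lemma diff_mean_value (V : normedModType R) (f : V -> R) x h M :
  (forall y, differentiable f y) ->
  (forall t : R, 0 <= t <= 1 -> `|'d f (t *: h + x) h| <= M) ->
  `|f (h + x) - f x| <= M.
Proof.
move=> df hM.
pose phi (t : R) := f (t *: h + x).
have dphi (t : R) : is_derive t 1 phi ('d f (t *: h + x) h).
  have dl : is_diff t (fun t : R => t *: h + x) ( *:%R^~ h).
    apply: is_diff_ext (is_diffD (is_diff_scalel t h) (is_diff_cst x t)) _ _ => // y.
    by rewrite /= -[LHS]/(y *: h + 0) addr0.
  have dc := is_diff_comp dl (differentiableP (df (t *: h + x))).
  have -> : phi = f \o (fun t : R => t *: h + x) by [].
  have [d1 d2] := dc; split; first exact: diff_derivable.
  by rewrite deriveE // d2 /= scale1r.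
have [c|c c01 e] := MVT_segment ler01 (fun t _ => dphi t).
  by apply: continuous_subspaceT => t; apply: differentiable_continuous; apply/derivable1_diffP; have [] := dphi t.
move: e; rewrite /phi scale1r scale0r add0r subr0 mulr1 => ->.
by apply: hM; move: c01; rewrite in_itv.
Qed.

Section LimitDiff.
Variables (V : normedModType R) (f_ : nat -> V -> R).
Hypothesis df : forall n x, differentiable (f_ n) x.
Hypothesis bf : forall r : R, exists n0, forall n x, (n0 <= n)%N -> `|x| <= r ->
  `|f_ n.+1 x - f_ n x| <= 2^-1 ^+ n.+1.
Hypothesis bdf : forall r : R, exists n0, forall n x v, (n0 <= n)%N -> `|x| <= r ->
  `|v| <= 1 -> `|'d (f_ n.+1) x v - 'd (f_ n) x v| <= 2^-1 ^+ n.+1.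

Let bdf' (r : R) : exists n0, forall n x v, (n0 <= n)%N -> `|x| <= r ->
  `|'d (f_ n.+1) x v - 'd (f_ n) x v| <= `|v| * 2^-1 ^+ n.+1.
Proof.
have [n0 h] := bdf r; exists n0 => n x v nn xr.
have [->|v0] := eqVneq v 0; first by rewrite normr0 mul0r !raddf0 addr0 normr0.
have nv : 0 < `|v| by rewrite normr_gt0.
have := h n x (`|v|^-1 *: v) nn xr.
rewrite normrZ normfV normr_id mulVf ?gt_eqF // lexx => /(_ isT).
have sc m c : 'd (f_ m) x (c *: v) = c * 'd (f_ m) x v by rewrite linearZ.
rewrite !sc -mulrBr normrM normfV normr_id.
by rewrite ler_pdivrMl.
Qed.

Lemma limit_cvg x : f_ ^~ x @ \oo --> limn (f_ ^~ x).
Proof.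
have [n0 h] := bf `|x|.
have [] // := @halving_cvg (f_ ^~ x) 1 n0 ler01.
by move=> n nn; rewrite mul1r; exact: h.
Qed.

Lemma limit_diff_cvg x v :
  (fun n => 'd (f_ n) x v) @ \oo --> limn (fun n => 'd (f_ n) x v).
Proof.
have [n0 h] := bdf' `|x|.
have [] // := @halving_cvg (fun n => 'd (f_ n) x v) `|v| n0 (normr_ge0 _).
by move=> n nn; exact: h.
Qed.

(** The mean value inequality for f_m - f_n bounds the difference of their increments by |v| / 2^n
    uniformly in m, so it passes to the limit. The remainder then splits into this term, the
    remainder of one f_n and the tail of the differentials. *)
Lemma limit_is_diff x :
  is_diff x ((fun y => limn (f_ ^~ y)) : V -> R) ((fun v => limn (fun n => 'd (f_ n) x v)) : V -> R).
Proof.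
have [n0 h] := bdf' (`|x| + 1).
have xr : `|x| <= `|x| + 1 by rewrite lerDl.
have tl v n : (n0 <= n)%N ->
    `|limn (fun n => 'd (f_ n) x v) - 'd (f_ n) x v| <= `|v| * 2^-1 ^+ n.
  move=> nn0; have [|_] := @halving_cvg (fun n => 'd (f_ n) x v) `|v| n0 (normr_ge0 _).
    by move=> k nk; exact: h.
  exact.
apply: is_diff_epsP.
- move=> a u v; apply/cvg_lim => //.
  under eq_fun do rewrite linearP.
  apply: cvgD; last exact: limit_diff_cvg.
  by apply: cvgM; [exact: cvg_cst|exact: limit_diff_cvg].
- have [C hC] : exists C, forall v, `|'d (f_ n0) x v| <= C * `|v|.
    have /linear_boundedP : bounded_near ('d (f_ n0) x) (nbhs (0 : V)).
      by apply/linear_bounded_continuous; apply: diff_continuous.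
    move=> [M [_ hM]]; exists (M + 1) => v; apply: hM; lra.
  exists (C + 2^-1 ^+ n0) => v.
  apply: (@le_trans _ _ (`|v| * 2^-1 ^+ n0 + C * `|v|)); last by rewrite mulrDl addrC [2^-1 ^+ n0 * _]mulrC.
  rewrite -{1}(subrK ('d (f_ n0) x v) (limn _)); apply: le_trans (ler_normD _ _) _.
  by apply: lerD; [exact: tl|exact: hC].
- move=> e e0.
  have [N _ hN] : \forall n \near \oo, (2^-1 ^+ n : R) < e / 4.
    have := @cvg_half; move/cvgr0Pnorm_lt => /(_ (e / 4)) hh.
    have e4 : 0 < e / 4 by rewrite divr_gt0.
    by apply: filterS (hh e4) => n; rewrite ger0_norm // ltW // half_gt0.
  pose n := maxn N n0.
  have hn : 2^-1 ^+ n < e / 4 by apply: hN; exact: leq_maxl.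
  have nn0 : (n0 <= n)%N by exact: leq_maxr.
  have e2 : 0 < e / 4 by rewrite divr_gt0.
  have [d d0 hd] := differentiable_eps (df n x) e2.
  exists (Num.min d 1); first by rewrite lt_min d0 ltr01.
  move=> v; rewrite le_min => /andP [vd v1].
  have part m : (n <= m)%N ->
      `|(f_ m (v + x) - f_ m x) - (f_ n (v + x) - f_ n x)| <= `|v| * 2^-1 ^+ n.
    move=> nm; pose g y := f_ m y - f_ n y.
    have dg y : is_diff y g ('d (f_ m) y \- 'd (f_ n) y).
      exact: (is_diffB (differentiableP (df m y)) (differentiableP (df n y))).
    have -> : f_ m (v + x) - f_ m x - (f_ n (v + x) - f_ n x) = g (v + x) - g x by rewrite /g; ring.
    apply: diff_mean_value => [y|t /andP [t0 t1]]; first by have [] := dg y.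
    have [_ ->] := dg (t *: v + x).
    have tr : `|t *: v + x| <= `|x| + 1.
      apply: le_trans (ler_normD _ _) _; rewrite addrC lerD2l normrZ ger0_norm //.
      by rewrite mulr_ile1.
    have := @telescope_half (fun k => 'd (f_ k) (t *: v + x) v) `|v| n0 _ n m nn0 nm.
    move=> /(_ (fun k nk => h k _ v nk tr)) /le_trans; apply.
    by rewrite ler_wpM2l // lerBlDr lerDl ltW // half_gt0.
  have lim1 : `|(limn (f_ ^~ (v + x)) - limn (f_ ^~ x)) - (f_ n (v + x) - f_ n x)| <= `|v| * 2^-1 ^+ n.
    have : (fun m => `|(f_ m (v + x) - f_ m x) - (f_ n (v + x) - f_ n x)|) @ \oo -->
        `|(limn (f_ ^~ (v + x)) - limn (f_ ^~ x)) - (f_ n (v + x) - f_ n x)|.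
      apply: cvg_norm; apply: cvgB; last exact: cvg_cst.
      by apply: cvgB; exact: limit_cvg.
    move/cvgr_to_le; apply; near=> m; apply: part; near: m; exact: nbhs_infty_ge.
  have l2 := tl v n nn0; have l3 := hd v vd.
  set A := limn (f_ ^~ (v + x)) in lim1 *; set B := limn (f_ ^~ x) in lim1 *.
  set L := limn (fun n => 'd (f_ n) x v) in l2 *.
  have -> : A - B - L = ((A - B) - (f_ n (v + x) - f_ n x))
     + (f_ n (v + x) - f_ n x - 'd (f_ n) x v) + ('d (f_ n) x v - L) by ring.
  apply: le_trans (ler_normD _ _) _; rewrite distrC in l2.
  apply: le_trans (lerD (ler_normD _ _) (lexx _)) _.
  have := normr_ge0 v; nra.
Unshelve. all: end_near. Qed.

End LimitDiff.

End Limits.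

(** * Families with uniformly bounded derivatives and smooth limits *)

Section SmoothFamilies.
Variables (R : realType) (k : nat).
Local Notation V := (Cpt R k.+1).
Implicit Types (F G : set (V -> R)) (f g : V -> R) (rho : R).

Definition dder rho F : set (V -> R) :=
  [set g | exists f v, [/\ F f, `|v| <= rho & g = fun x => 'd f x v]].

(* All derivatives of order at most [m] in directions of norm at most [rho] are
   bounded on balls, uniformly over the family [F]. *)
Fixpoint bounded_ders rho m F : Prop :=
  [/\ forall r : R, exists M, forall f x, F f -> `|x| <= r -> `|f x| <= M,
      forall f x, F f -> differentiable f x &
      if m is m'.+1 then bounded_ders rho m' (dder rho F) else True].

Lemma bounded_ders_bound rho m F : bounded_ders rho m F ->
  forall r : R, exists M, forall f x, F f -> `|x| <= r -> `|f x| <= M.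
Proof. by case: m => [|m] []. Qed.

Lemma bounded_ders_diff rho m F : bounded_ders rho m F ->
  forall f x, F f -> differentiable f x.
Proof. by case: m => [|m] []. Qed.

Lemma bounded_ders_sub rho m F G : G `<=` F -> bounded_ders rho m F -> bounded_ders rho m G.
Proof.
elim: m F G => [|m IH] F G GF [bF dF hF]; split=> //.
- by move=> r; have [M hM] := bF r; exists M => f x /GF; exact: hM.
- by move=> f x /GF; exact: dF.
- by move=> r; have [M hM] := bF r; exists M => f x /GF; exact: hM.
- by move=> f x /GF; exact: dF.
- by apply: IH hF => _ [f [v [/GF Ff vr ->]]]; exists f, v.
Qed.

Lemma bounded_dersW rho m F : bounded_ders rho m.+1 F -> bounded_ders rho m F.
Proof.
elim: m F => [|m IH] F [bF dF hF]; first by split.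
by split=> //; exact: IH.
Qed.

Definition fam2 (op : R -> R -> R) F G : set (V -> R) :=
  [set h | exists f g, [/\ F f, G g & h = fun x => op (f x) (g x)]].

Lemma bounded_dersD rho m F G : bounded_ders rho m F -> bounded_ders rho m G ->
  bounded_ders rho m (fam2 +%R F G).
Proof.
elim: m F G => [|m IH] F G [bF dF hF] [bG dG hG].
  split=> // [r|_ x [f [g [Ff Gg ->]]]]; last first.
    exact: (differentiableD (dF _ x Ff) (dG _ x Gg)).
  have [M hM] := bF r; have [N hN] := bG r; exists (M + N) => _ x [f [g [Ff Gg ->]]] xr.
  by apply: le_trans (ler_normD _ _) _; apply: lerD; [exact: hM|exact: hN].
split=> [r|_ x [f [g [Ff Gg ->]]]|].
- have [M hM] := bF r; have [N hN] := bG r; exists (M + N) => _ x [f [g [Ff Gg ->]]] xr.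
  by apply: le_trans (ler_normD _ _) _; apply: lerD; [exact: hM|exact: hN].
- exact: (differentiableD (dF _ x Ff) (dG _ x Gg)).
- apply: bounded_ders_sub (IH _ _ hF hG) => _ [_ [v [[f [g [Ff Gg ->]]] vr ->]]].
  exists (fun x => 'd f x v), (fun x => 'd g x v); split.
  + by exists f, v.
  + by exists g, v.
  + apply/funext => x.
    have [_ ->] := is_diffD (differentiableP (dF _ x Ff)) (differentiableP (dG _ x Gg)).
    by [].
Qed.

Lemma bounded_dersM rho m F G : bounded_ders rho m F -> bounded_ders rho m G ->
  bounded_ders rho m (fam2 *%R F G).
Proof.
elim: m F G => [|m IH] F G hF hG; have [bF dF hF'] := hF; have [bG dG hG'] := hG.
  split=> // [r|_ x [f [g [Ff Gg ->]]]]; last first.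
    exact: (differentiableM (dF _ x Ff) (dG _ x Gg)).
  have [M hM] := bF r; have [N hN] := bG r; exists (M * N) => _ x [f [g [Ff Gg ->]]] xr.
  by rewrite normrM; apply: ler_pM; rewrite ?normr_ge0 ?hM ?hN.
split=> [r|_ x [f [g [Ff Gg ->]]]|].
- have [M hM] := bF r; have [N hN] := bG r; exists (M * N) => _ x [f [g [Ff Gg ->]]] xr.
  by rewrite normrM; apply: ler_pM; rewrite ?normr_ge0 ?hM ?hN.
- exact: (differentiableM (dF _ x Ff) (dG _ x Gg)).
- have h1 := IH _ _ (bounded_dersW hF) hG'; have h2 := IH _ _ (bounded_dersW hG) hF'.
  apply: bounded_ders_sub (bounded_dersD h1 h2) => _ [_ [v [[f [g [Ff Gg ->]]] vr ->]]].
  exists (fun x => f x * 'd g x v), (fun x => g x * 'd f x v); split.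
  + by exists f, (fun x => 'd g x v); split=> //; exists g, v.
  + by exists g, (fun x => 'd f x v); split=> //; exists f, v.
  + apply/funext => x.
    have [_ ->] := is_diffM (differentiableP (dF _ x Ff)) (differentiableP (dG _ x Gg)).
    by [].
Qed.

Definition csts (M : R) : set (V -> R) := [set f | exists2 c, `|c| <= M & f = fun=> c].

Lemma bounded_ders_cst rho m M : 0 <= M -> bounded_ders rho m (csts M).
Proof.
elim: m M => [|m IH] M M0.
  split=> // [r|_ x [c _ ->]]; first by exists M => _ x [c cM ->].
  exact: differentiable_cst.
split=> [r|_ x [c _ ->]|].
- by exists M => _ x [c cM ->].
- exact: differentiable_cst.
- apply: (@bounded_ders_sub _ _ (csts 0)); last exact: IH.
  move=> _ [_ [v [[c _ ->] vr ->]]]; exists 0; first by rewrite normr0.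
  by apply/funext => x; have [_ ->] := is_diff_cst c x.
Qed.

Lemma bounded_ders_lin rho m f (M : R) : 0 <= rho -> 0 <= M -> (forall v, `|f v| <= M * `|v|) ->
  (forall x, is_diff x f f) -> bounded_ders rho m [set f].
Proof.
move=> r0 M0 hM df.
have b (r : R) : exists N, forall g x, [set f] g -> `|x| <= r -> `|g x| <= N.
  exists (M * r) => _ x -> xr; apply: le_trans (hM x) _.
  by rewrite ler_wpM2l.
have d g x : [set f] g -> differentiable g x by move=> ->; have [] := df x.
case: m => [|m]; split=> //.
apply: (@bounded_ders_sub _ _ (csts (M * rho))); last exact/bounded_ders_cst/mulr_ge0.
move=> _ [_ [v [-> vr ->]]]; exists (f v).
  by apply: le_trans (hM v) _; rewrite ler_wpM2l.
by apply/funext => x; have [_ ->] := df x.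
Qed.

Definition invs F : set (V -> R) := [set h | exists2 f, F f & h = fun x => (f x)^-1].

Lemma bounded_dersV rho m F : (forall f x, F f -> 1 <= f x) ->
  bounded_ders rho m F -> bounded_ders rho m (invs F).
Proof.
move=> F1; have b (r : R) : exists N, forall g x, invs F g -> `|x| <= r -> `|g x| <= N.
  exists 1 => _ x [f Ff ->] xr; have f1 := F1 f x Ff.
  by rewrite normfV invf_le1 ?normr_gt0; [rewrite ger0_norm //; lra|apply/eqP; lra].
have f0 f x : F f -> f x != 0 by move=> Ff; have f1 := F1 f x Ff; apply/eqP; lra.
elim: m => [|m IH] hF; have [bF dF hF'] := hF.
  by split=> // _ x [f Ff ->]; apply: (differentiableV (dF _ x Ff)); exact: f0.
split=> [//|_ x [f Ff ->]|].
  by apply: (differentiableV (dF _ x Ff)); exact: f0.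
have h1 := IH (bounded_dersW hF).
have h2 := bounded_dersM (bounded_dersM h1 h1) (bounded_dersM (bounded_ders_cst rho m ler01) hF').
apply: bounded_ders_sub h2 => _ [_ [v [[f Ff ->] vr ->]]].
exists (fun x => (f x)^-1 * (f x)^-1), (fun x => (-1) * 'd f x v); split.
- by exists (fun x => (f x)^-1), (fun x => (f x)^-1); split=> //; exists f.
- exists (fun=> -1), (fun x => 'd f x v); split=> //; last by exists f, v.
  by exists (-1) => //; rewrite normrN1.
- apply/funext => x; rewrite (diffV (dF _ x Ff) (f0 _ x Ff)).
  by rewrite /= /GRing.scale /= mulN1r mulrN mulNr -expr2 exprVn.
Qed.

(** In contrast to [smooth], the bounds are uniform over balls and over bounded directions, which
    allows a single [a] to serve for all of them in [small_perturbation]. *)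
Definition sm f := forall rho m, 0 <= rho -> bounded_ders rho m [set f].

Lemma sm_cst c : sm (fun=> c).
Proof.
move=> rho m r0; apply: (@bounded_ders_sub _ _ (csts `|c|)); last exact: bounded_ders_cst.
by move=> _ ->; exists c.
Qed.

Lemma smD f g : sm f -> sm g -> sm (fun x => f x + g x).
Proof.
move=> hf hg rho m r0; apply: bounded_ders_sub (bounded_dersD (hf _ _ r0) (hg _ _ r0)).
by move=> _ ->; exists f, g.
Qed.

Lemma smM f g : sm f -> sm g -> sm (fun x => f x * g x).
Proof.
move=> hf hg rho m r0; apply: bounded_ders_sub (bounded_dersM (hf _ _ r0) (hg _ _ r0)).
by move=> _ ->; exists f, g.
Qed.

Lemma smN f : sm f -> sm (fun x => - f x).
Proof.
by move=> hf; under eq_fun do rewrite -mulN1r; apply: smM => //; exact: sm_cst.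
Qed.

Lemma smB f g : sm f -> sm g -> sm (fun x => f x - g x).
Proof. by move=> hf hg; apply: smD => //; exact: smN. Qed.

Lemma smV f : (forall x, 1 <= f x) -> sm f -> sm (fun x => (f x)^-1).
Proof.
move=> f1 hf rho m r0; apply: bounded_ders_sub (bounded_dersV _ (hf _ m r0)).
  by move=> _ ->; exists f.
by move=> _ x ->.
Qed.

Lemma smX f n : sm f -> sm (fun x => f x ^+ n).
Proof.
move=> hf; elim: n => [|n IH]; first exact: sm_cst.
by under eq_fun do rewrite exprS; exact: smM.
Qed.

Lemma sm_sum n (f : nat -> V -> R) : (forall i, sm (f i)) -> sm (fun x => \sum_(i < n) f i x).
Proof.
move=> hf; elim: n => [|n IH]; first by under eq_fun do rewrite big_ord0; exact: sm_cst.
by under eq_fun do rewrite big_ord_recr /=; exact: smD.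
Qed.

Lemma sm_differentiable f x : sm f -> differentiable f x.
Proof. by move=> /(_ 0 0%N (lexx _)) /bounded_ders_diff; exact. Qed.

Lemma sm_cpoly (f : V -> R[i]) : cpoly f ->
  sm (fun z => complex.Re (f z)) /\ sm (fun z => complex.Im (f z)).
Proof.
elim=> [c|j jk|{}f g _ [f1 f2] _ [g1 g2]|{}f g _ [f1 f2] _ [g1 g2]].
- by split; exact: sm_cst.
- split=> rho m r0; apply: (@bounded_ders_lin _ _ _ 1) => // v.
  + by rewrite mul1r; apply: le_trans (norm_entry_le _ _ _) _; rewrite prod_normE le_max lexx.
  + exact: is_diff_re_co.
  + by rewrite mul1r; apply: le_trans (norm_entry_le _ _ _) _; rewrite prod_normE le_max lexx orbT.
  + exact: is_diff_im_co.
- split; [under eq_fun do rewrite cReD|under eq_fun do rewrite cImD]; exact: smD.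
- split; [under eq_fun do rewrite cReM|under eq_fun do rewrite cImM].
    by apply: smB; exact: smM.
  by apply: smD; exact: smM.
Qed.

(** [iter_dder] applies the last vector of the list first, whereas [dder] differentiates a family
    before the induction hypothesis is used; lists are therefore peeled from the end. *)
Lemma iter_dder_rcons l v f : (forall x, differentiable f x) ->
  iter_dder (rcons l v) f = iter_dder l (fun x => 'd f x v).
Proof.
move=> df; elim: l => [|u l IH] /=; last by rewrite IH.
by apply/funext => x; rewrite deriveE.
Qed.

Lemma bounded_ders_iter rho m F : bounded_ders rho m F ->
  (forall f l x, F f -> (size l <= m)%N -> (forall v, v \in l -> `|v| <= rho) ->
     differentiable (iter_dder l f) x) /\
  (forall r : R, exists M, forall f l x, F f -> (size l <= m)%N -> (forall v, v \in l -> `|v| <= rho) ->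
     `|x| <= r -> `|iter_dder l f x| <= M).
Proof.
elim: m F => [|m IH] F hF.
  split=> [f l x Ff|r].
    by rewrite leqn0 size_eq0 => /eqP -> _; exact: (bounded_ders_diff hF).
  have [M hM] := bounded_ders_bound hF r; exists M => f l x Ff.
  by rewrite leqn0 size_eq0 => /eqP -> _; exact: hM.
have dF := bounded_ders_diff hF; have [_ _ hF'] := hF; have [h1 h2] := IH _ hF'; split.
  move=> f l; case/lastP: l => [|l v] x Ff sl hl; first exact: dF.
  rewrite iter_dder_rcons; last by move=> y; exact: dF.
  apply: h1.
  - by exists f, v; split=> //; apply: hl; rewrite mem_rcons mem_head.
  - by move: sl; rewrite size_rcons.
  - by move=> u ul; apply: hl; rewrite mem_rcons inE ul orbT.
move=> r; have [M hM] := bounded_ders_bound hF r; have [N hN] := h2 r.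
exists (Num.max M N) => f l; case/lastP: l => [|l v] x Ff sl hl xr.
  by rewrite le_max (hM _ _ Ff xr).
rewrite le_max iter_dder_rcons; last by move=> y; exact: dF.
apply/orP; right; apply: hN => //.
- by exists f, v; split=> //; apply: hl; rewrite mem_rcons mem_head.
- by move: sl; rewrite size_rcons.
- by move=> u ul; apply: hl; rewrite mem_rcons inE ul orbT.
Qed.

Lemma sm_iter_diff f l x : sm f -> differentiable (iter_dder l f) x.
Proof.
move=> hf; pose rho : R := \sum_(v <- l) `|v|.
have r0 : 0 <= rho by apply: sumr_ge0.
have [h _] := bounded_ders_iter (hf rho (size l) r0).
apply: h => // v vl; rewrite /rho (big_rem v) //= lerDl.
exact: sumr_ge0.
Qed.

Lemma iter_dder_axpy (a : R) f g l x : sm f -> sm g ->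
  iter_dder l (fun x => f x + a * g x) x = iter_dder l f x + a * iter_dder l g x.
Proof.
move=> hf hg; elim: l x => [//|v l IH] x /=.
have -> : iter_dder l (fun x => f x + a * g x) = (fun x => iter_dder l f x + a * iter_dder l g x).
  by apply/funext.
have df := differentiableP (sm_iter_diff l x hf); have dg := differentiableP (sm_iter_diff l x hg).
have dd : is_diff x (fun y => iter_dder l f y + a * iter_dder l g y)
   (fun v => 'd (iter_dder l f) x v + a * 'd (iter_dder l g) x v).
  by apply: is_diff_ext (is_diffD df (is_diffZ a dg)) _ _.
rewrite deriveE; last by have [] := dd.
have [_ ->] := dd; rewrite !deriveE //.
Qed.

(* The [a]-dependence [a * (A + a * B)] is that of the squared modulus of a
   polynomial perturbed at first order. *)
Lemma small_perturbation f A B n (r e : R) : sm f -> sm A -> sm B -> 0 < e ->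
  exists2 a0 : R, 0 < a0 & forall a, 0 < a <= a0 -> let f' x := f x + a * (A x + a * B x) in
    (forall l x, (size l <= n)%N -> (forall v, v \in l -> `|v| <= n%:R) -> `|x| <= r ->
       `|iter_dder l f' x - iter_dder l f x| <= e) /\
    (forall x v, `|x| <= r -> `|'d f' x v - 'd f x v| <= e * `|v|).
Proof.
move=> hf hA hB e0.
pose F := fam2 +%R [set A] (fam2 *%R (csts 1) [set B]).
(* One order above [n], and directions of norm at least 1, so that the first differential is covered
   even for n = 0. *)
pose rho : R := n.+1%:R.
have r0 : 0 <= rho by rewrite ler0n.
have hF : bounded_ders rho n.+1 F.
  apply: bounded_dersD; first exact: hA.
  by apply: bounded_dersM; [exact: bounded_ders_cst|exact: hB].
have [_ /(_ r) [M hM]] := bounded_ders_iter hF.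
have M1 : 0 < 1 + `|M| by have := normr_ge0 M; lra.
exists (Num.min 1 (e / (1 + `|M|))); first by rewrite lt_min ltr01 divr_gt0.
move=> a /andP [a0]; rewrite le_min => /andP [a1 aM] f'.
pose g x := A x + a * B x.
have Fg : F g.
  exists A, (fun x => a * B x); split=> //; exists (fun=> a), B; split=> //.
  by exists a => //; rewrite gtr0_norm.
have smg : sm g by apply: smD => //; apply: smM => //; exact: sm_cst.
have small (y : R) : `|y| <= M -> `|a * y| <= e.
  move=> yM; rewrite normrM (gtr0_norm a0).
  rewrite ler_pdivlMr // in aM; have := ler_norm M; have := normr_ge0 y; nra.
split=> [l x sl hl xr|x v xr].
  rewrite iter_dder_axpy // addrC addKr; apply: small; apply: hM => //.
    exact: leq_trans sl _.
  by move=> v /hl /le_trans; apply; rewrite ler_nat.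
have df := differentiableP (sm_differentiable x hf); have dg := differentiableP (sm_differentiable x smg).
have [_ ->] : is_diff x f' (fun v => 'd f x v + a * 'd g x v).
  by apply: is_diff_ext (is_diffD df (is_diffZ a dg)) _ _.
rewrite addrC addKr.
have [->|v0] := eqVneq v 0; first by rewrite raddf0 mulr0 !normr0 mulr0.
have nv : 0 < `|v| by rewrite normr_gt0.
have := hM g [:: `|v|^-1 *: v] x Fg; rewrite /= => /(_ isT) => h.
suff hy : `| (`|v|^-1 * 'd g x v) | <= M.
  have := small _ hy; rewrite mulrCA [X in X <= _]normrM normfV normr_id.
  by rewrite ler_pdivrMl // [_ * e]mulrC.
have <- : 'D_(`|v|^-1 *: v) g x = `|v|^-1 * 'd g x v.
  by rewrite deriveE ?linearZ //; exact: sm_differentiable.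
apply: h => // u; rewrite inE => /eqP ->.
rewrite normrZ normfV normr_id mulVf ?gt_eqF // ler1n //.
Qed.

Section SmoothLimit.
Variable f_ : nat -> V -> R.
Hypothesis smf : forall n, sm (f_ n).
Hypothesis hf : forall n l x, (size l <= n)%N -> (forall v, v \in l -> `|v| <= n%:R) ->
  `|x| <= n%:R -> `|iter_dder l (f_ n.+1) x - iter_dder l (f_ n) x| <= 2^-1 ^+ n.+1.

Let bound_l (l : seq V) (r : R) : exists n0, forall n, (n0 <= n)%N ->
  [/\ (size l <= n)%N, forall v, v \in l -> `|v| <= n%:R & r <= n%:R].
Proof.
pose s : R := \sum_(v <- l) `|v| + `|r|.
have s0 : 0 <= s by rewrite addr_ge0 // sumr_ge0.
exists (maxn (size l) (Num.bound s)) => n; rewrite geq_max => /andP [h1 h2].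
have sn : s <= n%:R.
  by apply: le_trans (ltW (archi_boundP s0)) _; rewrite ler_nat.
split=> // [v vl|].
  apply: le_trans sn; rewrite /s (big_rem v) //= -addrA lerDl addr_ge0 //.
  exact: sumr_ge0.
apply: le_trans sn; rewrite /s; apply: le_trans (ler_norm r) _.
by rewrite lerDr sumr_ge0.
Qed.

Let hb l (r : R) : exists n0, forall n x, (n0 <= n)%N -> `|x| <= r ->
  `|iter_dder l (f_ n.+1) x - iter_dder l (f_ n) x| <= 2^-1 ^+ n.+1.
Proof.
have [n0 h] := bound_l l r; exists n0 => n x /h [h1 h2 h3] xr.
by apply: hf => //; exact: le_trans h3.
Qed.

Let hdb l (r : R) : exists n0, forall n x v, (n0 <= n)%N -> `|x| <= r -> `|v| <= 1 ->
  `|'d (iter_dder l (f_ n.+1)) x v - 'd (iter_dder l (f_ n)) x v| <= 2^-1 ^+ n.+1.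
Proof.
(* The list [v :: l] is one longer than [l], and [v] has norm at most 1; both are absorbed by the
   shift. *)
have [n0 h] := bound_l l r; exists n0.+1 => n x v n0n xr v1.
have [h1 h2 h3] := h n.-1 ltac:(lia).
have nn : n.-1%:R <= n%:R :> R by rewrite ler_nat; lia.
have := @hf n (v :: l) x; rewrite /= !deriveE; [|exact: sm_iter_diff|exact: sm_iter_diff].
apply; first by apply: leq_ltn_trans h1 _; lia.
  move=> u; rewrite inE => /predU1P[->|/h2 hu]; last exact: le_trans hu nn.
  by apply: le_trans v1 _; rewrite ler1n; lia.
by apply: le_trans xr _; exact: le_trans h3 nn.
Qed.

Lemma iter_dder_limit_is_diff l x :
  is_diff x ((fun y => limn (fun n => iter_dder l (f_ n) y)) : V -> R)
    ((fun v => limn (fun n => 'd (iter_dder l (f_ n)) x v)) : V -> R).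
Proof.
apply: (@limit_is_diff _ _ (fun n => iter_dder l (f_ n))).
- by move=> n y; exact: sm_iter_diff.
- exact: hb.
- exact: hdb.
Qed.

Lemma iter_dder_limit l :
  iter_dder l (fun y => limn (f_ ^~ y)) = fun y => limn (fun n => iter_dder l (f_ n) y).
Proof.
elim: l => [//|v l IH] /=; rewrite IH; apply/funext => x.
have [h1 h2] := iter_dder_limit_is_diff l x.
have -> : (fun n => 'D_v (iter_dder l (f_ n)) x) = (fun n => 'd (iter_dder l (f_ n)) x v).
  by apply/funext => n; rewrite deriveE //; exact: sm_iter_diff.
by rewrite deriveE // h2.
Qed.

Lemma smooth_limit : smooth (fun y => limn (f_ ^~ y)).
Proof.
move=> l; rewrite iter_dder_limit.
split=> [x|x v]; have [h _] := iter_dder_limit_is_diff l x.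
  exact: differentiable_continuous.
exact: diff_derivable.
Qed.

End SmoothLimit.
End SmoothFamilies.

(** * Circle means *)

Section Riemann.
Variable R : realType.
Local Notation mu := (@lebesgue_measure R).

Lemma uniform_continuity_segment (F : R -> R) a b (e : R) : continuous F -> 0 < e ->
  exists2 d : R, 0 < d & forall x y, a <= x <= b -> `|x - y| < d -> `|F x - F y| <= e.
Proof.
move=> cF e0.
have /compact_near_coveringP/(_ _ (0^'+ : set_system R) (fun d x => forall y, `|x - y| < d -> `|F x - F y| <= e)) := @segment_compact R a b.
move=> /(_ _ _)[].
  move=> x _; have e2 : 0 < e / 2 by rewrite divr_gt0.
  have /cvgrPdist_lt /(_ _ e2) /nbhs_normP [d /= d0 hd] := cF x.
  exists ([set x' | `|x - x'| < d / 2], [set i | i < d / 2]) => /=.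
    split; first by apply/nbhs_normP; exists (d / 2) => //=; rewrite divr_gt0.
    by apply: nbhs_right_lt; rewrite divr_gt0.
  move=> [x' i] /= [h1 h2] y h3.
  have k1 : `|F x - F x'| < e / 2 by apply: hd => /=; lra.
  have k2 : `|F x - F y| < e / 2.
    apply: hd => /=; rewrite -(subrKA x' x); apply: le_lt_trans (ler_normD _ _) _; lra.
  rewrite -(subrKA (F x)); apply: le_trans (ler_normD _ _) _; rewrite distrC; lra.
move=> d /= d0 hd; exists (d / 2); first by rewrite divr_gt0.
move=> x y xab xy; apply: (hd (d / 2)) => //.
- by rewrite /ball /= sub0r normrN gtr0_norm ?divr_gt0 // gtr_pMr //; lra.
- by rewrite divr_gt0.
Qed.

(** Sums over arbitrarily fine subdivisions suffice, with any common offset t. On each piece the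
    mean value theorem for the primitive [G] gives a value of F, which differs from the sample by at
    most e / (2 pi). *)
Lemma riemann_lower (F : R -> R) (c : R) : continuous F ->
  (forall M0, exists M (t : R), [/\ (M0 <= M)%N, (0 < M)%N, 0 <= t <= 2 * pi / M%:R &
     M%:R * c <= \sum_(j < M) F (t + 2 * pi * j%:R / M%:R)]) ->
  (c%:E <= ((2 * pi)^-1)%:E * \int[mu]_(t in `[0%R, (2 * pi)%R]) (F t)%:E)%E.
Proof.
move=> cF hF.
have p0 : 0 < 2 * pi :> R by rewrite mulr_gt0 // pi_gt0.
have intF b : mu.-integrable `[0, b] (EFin \o F).
  apply: continuous_compact_integrable; first exact: segment_compact.
  exact: continuous_subspaceT.
pose G x := (\int[mu]_(t in `[0%R, x]) F t)%R.
have dG (x : R) : 0 < x -> is_derive x 1 G (F x).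
  move=> x0; have [] := @continuous_FTC1_closed R F 0 x (x + 1) _ (intF _) x0 (cF x).
    by rewrite ltrDl.
  by move=> h1 h2; apply: DeriveDef; [exact: h1|rewrite -derive1E; exact: h2].
have cG : {within `[0, 2 * pi], continuous G}.
  by apply: parameterized_integral_continuous => //; exact: ltW.
have G0 : G 0 = 0 by rewrite /G set_itv1 Rintegral_set1.
have -> : (\int[mu]_(t in `[0%R, (2 * pi)%R]) (F t)%:E = (G (2 * pi))%:E)%E.
  rewrite /G /Rintegral fineK //; apply: integrable_fin_num => //.
rewrite -EFinM lee_fin mulrC ler_pdivlMr //.
apply/ler_addgt0Pr => e e0.
have e2 : 0 < e / (2 * pi) by rewrite divr_gt0.
have [d d0 hd] := @uniform_continuity_segment F 0 (2 * pi) _ cF e2.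
have [M [t [M0M M0 /andP [t0 tM] hM]]] := hF (Num.bound `|2 * pi / d|).
have MR : 0 < M%:R :> R by rewrite ltr0n.
have step : 2 * pi / M%:R < d.
  rewrite ltr_pdivrMr // -ltr_pdivrMl // [d^-1 * _]mulrC.
  apply: le_lt_trans (ler_norm _) _; apply: lt_le_trans (archi_boundP (normr_ge0 _)) _.
  by rewrite ler_nat.
pose X (j : nat) : R := 2 * pi * j%:R / M%:R.
have Xge j : 0 <= X j by rewrite /X divr_ge0 // ?ler0n // mulr_ge0 // ?ltW.
have XS j : X j.+1 = X j + 2 * pi / M%:R.
  by rewrite /X -[j.+1%:R]natr1 mulrDr mulr1 mulrDl.
have Xle j : (j <= M)%N -> X j <= 2 * pi.
  by move=> jM; rewrite /X ler_pdivrMr // ler_pM2l // ler_nat.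
have XM : X M = 2 * pi by rewrite /X mulfK // gt_eqF.
have tel n : (n <= M)%N -> G (X n) >= (2 * pi / M%:R) * \sum_(j < n) (F (t + X j) - e / (2 * pi)).
  elim: n => [|n IH] nM; first by rewrite big_ord0 mulr0 /X mulr0 mul0r G0.
  rewrite big_ord_recr /= mulrDr.
  have lt : X n < X n.+1 by rewrite XS ltrDl divr_gt0.
  have [||x xin hx] := @MVT R G F (X n) (X n.+1) lt.
  - move=> x xin; apply: dG; apply: le_lt_trans (Xge n) _.
    by rewrite (itvP xin).
  - apply: continuous_subspaceW cG => x /=; rewrite !in_itv /= => /andP [x1 x2].
    by rewrite (le_trans (Xge n) x1) (le_trans x2 (Xle _ nM)).
  have -> : G (X n.+1) = G (X n) + F x * (2 * pi / M%:R).
    by rewrite -(subrK (G (X n)) (G (X n.+1))) hx addrC XS [X n + _]addrC addrK.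
  apply: lerD; first exact: IH (ltnW nM).
  rewrite mulrC ler_pM2r ?divr_gt0 // lerBlDr -lerBlDl.
  apply: le_trans (ler_norm _) _; apply: hd.
    rewrite addr_ge0 //=; apply: le_trans (Xle _ nM); rewrite XS addrC lerD2l //.
  move: xin; rewrite in_itv /= => /andP [x1 x2].
  rewrite XS in x2; rewrite ltr_norml; apply/andP; split; lra.
have := tel M (leqnn _); rewrite XM sumrB sumr_const card_ord => h.
have h2 : 2 * pi / M%:R * (M%:R * c - (e / (2 * pi)) *+ M) <= G (2 * pi).
  by apply: le_trans h; rewrite ler_pM2l ?divr_gt0 //; apply: lerB.
have e1 : 2 * pi / M%:R * (M%:R * c - (e / (2 * pi)) *+ M) = c * (2 * pi) - e.
  rewrite -[e / _ *+ M]mulr_natr; move: (2 * pi) p0 (M%:R) MR => q q0 m m0.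
  by field; rewrite !gt_eqF.
rewrite e1 in h2; lra.
Qed.

End Riemann.

(** * Discrete circle means of polynomials *)

Section CircleMeans.
Variable R : realType.
Local Notation C := R[i].

Definition cis (t : R) : C := (cos t +i* sin t)%C.

Lemma cis0 : cis 0 = 1. Proof. by rewrite /cis cos0 sin0. Qed.

Lemma cisD s t : cis (s + t) = cis s * cis t.
Proof.
apply: complex_ext; rewrite ?cReM ?cImM /= ?cosD ?sinD //.
by rewrite addrC.
Qed.

Lemma cisX t n : cis t ^+ n = cis (n%:R * t).
Proof.
elim: n => [|n IH]; first by rewrite mul0r cis0.
by rewrite exprS IH -cisD -[n.+1%:R]natr1 mulrDl mul1r addrC.
Qed.

Lemma cis2pi : cis (2 * pi) = 1.
Proof. by rewrite mulr_natl /cis cos2pi sin2pi. Qed.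

Lemma cis2piX n : cis (2 * pi * n%:R) = 1.
Proof. by rewrite mulrC -cisX cis2pi expr1n. Qed.

Lemma cmod_cis t : cmod (cis t) = 1.
Proof. by rewrite cmodE /= cos2Dsin2 sqrtr1. Qed.

Lemma cis_neq1 t : 0 < t < 2 * pi -> cis t != 1.
Proof.
move=> /andP [t0 t1]; apply/eqP => /(congr1 (@complex.Re R)) /= h.
have s0 : 0 < sin (t / 2) by apply: sin_gt0_pi; lra.
have : cos ((t / 2) *+ 2) = 1 by rewrite -mulr_natr divfK.
have := cos2Dsin2 (t / 2); rewrite cos_mulr2n; nra.
Qed.

(** A discrete mean value property: X^i with 0 < i < M sums to zero over the M-th roots of unity,
    and the bound on the size excludes higher powers. *)
Lemma roots_of_unity_mean (p : {poly C}) M : (0 < M)%N -> (size p <= M)%N ->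
  \sum_(j < M) p.[cis (2 * pi * j%:R / M%:R)] = M%:R * p.[0].
Proof.
move=> M0 sp.
have MR : M%:R != 0 :> R by rewrite pnatr_eq0 -lt0n.
under eq_bigr do rewrite (horner_coef_wide _ sp).
rewrite exchange_big /= horner_coef0.
rewrite (bigD1 (Ordinal M0)) //= [X in _ + X]big1 ?addr0.
  by under eq_bigr do rewrite expr0 mulr1; rewrite sumr_const card_ord mulr_natl.
move=> i i0; have i1 : (0 < i)%N by rewrite lt0n; exact: i0.
rewrite -mulr_sumr; set z := cis (2 * pi * i%:R / M%:R).
have -> : \sum_(j < M) cis (2 * pi * j%:R / M%:R) ^+ i = \sum_(j < M) z ^+ j.
  apply: eq_bigr => j _; rewrite /z !cisX; congr cis.
  by rewrite !mulrA [i%:R * _ * _]mulrAC [j%:R * _ * _]mulrAC -!mulrA; ring.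
have z1 : z != 1.
  apply: cis_neq1; rewrite divr_gt0 ?mulr_gt0 ?pi_gt0 ?ltr0n //=.
  by rewrite ltr_pdivrMr ?ltr0n // ltr_pM2l ?mulr_gt0 ?pi_gt0 // ltr_nat.
have : z ^+ M - 1 = 0.
  by rewrite /z cisX mulrC divfK // cis2piX subrr.
rewrite subrX1 => /eqP; rewrite mulf_eq0 subr_eq0 (negbTE z1) => /eqP ->.
by rewrite mulr0.
Qed.

Lemma max_on_roots (p : {poly C}) M : (0 < M)%N -> (size p <= M)%N ->
  exists2 j, (j < M)%N & cmod p.[0] <= cmod p.[cis (2 * pi * j%:R / M%:R)].
Proof.
move=> M0 sp; apply: contrapT => /forall2NP h.
have lt j : (j < M)%N -> cmod p.[cis (2 * pi * j%:R / M%:R)] < cmod p.[0].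
  by move=> jM; have [//|/negP] := h j; rewrite -ltNge.
have := congr1 (@cmod R) (roots_of_unity_mean M0 sp).
rewrite cmodM => e.
have : cmod (M%:R : C) * cmod p.[0] < M%:R * cmod p.[0].
  rewrite -e; apply: le_lt_trans (cmod_sum _ _ _) _.
  have -> : M%:R * cmod p.[0] = \sum_(j < M) cmod p.[0] by rewrite sumr_const card_ord mulr_natl.
  by apply: ltr_sum; [apply/hasP; exists (Ordinal M0) => //; rewrite mem_index_enum|move=> j _; exact: lt].
have -> : (M%:R : C) = (M%:R : R)%:C%C by rewrite rmorph_nat.
by rewrite cmod_real normr_nat ltxx.
Qed.

Lemma prod_periodic (phi : nat -> R) N s : (forall j, phi (j + N)%N = phi j) ->
  \prod_(j < N) phi (j + s)%N = \prod_(j < N) phi j.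
Proof.
move=> per; elim: s => [|s IH]; first by under eq_bigr do rewrite addn0.
rewrite -IH; case: N per {IH} => [|N] per; first by rewrite !big_ord0.
rewrite big_ord_recr [RHS]big_ord_recl /= mulrC; congr (_ * _).
  by rewrite add0n -(per s) addnC addSnnS.
by apply: eq_bigr => j _; rewrite /bump /= add1n addSnnS.
Qed.

(* Maximum principle for the product of the rotated polynomials [p (w^j X)]. *)
Lemma rotated_prod_ge (p : {poly C}) N : (0 < N)%N ->
  exists2 t : R, 0 <= t <= 2 * pi / N%:R &
    cmod p.[0] ^+ N <= \prod_(j < N) cmod p.[cis (t + 2 * pi * j%:R / N%:R)].
Proof.
move=> N0; have NR : N%:R != 0 :> R by rewrite pnatr_eq0 -lt0n.
pose w (j : nat) := cis (2 * pi * j%:R / N%:R).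
pose Q := \prod_(j < N) (p \Po ((w j)%:P * 'X)).
have QE x : Q.[x] = \prod_(j < N) p.[w j * x].
  by rewrite horner_prod; apply: eq_bigr => j _; rewrite horner_comp !hornerE.
(* The number N m of roots of unity exceeds the degree of Q and is a multiple of N. In l = s m + (l
   mod m) the remainder gives the angle t within one N-th of the circle, and s only permutes the
   factors. *)
pose m := (size Q).+1.
have mR : m%:R != 0 :> R by rewrite pnatr_eq0.
have Nm0 : (0 < N * m)%N by rewrite muln_gt0 N0.
have sQ : (size Q <= N * m)%N.
  by apply: leq_trans (leqnSn _) _; rewrite -/m leq_pmull.
have [l lNm hl] := max_on_roots Nm0 sQ.
pose s := (l %/ m)%N; pose t : R := 2 * pi * (l %% m)%N%:R / (N * m)%N%:R.
have tE j : t + 2 * pi * (j + s)%N%:R / N%:R = 2 * pi * j%:R / N%:R + 2 * pi * l%:R / (N * m)%N%:R.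
  rewrite [in RHS](divn_eq l m) -/s /t !natrD !natrM.
  move: (2 * pi) (N%:R) NR (m%:R) mR (s%:R) ((l %% m)%N%:R) (j%:R) => q n n0 m' m0' s' l' j'.
  by field; rewrite n0 m0'.
exists t.
  rewrite /t divr_ge0 ?mulr_ge0 ?pi_ge0 //=.
  rewrite ler_pdivrMr ?ltr0n // natrM mulrA divfK //.
  by rewrite ler_pM2l ?mulr_gt0 ?pi_gt0 // ler_nat ltnW // ltn_mod.
pose phi (j : nat) := cmod p.[cis (t + 2 * pi * j%:R / N%:R)].
have per j : phi (j + N)%N = phi j.
  have E : t + 2 * pi * (j + N)%N%:R / N%:R = (t + 2 * pi * j%:R / N%:R) + 2 * pi.
    by rewrite natrD mulrDr mulrDl (mulfK NR) addrA.
  by rewrite /phi E cisD cis2pi mulr1.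
rewrite -[leRHS](prod_periodic s per).
move: hl; rewrite !QE cmod_prod; under eq_bigr do rewrite mulr0.
rewrite prodr_const card_ord => /le_trans; apply.
rewrite cmod_prod; apply: ler_prod => j _; rewrite cmod_ge0 /= /phi.
by rewrite -cisD tE.
Qed.

Lemma ln_prod N (x : nat -> R) : (forall j, 0 < x j) ->
  ln (\prod_(j < N) x j) = \sum_(j < N) ln (x j).
Proof.
move=> x0; elim: N => [|N IH]; first by rewrite !big_ord0 ln1.
by rewrite !big_ord_recr /= lnM ?IH // posrE ?prodr_gt0.
Qed.

(** If the maximum at 0 is e, every summand is at least ln e; otherwise this is the logarithm of
    [rotated_prod_ge]. *)
Lemma logmax_mean (p : {poly C}) (e : R) N : (0 < N)%N -> 0 < e ->
  exists2 t : R, 0 <= t <= 2 * pi / N%:R &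
    N%:R * ln (Num.max (cmod p.[0]) e) <=
      \sum_(j < N) ln (Num.max (cmod p.[cis (t + 2 * pi * j%:R / N%:R)]) e).
Proof.
move=> N0 e0; have [t ht hp] := rotated_prod_ge p N0; exists t => //.
have m0 y : 0 < Num.max y e by rewrite lt_max e0 orbT.
have [pe|pe] := leP (cmod p.[0]) e.
  have -> : N%:R * ln e = \sum_(j < N) ln e by rewrite sumr_const card_ord mulr_natl.
  apply: ler_sum => j _.
  by rewrite ler_ln ?posrE // le_max lexx orbT.
rewrite -(ln_prod N (x := fun j => Num.max (cmod p.[cis (t + 2 * pi * j%:R / N%:R)]) e)) //.
rewrite [leLHS]mulr_natl -lnXn; last by apply: lt_trans pe.
rewrite ler_ln ?posrE ?exprn_gt0 ?prodr_gt0 //; last exact: lt_trans pe.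
apply: le_trans hp _; apply: ler_prod => j _.
by rewrite cmod_ge0 le_max lexx.
Qed.

Lemma sqr_mean N (x : nat -> R) c : \sum_(j < N) x j = N%:R * c ->
  N%:R * c ^+ 2 <= \sum_(j < N) x j ^+ 2.
Proof.
move=> hx; rewrite -subr_ge0.
have -> : \sum_(j < N) x j ^+ 2 - N%:R * c ^+ 2 = \sum_(j < N) (x j - c) ^+ 2.
  have -> : \sum_(j < N) (x j - c) ^+ 2 = \sum_(j < N) (x j ^+ 2 - (2 * c * x j - c ^+ 2)).
    by apply: eq_bigr => j _; ring.
  rewrite sumrB; congr (_ - _); rewrite sumrB -mulr_sumr hx sumr_const card_ord -[c ^+ 2 *+ N]mulr_natl.
  ring.
by apply: sumr_ge0 => j _; exact: sqr_ge0.
Qed.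

Lemma sqr_cmod_mean (p : {poly C}) N : (0 < N)%N -> (size p <= N)%N ->
  N%:R * cmod p.[0] ^+ 2 <= \sum_(j < N) cmod p.[cis (2 * pi * j%:R / N%:R)] ^+ 2.
Proof.
move=> N0 sp; have h := roots_of_unity_mean N0 sp.
have NE : (N%:R : C) = (N%:R : R)%:C%C by rewrite rmorph_nat.
pose z (j : nat) := p.[cis (2 * pi * j%:R / N%:R)].
have hR : \sum_(j < N) complex.Re (z j) = N%:R * complex.Re p.[0].
  have := congr1 (@complex.Re R) h; rewrite NE cReM /= mul0r subr0 => <-.
  by rewrite (big_morph _ (@cReD R) (erefl _)).
have hI : \sum_(j < N) complex.Im (z j) = N%:R * complex.Im p.[0].
  have := congr1 (@complex.Im R) h; rewrite NE cImM /= mul0r addr0 => <-.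
  by rewrite (big_morph _ (@cImD R) (erefl _)).
rewrite sqr_cmod mulrDr; under eq_bigr do rewrite sqr_cmod.
rewrite big_split /=; apply: lerD.
  exact: (sqr_mean (x := fun j => complex.Re (z j))).
exact: (sqr_mean (x := fun j => complex.Im (z j))).
Qed.

Lemma cpoly_disc k (f : Cpt R k.+1 -> C) (a b : Cpt R k.+1) : cpoly f ->
  exists q : {poly C}, forall l : Cpt R 1, f (a + Defs.cscale l b) = q.[co l 0].
Proof.
elim=> [c|j jk|{}f g _ [p hp] _ [q hq]|{}f g _ [p hp] _ [q hq]].
- by exists c%:P => l; rewrite hornerC.
- exists ((co a j)%:P + (co b j)%:P * 'X) => l.
  by rewrite coD cscaleE co_cs // !hornerE mulrC.
- by exists (p + q) => l; rewrite hornerD hp hq.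
- by exists (p * q) => l; rewrite hornerM hp hq.
Qed.

Lemma co_cexpi t : co (cexpi t : Cpt R 1) 0 = cis t.
Proof. by rewrite /co /cexpi /= !mxE. Qed.

Lemma circle_continuous k (a b : Cpt R k.+1) :
  continuous (fun t : R => a + Defs.cscale (cexpi t) b).
Proof.
have E : (fun t : R => a + Defs.cscale (cexpi t) b) = (fun t => a + (cos t *: b + sin t *: cmulI b)).
  apply/funext => t; congr (_ + _); rewrite /Defs.cscale /= !mxE.
  by case: b => b1 b2; rewrite /cmulI /=; congr pair; rewrite /= scalerN.
rewrite E => t; apply: cvgD; first exact: cvg_cst.
by apply: cvgD; apply: cvgZr_tmp; [exact: continuous_cos|exact: continuous_sin].
Qed.

End CircleMeans.

(** * The inductive construction *)

Section Step.
Variables (R : realType) (m : nat).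
Local Notation C := R[i].
Local Notation K := m.+2.
Local Notation pt := (Cpt R K.+1).

Definition stepmap (d : nat) (a : R) (z : pt) : pt :=
  mk K (fun i => if i == K then a%:C%C * co z 0 else co z i ^+ d + a%:C%C * co z i.+1).

Fixpoint stepinv_co (d : nat) (a : R) (w : pt) (i : nat) : C :=
  if i is i'.+1 then a%:C%C^-1 * (co w i' - stepinv_co d a w i' ^+ d) else a%:C%C^-1 * co w K.

Definition stepinv d a (w : pt) : pt := mk K (stepinv_co d a w).

Lemma co_stepmap d a z i : (i < K)%N -> co (stepmap d a z) i = co z i ^+ d + a%:C%C * co z i.+1.
Proof. by move=> iK; rewrite co_mk; [rewrite ltn_eqF|exact: ltnW]. Qed.

Lemma co_stepmap_last d a z : co (stepmap d a z) K = a%:C%C * co z 0.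
Proof. by rewrite co_mk // eqxx. Qed.

Lemma stepmap_auto d a : a != 0 -> polyauto (stepmap d a) (stepinv d a).
Proof.
move=> a0; have aC : a%:C%C != 0 :> C by rewrite -cmod_eq0 cmod_real normr_eq0.
split.
- apply: polymap_mk => j jK; case: eqP => [_|jK'].
    by apply: cpolyM; [exact: cpoly_cst|exact: cpoly_co].
  apply: cpolyD; first by apply: cpolyX; exact: cpoly_co.
  by apply: cpolyM; [exact: cpoly_cst|apply: cpoly_co; lia].
- apply: polymap_mk; elim=> [|j IH] jK /=.
    by apply: cpolyM; [exact: cpoly_cst|exact: cpoly_co].
  apply: cpolyM; first exact: cpoly_cst.
  apply: cpolyB; first by apply: cpoly_co; lia.
  by apply: cpolyX; apply: IH; lia.
- move=> z; apply: co_inj => j jK; rewrite co_mk //.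
  elim: j jK => [|j IH] jK /=; first by rewrite co_stepmap_last mulKf.
  by rewrite IH; [rewrite co_stepmap // addrC addKr mulKf|lia].
- move=> w; apply: co_inj => j jK; have [->|jK'] := eqVneq j K.
    by rewrite co_stepmap_last co_mk //= mulVKf.
  have jK2 : (j < K)%N by lia.
  by rewrite co_stepmap // !co_mk //= mulVKf // addrC subrK.
Qed.

Lemma stepmap0 d a : (0 < d)%N -> stepmap d a 0 = 0.
Proof.
move=> d0; have z0 j : co (0 : pt) j = 0 by rewrite /co /= !mxE.
apply: co_inj => j jK; rewrite co_mk // !z0.
by case: eqP => _; rewrite mulr0 // expr0n gtn_eqF // addr0.
Qed.

Lemma exists_argmax n (f : nat -> R) : exists2 j, (j <= n)%N & forall i, (i <= n)%N -> f i <= f j.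
Proof.
elim: n => [|n [j jn hj]]; first by exists 0%N => // i; rewrite leqn0 => /eqP ->.
have [h|h] := leP (f n.+1) (f j).
  exists j; first exact: leqW.
  by move=> i; rewrite leq_eqVlt => /predU1P[->//|]; exact: hj.
exists n.+1 => // i; rewrite leq_eqVlt => /predU1P[->//|/hj h'].
exact: le_trans h' (ltW h).
Qed.

(** Let mu be the largest of the first m + 1 moduli, attained at j. If mu > 2s, the bound on the
    image forces a |z_{j+1}| >= mu^d - s, hence |z_{j+1}| > mu^(d-1). For j < m this contradicts
    maximality, and for j = m the growth bound, since E < d. So old coordinates are at most 2s, and
    the new growth bound follows. *)
Lemma tame_step (V : set pt) (phi : pt -> pt) E d (a : R) :
  tame_at m [set co (phi z) | z in V] E -> (E < d)%N -> (1 < d)%N ->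
  0 < a <= 1 / 4 -> a * 4 ^+ E.+1 <= 2 ->
  tame_at m [set co (stepmap d a (phi z)) | z in V] (2 * E * d + 1).
Proof.
move=> [W1 W2] Ed d1 /andP [a0 a4] aE.
have cma z : cmod (a%:C%C * z) = a * cmod z by rewrite cmodM cmod_real gtr0_norm.
have key z s : V z -> 2 <= s -> (forall j, (j <= m)%N -> cmod (co (stepmap d a (phi z)) j) <= s) ->
    forall j, (j <= m)%N -> cmod (co (phi z) j) <= 2 * s.
  move=> Vz s2 hs.
  have [j jm hj] := exists_argmax m (fun j => cmod (co (phi z) j)).
  move=> i im; apply: le_trans (hj i im) _; rewrite leNgt; apply/negP => big.
  set mu := cmod (co (phi z) j) in hj big.
  have mu4 : 4 <= mu by lra.
  have mu1 : 1 <= mu by lra.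
  have mu0 : 0 < mu by lra.
  have powd : mu <= mu ^+ d by rewrite -{1}(expr1 mu) ler_weXn2l // ltnW.
  have powd1 : 0 < mu ^+ d.-1 by rewrite exprn_gt0.
  have pd : mu ^+ d = mu * mu ^+ d.-1 by rewrite -exprS prednK //; exact: ltnW.
  have low : mu ^+ d - s <= a * cmod (co (phi z) j.+1).
    have := hs j jm; rewrite co_stepmap; last exact: leqW.
    have := cmod_lbD (co (phi z) j ^+ d) (a%:C%C * co (phi z) j.+1).
    by rewrite cmodX cma -/mu => h1 h2; lra.
  have low2 : mu ^+ d.-1 < cmod (co (phi z) j.+1).
    have c0 := cmod_ge0 (co (phi z) j.+1).
    have : 2 * mu ^+ d.-1 <= mu ^+ d - s.
      have : 4 * mu ^+ d.-1 <= mu ^+ d by rewrite pd ler_wpM2r // ltW.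
      lra.
    nra.
  have : (j < m)%N \/ j = m by move: jm; clear; lia.
  case=> [jm'|jE].
    have := hj j.+1 jm'; have : mu <= mu ^+ d.-1.
      by apply: ler_eXnr => //; move: d1; clear; lia.
    lra.
  have [|h1 _] := W1 (co (phi z)) mu (ex_intro2 _ _ z Vz erefl) _ hj; first by lra.
  have Ed1 : (E <= d.-1)%N by move: Ed; clear; lia.
  have : mu ^+ E <= mu ^+ d.-1 by exact: ler_weXn2l.
  by rewrite jE in low2; lra.
split=> [_ s [z Vz <-] s2 hs|_ [z Vz <-] hs].
  have hk := key z s Vz s2 hs.
  have s1 : 1 <= s by lra.
  have s22 : 2 * s <= s ^+ 2 by rewrite expr2; nra.
  have [|h1 h2] := W1 (co (phi z)) (2 * s) (ex_intro2 _ _ z Vz erefl) _ hk; first by lra.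
  have sE : (2 * s) ^+ E <= s ^+ (2 * E).
    by rewrite exprM; apply: lerXn2r => //; rewrite nnegrE; [lra|rewrite exprn_ge0 //; lra].
  split.
    rewrite co_stepmap //; apply: le_trans (cmodD _ _) _; rewrite cmodX cma.
    have t1 : cmod (co (phi z) m.+1) ^+ d <= s ^+ (2 * E * d).
      rewrite exprM; apply: lerXn2r; rewrite ?nnegrE ?cmod_ge0 ?exprn_ge0 //; first lra.
      exact: le_trans h1 sE.
    have t2 : a * cmod (co (phi z) K) <= s ^+ (2 * E * d).
      apply: (@le_trans _ _ (s ^+ (2 * E))); last first.
        by rewrite ler_weXn2l // leq_pmulr // ltnW.
      apply: le_trans _ (le_trans h2 sE); rewrite ler_piMl ?cmod_ge0 //; lra.
    rewrite exprD expr1; have : 0 <= s ^+ (2 * E * d) by apply: exprn_ge0; lra.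
    nra.
  rewrite co_stepmap_last cma.
  have := hk 0%N (leq0n _); have := cmod_ge0 (co (phi z) 0).
  have : s <= s ^+ (2 * E * d + 1) by apply: ler_eXnr => //; rewrite addn1.
  nra.
(* For the polydisc take s = 2: the first m + 1 old coordinates are at most 4, so every a z_{i+1} is
   at most a 4^(E+1) <= 2. A coordinate of modulus above 2 would have an image of modulus above 4 -
   2. *)
have two : (2 : R) <= 2 by [].
have hk := key z 2 Vz two (fun j jm => hs j (leqW jm)).
have [|h1 h2] := W1 (co (phi z)) (2 * 2) (ex_intro2 _ _ z Vz erefl) _ hk; first by lra.
have e22 : (2 * 2 : R) = 4 by ring.
rewrite e22 in h1 h2 hk.
have E4 : 4 <= 4 ^+ E.+1 :> R by rewrite -{1}(expr1 4) ler_weXn2l //; lra.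
have EE : 4 ^+ E <= 4 ^+ E.+1 :> R by rewrite ler_weXn2l //; lra.
have all4 j : (j <= K)%N -> a * cmod (co (phi z) j) <= 2.
  move=> jK; apply: le_trans aE; rewrite ler_pM2l //.
  have : (j <= m)%N \/ (j = m.+1 \/ j = K) by lia.
  case=> [/hk h|[->|->]]; first exact: le_trans h E4.
    exact: le_trans h1 EE.
  exact: le_trans h2 EE.
apply: (W2 _ (ex_intro2 _ _ z Vz erefl)) => j jK.
rewrite leNgt; apply/negP => big.
have := hs j jK; rewrite co_stepmap //.
have := cmod_lbD (co (phi z) j ^+ d) (a%:C%C * co (phi z) j.+1).
rewrite cmodX cma => l1 l2.
have := all4 j.+1 jK.
have : cmod (co (phi z) j) ^+ 2 <= cmod (co (phi z) j) ^+ d by rewrite ler_weXn2l //; lra.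
rewrite expr2; nra.
Qed.

End Step.

(** * States of the induction and the choice of a_n *)

Section Construction.
Variables (R : realType) (m : nat).
Local Notation C := R[i].
Local Notation K := m.+2.
Local Notation pt := (Cpt R K.+1).

(* [phi] is the composition so far and [psi] its inverse; [wt i] is the weight [P_i].
   On [|z| <= n] all components of [phi] stay below [scut], [psi] maps the polydisc of
   radius [scut] into [|z| <= rad], [ubd] bounds the weights and dual fields on that ball
   and [eps] bounds the later changes of the defining functions there. *)
Record state := State {
  phi : pt -> pt; psi : pt -> pt; wt : nat -> pt -> R;
  scut : R; rad : R; eps : R; ubd : R }.

Definition defn (st : state) (i : nat) (z : pt) : R :=
  (cmod (co (phi st z) i) ^+ 2 - 1) / wt st i z.

(* The field that [phi] straightens to [h_j d/dw_j]; the differentials of the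
   moduli of the components of [phi] are dual to these fields. *)
Definition dual_field (st : state) (j : nat) (z : pt) : pt :=
  'd (psi st) (phi st z) (mk K (fun l => if l == j then co (phi st z) l else 0)).

Definition next_wt (d : nat) (st : state) (i : nat) (z : pt) : R :=
  wt st i z * \sum_(j < d) (cmod (co (phi st z) i) ^+ 2) ^+ j.

Variables (V : set pt) (dd Ex : nat -> nat) (cap : nat -> R).

(** The inequality in [inv_ubd] serves diagonal dominance: evaluated on the dual fields, the d rho_i
    have diagonal entries near 7 / (4 ubd) or larger, while the at most K other entries of a row are
    bounded by 4 eps ubd each. *)
Record state_ok (n : nat) (st : state) : Prop := StateOk {
  inv_auto : polyauto (phi st) (psi st);
  inv_wt : forall i, (i < K)%N -> sm (wt st i) /\ forall z, 1 <= wt st i z;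
  inv_tame : tame_at m [set co (phi st z) | z in V] (Ex n);
  inv_rad : n%:R <= rad st;
  inv_cut : forall z j, `|z| <= n%:R -> cmod (co (phi st z) j) < scut st;
  inv_cut_rad : forall w, (forall j, (j < K.+1)%N -> cmod (co w j) <= scut st) -> `|psi st w| <= rad st;
  inv_eps : 0 < eps st /\ eps st <= 2^-1 ^+ n.+1;
  inv_ubd : 1 <= ubd st /\ eps st * (8 * K%:R * ubd st ^+ 2) <= 1;
  inv_bound : forall z i j, `|z| <= rad st -> (i < K)%N -> (j < K)%N ->
    [/\ wt st i z <= ubd st, `|dual_field st j z| <= ubd st &
        `|'d (wt st i) z (dual_field st j z)| <= ubd st] }.

(** All estimates refer to the ball of radius [rad st], fixed before [a]. The sequence [cap] is an
    upper bound for a_n prescribed in advance; it will make the potential converge. *)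
Record state_step (n : nat) (st st' : state) (a : R) : Prop := StateStep {
  step_a : 0 < a <= 1 / 4;
  step_cap : a <= cap n;
  step_phi : phi st' = fun z => stepmap (dd n) a (phi st z);
  step_psi : psi st' = fun w => psi st (stepinv (dd n) a w);
  step_wt : wt st' = next_wt (dd n) st;
  step_small : forall z i, `|z| <= rad st -> (i < K)%N ->
    a * cmod (co (phi st z) i.+1) <= 1 / 8 * (3 / 4) ^+ n;
  step_smooth : forall i l z, (i < K)%N -> (size l <= n)%N ->
    (forall v, v \in l -> `|v| <= n%:R) -> `|z| <= rad st ->
    `|iter_dder l (defn st' i) z - iter_dder l (defn st i) z| <= eps st;
  step_diff : forall i z v, (i < K)%N -> `|z| <= rad st ->
    `|'d (defn st' i) z v - 'd (defn st i) z v| <= eps st * `|v|;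
  step_rad : rad st <= rad st';
  step_eps : eps st' <= eps st / 2 }.

Lemma sm_sqr_cmod (f : pt -> C) : cpoly f -> sm (fun z => cmod (f z) ^+ 2).
Proof.
move=> /sm_cpoly [f1 f2]; under eq_fun do rewrite sqr_cmod.
by apply: smD; exact: smX.
Qed.

Lemma sm_next_wt d st i : polymap (phi st) -> (i < K.+1)%N -> sm (wt st i) -> sm (next_wt d st i).
Proof.
move=> pp iK sw; apply: smM => //.
apply: (@sm_sum _ _ d (fun j z => (cmod (co (phi st z) i) ^+ 2) ^+ j)) => j.
by apply: smX; apply: sm_sqr_cmod; exact: pp.
Qed.

Lemma next_wt_ge1 d st i z : (0 < d)%N -> 1 <= wt st i z -> wt st i z <= next_wt d st i z.
Proof.
move=> d0 w1; rewrite /next_wt; case: d d0 => // d _; rewrite big_ord_recl expr0.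
rewrite mulrDr mulr1 lerDl; apply: mulr_ge0; first lra.
by apply: sumr_ge0 => j _; rewrite exprn_ge0 // sqr_ge0.
Qed.

Lemma sm_defn st i : polymap (phi st) -> (i < K.+1)%N -> sm (wt st i) ->
  (forall z, 1 <= wt st i z) -> sm (defn st i).
Proof.
move=> pp iK sw w1; apply: smM; last exact: smV.
by apply: smB; [apply: sm_sqr_cmod; exact: pp|exact: sm_cst].
Qed.

Lemma sqr_cmodD (x y : C) : cmod (x + y) ^+ 2 =
  cmod x ^+ 2 + (2 * (complex.Re x * complex.Re y + complex.Im x * complex.Im y) + cmod y ^+ 2).
Proof. by rewrite !sqr_cmod cReD cImD; ring. Qed.

(* Dividing by the weight makes [|h|^2 - 1] and [|h^d|^2 - 1] have the same defining
   function, so that only the perturbation [a * h_{i+1}] changes it. *)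
Lemma defn_next st st' d (a : R) i z : (0 < d)%N -> (i < K)%N -> 1 <= wt st i z ->
  phi st' = (fun z => stepmap d a (phi st z)) -> wt st' = next_wt d st ->
  let h := co (phi st z) i ^+ d in let g := co (phi st z) i.+1 in
  defn st' i z = defn st i z + a * (
    (2 * (complex.Re h * complex.Re g + complex.Im h * complex.Im g)) / next_wt d st i z +
    a * (cmod g ^+ 2 / next_wt d st i z)).
Proof.
move=> d0 iK w1 ep ew h g; rewrite /defn ep ew co_stepmap // sqr_cmodD -/h -/g.
have nw := next_wt_ge1 (i := i) (z := z) d0 w1.
have w0 : wt st i z != 0 by apply/eqP; lra.
set S := \sum_(j < d) (cmod (co (phi st z) i) ^+ 2) ^+ j.
have nwE : next_wt d st i z = wt st i z * S by [].
have S0 : S != 0 by apply/eqP => S0; rewrite nwE S0 in nw; lra.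
have E : cmod h ^+ 2 - 1 = (cmod (co (phi st z) i) ^+ 2 - 1) * S.
  by rewrite /S -subrX1 /h cmodX -!exprM mulnC.
have -> : (cmod (co (phi st z) i) ^+ 2 - 1) / wt st i z = (cmod h ^+ 2 - 1) / next_wt d st i z.
  by rewrite E nwE; field; rewrite w0 S0.
rewrite cmodM cmod_real cReM cImM /= !mul0r subr0 addr0 exprMn real_normK ?num_real //.
rewrite nwE; field; rewrite w0 S0 //.
Qed.

Lemma finite_bound (A : set pt) (f : nat -> pt -> R) n :
  (forall i, (i < n)%N -> exists M, forall z, A z -> f i z <= M) ->
  exists M, 1 <= M /\ forall i z, (i < n)%N -> A z -> f i z <= M.
Proof.
elim: n => [|n IH] h; first by exists 1; split.
have [|M [M1 hM]] := IH; first by move=> i lin; apply: h; exact: ltnW.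
have [N hN] := h n (ltnSn n).
exists (Num.max M N); split; first by rewrite le_max M1.
move=> i z; rewrite ltnS leq_eqVlt => /predU1P[->|lin] Az; rewrite le_max.
  by rewrite (hN z Az) orbT.
by rewrite (hM i z lin Az).
Qed.

Lemma polymap_bounded k l (T : Cpt R k.+1 -> Cpt R l.+1) (r : R) : polymap T ->
  exists M, 1 <= M /\ forall z, `|z| <= r -> `|T z| <= M /\ forall j, cmod (co (T z) j) <= M.
Proof.
move=> pT.
have [M [M1 hM]] : exists M, 1 <= M /\ forall z, `|z| <= r -> `|T z| <= M.
  suff: forall n, (n <= l.+1)%N -> exists M, 1 <= M /\ forall z, `|z| <= r -> forall j, (j < n)%N -> cmod (co (T z) j) <= M.
    move=> /(_ l.+1 (leqnn _)) [M [M1 hM]]; exists M; split=> // z zr.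
    by apply: norm_le_co; [lra|exact: hM].
  elim=> [|n IH] nl; first by exists 1; split.
  have [M [M1 hM]] := IH (ltnW nl); have [N [N0 hN]] := cpoly_bounded r (pT n nl).
  exists (M + N); split; first lra.
  move=> z zr j; rewrite ltnS leq_eqVlt => /predU1P[->|jn].
    by apply: le_trans (hN z zr) _; lra.
  by apply: le_trans (hM z zr j jn) _; lra.
exists (2 * M); split; first lra.
move=> z zr; have := hM z zr; split; first lra.
by move=> j; apply: le_trans (cmod_co_le _ _) _; rewrite ler_pM2l //.
Qed.

Lemma polymap_diff_bounded k l (T : Cpt R k.+1 -> Cpt R l.+1) (r : R) : polymap T ->
  exists M, 0 <= M /\ forall z v, `|z| <= r -> `|'d T z v| <= M * `|v|.
Proof.
move=> pT; suff: forall n, (n <= l.+1)%N -> exists M, 0 <= M /\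
    forall z v, `|z| <= r -> forall j, (j < n)%N -> cmod (co ('d T z v) j) <= M * `|v|.
  move=> /(_ l.+1 (leqnn _)) [M [M1 hM]]; exists M; split=> // z v zr.
  by apply: norm_le_co; [rewrite mulr_ge0|exact: hM].
elim=> [|n IH] nl; first by exists 0; split.
have [M [M0 hM]] := IH (ltnW nl); have [N [N0 hN]] := cder_bounded r (pT n nl).
exists (M + N); split; first lra.
move=> z v zr j; rewrite mulrDl ltnS leq_eqVlt => /predU1P[->|jn].
  by rewrite co_diff // (le_trans (hN z v zr)) // lerDr mulr_ge0.
by rewrite (le_trans (hM z v zr j jn)) // lerDl mulr_ge0.
Qed.

Lemma state_bound (st : state) (r : R) : polyauto (phi st) (psi st) ->
  (forall i, (i < K)%N -> sm (wt st i)) ->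
  exists M, 1 <= M /\ forall z i j, `|z| <= r -> (i < K)%N -> (j < K)%N ->
    [/\ wt st i z <= M, `|dual_field st j z| <= M & `|'d (wt st i) z (dual_field st j z)| <= M].
Proof.
move=> [pp ps _ _] sw.
have [A [A1 hA]] := polymap_bounded r pp.
have [B [B0 hB]] := polymap_diff_bounded A ps.
have hD z j : `|z| <= r -> (j < K)%N -> `|dual_field st j z| <= B * A.
  move=> zr jK; have [h1 h2] := hA z zr.
  apply: le_trans (hB _ _ h1) _; rewrite ler_wpM2l //; apply: norm_le_co; first lra.
  by move=> l lK; rewrite co_mk //; case: eqP => _ //; rewrite cmod0; lra.
have BA : 0 <= B * A by rewrite mulr_ge0 //; lra.
have [M1 [M11 hM1]] : exists M, 1 <= M /\ forall i z, (i < K)%N -> `|z| <= r -> wt st i z <= M.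
  apply: (@finite_bound [set z | `|z| <= r]) => i iK.
  have [M hM] := bounded_ders_bound (sw i iK 0 0%N (lexx _)) r.
  by exists M => z zr; apply: le_trans (ler_norm _) _; exact: hM.
(* [finite_bound] knows functions of z only, so the bound over all directions is passed to it as a
   supremum. *)
have [M2 [M21 hM2]] : exists M, 1 <= M /\ forall i z, (i < K)%N -> `|z| <= r ->
     sup [set `|'d (wt st i) z v| | v in [set v | `|v| <= B * A]] <= M.
  apply: (@finite_bound [set z | `|z| <= r]) => i iK.
  have [_ _ [bF _ _]] := sw i iK (B * A) 1%N BA; have [M hM] := bF r.
  exists M => z zr; apply: ge_sup; first by exists (`|'d (wt st i) z 0|), 0 => //=; rewrite normr0.
  move=> _ [v vr <-]; apply: (hM (fun x => 'd (wt st i) x v)) => //.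
  by exists (wt st i), v.
exists (M1 + M2 + B * A); split; first lra.
move=> z i j zr iK jK; split.
- by apply: le_trans (hM1 i z iK zr) _; lra.
- by apply: le_trans (hD z j zr jK) _; lra.
- apply: (@le_trans _ _ M2); last lra.
  apply: le_trans (hM2 i z iK zr); apply: ub_le_sup; last first.
    by exists (dual_field st j z) => //=; exact: hD.
  have [_ _ [bF _ _]] := sw i iK (B * A) 1%N BA; have [M hM] := bF r.
  exists M => _ [v vr <-]; apply: (hM (fun x => 'd (wt st i) x v)) => //.
  by exists (wt st i), v.
Qed.

(** The order of choice prevents circularity: a bound A of phi on |z| <= n gives the cut A + 1, the
    image of that polydisc under psi fixes the radius, the radius fixes the bound M, and [eps] comes
    last. *)
Lemma complete_state n ph ps w (r0 e0 : R) : polyauto ph ps ->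
  (forall i, (i < K)%N -> sm (w i) /\ forall z, 1 <= w i z) ->
  tame_at m [set co (ph z) | z in V] (Ex n) -> 0 < e0 -> e0 <= 2^-1 ^+ n.+1 ->
  exists st, [/\ state_ok n st, phi st = ph, psi st = ps & wt st = w] /\ r0 <= rad st /\ eps st <= e0.
Proof.
move=> aph hw tm e00 en; have [pp pps _ _] := aph.
have [A [A1 hA]] := polymap_bounded n%:R pp.
have [B [B1 hB]] := polymap_bounded (A + 1) pps.
pose r := Num.max (Num.max r0 n%:R) B.
(* The zeros are placeholders: [state_bound] concerns only [phi], [psi] and [wt]. *)
have [M [M1 hM]] := @state_bound (State ph ps w 0 0 0 0) r aph (fun i iK => (hw i iK).1).
have K0 : 0 < 8 * K%:R * M ^+ 2.
  by apply: mulr_gt0; [rewrite mulr_gt0 ?ltr0n|rewrite exprn_gt0 //; lra].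
pose e := Num.min e0 (8 * K%:R * M ^+ 2)^-1.
have e_gt0 : 0 < e by rewrite lt_min e00 invr_gt0.
exists (State ph ps w (A + 1) r e M); split; last first.
  by rewrite /= /r /e !le_max ge_min !lexx.
split=> //; split=> //=.
- by rewrite /r !le_max lexx orbT.
- move=> z j zn; have [_ h] := hA z zn; apply: le_lt_trans (h j) _; lra.
- move=> v hv; have [|h _] := hB v; first by apply: norm_le_co => //; lra.
  by rewrite /r !le_max h !orbT.
- by split=> //; rewrite /e ge_min en.
- split=> //; rewrite -ler_pdivlMr // div1r /e ge_min lexx orbT //.
Qed.

Lemma finite_small n (Q : nat -> R -> Prop) :
  (forall i, (i < n)%N -> exists2 a0 : R, 0 < a0 & forall a, 0 < a <= a0 -> Q i a) ->
  exists2 a0 : R, 0 < a0 & forall i a, (i < n)%N -> 0 < a <= a0 -> Q i a.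
Proof.
elim: n => [|n IH] h; first by exists 1.
have [|a0 a00 h0] := IH; first by move=> i lin; apply: h; exact: ltnW.
have [a1 a10 h1] := h n (ltnSn n).
exists (Num.min a0 a1); first by rewrite lt_min a00.
move=> i a; rewrite ltnS le_min leq_eqVlt => /predU1P[->|lin] /andP [aa /andP [b0 b1]].
  by apply: h1; rewrite aa.
by apply: h0 => //; rewrite aa.
Qed.

Hypothesis dd_gt : forall n, (Ex n < dd n)%N /\ (1 < dd n)%N.
Hypothesis ExS : forall n, Ex n.+1 = (2 * Ex n * dd n + 1)%N.
Hypothesis cap_gt0 : forall n, 0 < cap n.

(** Every requirement holds for all sufficiently small positive a, and there are finitely many of
    them. *)
Lemma exists_step n st : state_ok n st -> exists st' a, state_step n st st' a /\ state_ok n.+1 st'.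
Proof.
move=> I; have [pp pps _ _] := inv_auto I; have [e0 en] := inv_eps I.
have [dE d1] := dd_gt n; have d0 : (0 < dd n)%N by lia.
have [A [A1 hA]] := polymap_bounded (rad st) pp.
pose gA i (z : pt) : R := (2 * (complex.Re (co (phi st z) i ^+ dd n) * complex.Re (co (phi st z) i.+1) +
   complex.Im (co (phi st z) i ^+ dd n) * complex.Im (co (phi st z) i.+1))) / next_wt (dd n) st i z.
pose gB i (z : pt) : R := cmod (co (phi st z) i.+1) ^+ 2 / next_wt (dd n) st i z.
have nw1 i z : (i < K)%N -> 1 <= next_wt (dd n) st i z.
  move=> iK; have [_ w1] := inv_wt I iK; apply: le_trans (w1 z) _.
  exact: next_wt_ge1.
have smnw i : (i < K)%N -> sm (next_wt (dd n) st i).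
  by move=> iK; apply: sm_next_wt => //; [lia|have [] := inv_wt I iK].
have smiw i : (i < K)%N -> sm (fun z => (next_wt (dd n) st i z)^-1).
  by move=> iK; apply: smV; [move=> z; exact: nw1|exact: smnw].
have pco i : (i < K.+1)%N -> cpoly (fun z => co (phi st z) i) by exact: pp.
have smgA i : (i < K)%N -> sm (gA i).
  move=> iK; apply: smM; last exact: smiw.
  have [a1 a2] := sm_cpoly (cpolyX (dd n) (pco i ltac:(lia))).
  have [b1 b2] := sm_cpoly (pco i.+1 ltac:(lia)).
  by apply: smM; [exact: sm_cst|apply: smD; exact: smM].
have smgB i : (i < K)%N -> sm (gB i).
  by move=> iK; apply: smM; [apply: sm_sqr_cmod; apply: pco; lia|exact: smiw].
have [a1 a10 h1] := @finite_small K (fun i a => let f' z := defn st i z + a * (gA i z + a * gB i z) in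
    (forall l z, (size l <= n)%N -> (forall v, v \in l -> `|v| <= n%:R) -> `|z| <= rad st ->
       `|iter_dder l f' z - iter_dder l (defn st i) z| <= eps st) /\
    (forall z v, `|z| <= rad st -> `|'d f' z v - 'd (defn st i) z v| <= eps st * `|v|))
  (fun i iK => small_perturbation n (rad st)
     (sm_defn pp (ltnW iK : (i < K.+1)%N) (inv_wt I iK).1 (inv_wt I iK).2) (smgA i iK) (smgB i iK) e0).
(* [b0] serves the contraction of balls, [b1] is the condition of [tame_step], and [b2] makes the
   perturbations of the components summable on the ball of radius [rad st]. *)
pose b0 : R := 1 / 4; pose b1 : R := 2 / 4 ^+ (Ex n).+1; pose b2 : R := 1 / 8 * (3 / 4) ^+ n / A.
have b1p : 0 < b1 by rewrite divr_gt0 // exprn_gt0.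
have b2p : 0 < b2 by rewrite divr_gt0 ?mulr_gt0 ?exprn_gt0 //; lra.
pose a := Num.min (Num.min a1 (cap n)) (Num.min b0 (Num.min b1 b2)).
have a0 : 0 < a by rewrite !lt_min a10 cap_gt0 b1p b2p andbT /= divr_gt0.
have aa1 : a <= a1 by rewrite !ge_min lexx.
have acap : a <= cap n by rewrite !ge_min lexx !orbT.
have ab0 : a <= b0 by rewrite !ge_min lexx !orbT.
have ab1 : a <= b1 by rewrite !ge_min lexx !orbT.
have ab2 : a <= b2 by rewrite !ge_min lexx !orbT.
have an0 : a != 0 by rewrite gt_eqF.
have [|||||st' [[I' ep eps' ew] [hr he]]] := @complete_state n.+1 (fun z => stepmap (dd n) a (phi st z))
    (fun w => psi st (stepinv (dd n) a w)) (next_wt (dd n) st) (rad st) (eps st / 2).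
- exact: polyauto_comp (inv_auto I) (stepmap_auto _ _ an0).
- by move=> i iK; split=> [|z]; [exact: smnw|exact: nw1].
- rewrite ExS; apply: tame_step => //; first exact: inv_tame I.
    by rewrite a0.
  by rewrite -ler_pdivlMr ?exprn_gt0.
- by rewrite divr_gt0.
- by rewrite exprS mulrC ler_pM2l // invr_gt0.
exists st', a; split=> //.
have dE' i (iK : (i < K)%N) : defn st' i = fun z => defn st i z + a * (gA i z + a * gB i z).
  by apply/funext => z; apply: (defn_next d0 iK ((inv_wt I iK).2 z) ep ew).
split=> //.
- by rewrite a0.
- move=> z i zr iK; have [_ h] := hA z zr.
  apply: le_trans (ler_pM (ltW a0) (cmod_ge0 _) ab2 (h i.+1)) _.
  by rewrite /b2 divfK // gt_eqF //; lra.
- move=> i l z iK sl hl zr; rewrite dE' //.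
  have [|h _] := h1 i a iK; first by rewrite a0.
  exact: h.
- move=> i z v iK zr; rewrite dE' //.
  have [|_ h] := h1 i a iK; first by rewrite a0.
  exact: h.
Qed.

Lemma exists_sequence st0 : state_ok 0 st0 -> exists (st : nat -> state) (a : nat -> R),
  [/\ st 0%N = st0, forall n, state_ok n (st n) & forall n, state_step n (st n) (st n.+1) (a n)].
Proof.
move=> I0.
have ex (p : nat * state) : exists q : state * R, state_ok p.1 p.2 ->
    state_step p.1 p.2 q.1 q.2 /\ state_ok p.1.+1 q.1.
  have [I|nI] := pselect (state_ok p.1 p.2); last by exists (p.2, 0).
  by have [st' [a h]] := exists_step I; exists (st', a).
have [g hg] := choice ex.
pose st := fix st n := if n is n'.+1 then (g (n', st n')).1 else st0.
have Ist n : state_ok n (st n).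
  by elim: n => [//|n IH]; have [] := hg (n, st n) IH.
exists st, (fun n => (g (n, st n)).2); split=> // n.
by have [] := hg (n, st n) (Ist n).
Qed.

End Construction.

Section Starshaped.
Variable R : realType.

Lemma starshaped_connected (V : normedModType R) (A : set V) : A 0 ->
  (forall (t : R) x, 0 <= t <= 1 -> A x -> A (t *: x)) -> connected A.
Proof.
move=> A0 hA.
have -> : A = \bigcup_(x in A) [set t *: x | t in `[0, 1]%classic].
  apply/seteqP; split => [x Ax|y [x Ax [t]]].
    exists x => //; exists 1; last by rewrite scale1r.
    by rewrite /= in_itv /= ler01 lexx.
  by rewrite /= in_itv /= => t01 <-; exact: hA.
apply: bigcup_connected.
  exists 0 => x Ax; exists 0; last by rewrite scale0r.
  by rewrite /= in_itv /= lexx ler01.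
move=> x Ax; apply: connected_continuous_connected.
  by apply/connected_intervalP; exact: interval_is_interval.
by apply: continuous_subspaceT; exact: scalel_continuous.
Qed.

Lemma geometric_cvg0 (u : nat -> R) A r N : 0 <= r < 1 -> (forall n, 0 <= u n) ->
  (forall k, u (N + k)%N <= A * r ^+ k) -> u @ \oo --> (0 : R).
Proof.
move=> /andP [r0 r1] u0 hu; apply/cvgrPdist_le => e e0; rewrite /=.
have c : (fun k => A * r ^+ k : R) @ \oo --> A * (0 : R).
  by apply: cvgM; [exact: cvg_cst|apply: cvg_expr; rewrite ger0_norm].
rewrite mulr0 in c; move/cvgr0Pnorm_lt: c => /(_ e e0) [k0 _ hk].
exists (N + k0)%N => // k /= nk; rewrite sub0r normrN ger0_norm //.
have nk' : (N <= k)%N by apply: leq_trans nk; exact: leq_addr.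
rewrite -(subnKC nk'); apply: le_trans (hu _) _; apply: le_trans (ler_norm _) _.
by apply/ltW/hk; rewrite /= leq_subRL.
Qed.

End Starshaped.

(** * Plurisubharmonicity from discrete means *)

Section Psh.
Variables (R : realType) (k : nat).
Local Notation C := R[i].
Local Notation pt := (Cpt R k.+1).

Lemma closed_bounded_compact (A : set pt) (M : R) : closed A -> (forall z, A z -> `|z| <= M) -> compact A.
Proof.
move=> cA bA.
have cB n : compact [set v : 'rV[R]_n.+1 | `|v| <= M].
  apply: bounded_closed_compact.
    by exists M; split; rewrite ?num_real // => x Mx v vM; apply: le_trans vM (ltW Mx).
  apply: (@preimage_closed _ _ (fun v : 'rV[R]_n.+1 => `|v|) [set x | x <= M]); last exact: closed_le.
  by move=> v _; exact: norm_continuous.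
apply: (@subclosed_compact _ _ ([set v | `|v| <= M] `*` [set v | `|v| <= M])) => //.
  exact: (compact_setX (cB k) (cB k)).
by move=> z /bA; rewrite prod_normE ge_max => /andP [].
Qed.

Definition sqsum (fs : seq (pt -> C)) (z : pt) : R := \sum_(f <- fs) cmod (f z) ^+ 2.

Definition all_cpoly (fs : seq (pt -> C)) := forall i, (i < size fs)%N -> cpoly (nth (fun=> 0) fs i).

Lemma all_cpoly_cons f fs : all_cpoly (f :: fs) -> cpoly f /\ all_cpoly fs.
Proof. by move=> h; split=> [|i ifs]; [exact: (h 0%N)|exact: (h i.+1)]. Qed.

Lemma sqsum_continuous fs : all_cpoly fs -> continuous (sqsum fs).
Proof.
elim: fs => [_ z|f fs IH /all_cpoly_cons [pf pfs] z]; rewrite /sqsum.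
  by under eq_fun do rewrite big_nil; exact: cvg_cst.
under eq_fun do rewrite big_cons.
apply: cvgD; last exact: IH.
apply: (@continuous_comp _ _ _ (fun z : pt => cmod (f z)) (fun x : R => x ^+ 2)).
  exact: cpoly_cmod_continuous.
exact: exprn_continuous.
Qed.

Definition coords : seq (pt -> C) := [seq (fun z => co z j) | j <- iota 0 k.+1].

Lemma hnorm2_sqsum : @hnorm2 R k.+1 = sqsum coords.
Proof.
apply/funext => z; rewrite hnorm2E /sqsum big_map.
by rewrite -(big_mkord xpredT (fun j => cmod (co z j) ^+ 2)) /index_iota subn0.
Qed.

Lemma coords_cpoly : all_cpoly coords.
Proof.
move=> i; rewrite size_map size_iota => ik.
by rewrite (nth_map 0%N) ?size_iota // nth_iota //; exact: cpoly_co.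
Qed.

Lemma hnorm2_continuous : continuous (@hnorm2 R k.+1).
Proof. by rewrite hnorm2_sqsum; exact: sqsum_continuous coords_cpoly. Qed.

Lemma cmod_le_hnorm2 (z : pt) j : (j < k.+1)%N -> cmod (co z j) ^+ 2 <= hnorm2 z.
Proof.
move=> jk; rewrite hnorm2E (bigD1 (Ordinal jk)) //= lerDl.
by apply: sumr_ge0 => i _; exact: sqr_ge0.
Qed.

Lemma hnorm2_ge0 (z : pt) : 0 <= hnorm2 z.
Proof. by rewrite hnorm2E; apply: sumr_ge0 => i _; exact: sqr_ge0. Qed.

Lemma norm_le_sqrt_hnorm2 (z : pt) : `|z| <= Num.sqrt (hnorm2 z).
Proof.
apply: norm_le_co; first exact: sqrtr_ge0.
move=> j jk; rewrite -(ger0_norm (cmod_ge0 (co z j))) -sqrtr_sqr ler_wsqrtr //.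
exact: cmod_le_hnorm2.
Qed.

Lemma circle_in_closed_disc (t : R) : closed_disc (cexpi t).
Proof.
rewrite /closed_disc /= hnorm2E big_ord1 co_cexpi.
by rewrite cmod_cis expr1n.
Qed.

Lemma cscale0 (b : pt) : Defs.cscale (0 : Cpt R 1) b = 0.
Proof.
rewrite cscaleE; apply: co_inj => j jk; rewrite co_cs //.
by rewrite /co /= !mxE mul0r.
Qed.

Definition circ (a b : pt) (t : R) : pt := a + Defs.cscale (cexpi t) b.

(* The Lebesgue mean over a circle is bounded below through Riemann sums with a free
   starting angle. *)
Lemma psh_from_means (U : set pt) (u : pt -> R) : open U ->
  (forall z, U z -> {for z, continuous u}) ->
  (forall a b : pt, (forall l, closed_disc l -> U (a + Defs.cscale l b)) -> forall e : R, 0 < e ->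
     forall M0, exists M (t : R), [/\ (M0 <= M)%N, (0 < M)%N, 0 <= t <= 2 * pi / M%:R &
       M%:R * (u a - e) <= \sum_(j < M) u (circ a b (t + 2 * pi * j%:R / M%:R))]) ->
  psh U (fun z => (u z)%:E).
Proof.
move=> oU cu hu; split=> //.
- by move=> z _; rewrite ltry.
- move=> z Uz c; rewrite lte_fin => uc.
  have cz : u @ z --> u z := cu z Uz.
  have Fz : Filter (nbhs z) := nbhs_filter z.
  have uz : nbhs z [set w | u w < c] by exact: (cvgr_lt _ cz).
  have sub : [set w | u w < c] `<=` [set w | ((u w)%:E < c%:E)%E] by move=> w; rewrite /= lte_fin.
  exact: (filterS sub uz).
- move=> a b hab.
  have cF : continuous (fun t => u (circ a b t)).
    move=> t; apply: (@continuous_comp _ _ _ (circ a b) u).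
      exact: circle_continuous.
    by apply: cu; apply: hab; exact: circle_in_closed_disc.
  apply/lee_subgt0Pr => e e0; rewrite -EFinB.
  have hM M0 : exists M t, [/\ (M0 <= M)%N, (0 < M)%N, 0 <= t <= 2 * pi / M%:R &
      M%:R * (u a - e) <= \sum_(j < M) (fun t => u (circ a b t)) (t + 2 * pi * j%:R / M%:R)].
    by have [M [t h]] := hu a b hab e e0 M0; exists M, t.
  exact: riemann_lower cF hM.
Qed.

Lemma lim_uniform_continuous_at (u : pt -> R) (z : pt) :
  (forall e : R, 0 < e -> exists f : pt -> R, {for z, continuous f} /\ \forall w \near z, `|u w - f w| <= e) ->
  {for z, continuous u}.
Proof.
move=> hu; have Fz : Filter (nbhs z) := nbhs_filter z.
apply/cvgrPdist_le => e e0.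
have e3 : 0 < e / 3 by rewrite divr_gt0.
have [f [cf hf]] := hu _ e3.
have hz := nbhs_singleton hf.
have cz : f @ z --> f z := cf.
have cf' : nbhs z [set w | `|f z - f w| <= e / 3] by move/cvgrPdist_le: cz; apply.
apply: (filterS _ (filterI hf cf')) => w [/= h1 h2].
have -> : u z - u w = (u z - f z) + (f z - f w) - (u w - f w) by ring.
apply: le_trans (ler_normB _ _) _.
have := ler_normD (u z - f z) (f z - f w); lra.
Qed.

Lemma sqsum_mean fs a b : all_cpoly fs -> exists M0, forall M, (M0 <= M)%N -> (0 < M)%N ->
  M%:R * sqsum fs a <= \sum_(j < M) sqsum fs (circ a b (2 * pi * j%:R / M%:R)).
Proof.
elim: fs => [_|f fs IH /all_cpoly_cons [pf pfs]].
  exists 0%N => M _ _; rewrite /sqsum big_nil mulr0; apply: sumr_ge0 => j _.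
  by rewrite big_nil.
have [M0 hM0] := IH pfs; have [q hq] := cpoly_disc a b pf.
exists (maxn M0 (size q)) => M; rewrite geq_max => /andP [M1 M2] M3.
rewrite /sqsum big_cons mulrDr; under [leRHS]eq_bigr do rewrite big_cons.
rewrite big_split; apply: lerD; last exact: hM0.
have fa : f a = q.[0] by rewrite -[a]addr0 -(cscale0 b) hq /co /= !mxE.
have fc t : f (circ a b t) = q.[cis t] by rewrite /circ hq co_cexpi.
rewrite fa; apply: le_trans (sqr_cmod_mean M3 M2) _.
by apply: ler_sum => i _; rewrite fc.
Qed.

End Psh.

(** * The basin *)

Section LimitDomains.
Variables (R : realType) (m : nat).
Local Notation C := R[i].
Local Notation K := m.+2.
Local Notation pt := (Cpt R K.+1).
Variables (V : set pt) (dd Ex : nat -> nat) (cap : nat -> R).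
Variables (st : nat -> state R m) (a : nat -> R).
Hypothesis dd_gt : forall n, (Ex n < dd n)%N /\ (1 < dd n)%N.
Hypothesis Hinv : forall n, state_ok V Ex n (st n).
Hypothesis Hstep : forall n, state_step dd cap n (st n) (st n.+1) (a n).

Definition h n i z := co (phi (st n) z) i.
Definition rho i (z : pt) : R := limn (fun n => defn (st n) i z).

Lemma rad_mono n k : (n <= k)%N -> rad (st n) <= rad (st k).
Proof.
elim: k => [|k IH]; first by rewrite leqn0 => /eqP ->.
rewrite leq_eqVlt => /predU1P[->//|nk]; apply: le_trans (IH nk) _.
exact: step_rad (Hstep k).
Qed.

Lemma eps_decay n k : eps (st (n + k)%N) <= eps (st n) * 2^-1 ^+ k.
Proof.
elim: k => [|k IH]; first by rewrite addn0 expr0 mulr1.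
rewrite addnS; apply: le_trans (step_eps (Hstep _)) _.
by rewrite exprSr mulrA ler_pM2r.
Qed.

Lemma h_step n i z : (i < K)%N -> h n.+1 i z = h n i z ^+ dd n + (a n)%:C%C * h n i.+1 z.
Proof. by move=> iK; rewrite /h (step_phi (Hstep n)) co_stepmap. Qed.

Lemma h_step_last n z : h n.+1 K z = (a n)%:C%C * h n 0 z.
Proof. by rewrite /h (step_phi (Hstep n)) co_stepmap_last. Qed.

Lemma a_gt0 n : 0 < a n. Proof. by have /andP [] := step_a (Hstep n). Qed.
Lemma a_le n : a n <= 1 / 4. Proof. by have /andP [] := step_a (Hstep n). Qed.

Lemma h_perturb n i z : (i < K)%N -> `|z| <= rad (st n) ->
  cmod (h n.+1 i z - h n i z ^+ dd n) <= 1 / 8 * (3 / 4) ^+ n.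
Proof.
move=> iK zr; rewrite h_step // addrC addKr cmodM cmod_real gtr0_norm ?a_gt0 //.
exact: (step_small (Hstep n)).
Qed.

Lemma phi_polymap n : polymap (phi (st n)). Proof. by have [] := inv_auto (Hinv n). Qed.

Lemma h_cpoly n i : (i < K.+1)%N -> cpoly (h n i).
Proof. by move=> iK; exact: phi_polymap. Qed.

Lemma sm_defn_st n i : (i < K)%N -> sm (defn (st n) i).
Proof.
move=> iK; have [h1 h2] := inv_wt (Hinv n) iK.
by apply: sm_defn => //; [exact: phi_polymap|exact: ltnW].
Qed.

Lemma defn_close i n l z : (i < K)%N -> (size l <= n)%N -> (forall v, v \in l -> `|v| <= n%:R) ->
  `|z| <= n%:R -> `|iter_dder l (defn (st n.+1) i) z - iter_dder l (defn (st n) i) z| <= 2^-1 ^+ n.+1.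
Proof.
move=> iK sl hl zn; apply: le_trans (inv_eps (Hinv n)).2.
by apply: (step_smooth (Hstep n)) => //; apply: le_trans zn (inv_rad (Hinv n)).
Qed.

Lemma rho_smooth i : (i < K)%N -> smooth (rho i).
Proof.
move=> iK; apply: (@smooth_limit _ _ (fun n => defn (st n) i)) => [n|n l z].
  exact: sm_defn_st.
exact: defn_close.
Qed.

Lemma rho_is_diff i z : (i < K)%N ->
  is_diff z (rho i) ((fun v => limn (fun n => 'd (defn (st n) i) z v)) : pt -> R).
Proof.
move=> iK; apply: (@iter_dder_limit_is_diff _ _ (fun n => defn (st n) i) _ _ [::]) => [n|n l x].
  exact: sm_defn_st.
exact: defn_close.
Qed.

Lemma defn_step n i z : (i < K)%N -> `|z| <= rad (st n) ->
  `|defn (st n.+1) i z - defn (st n) i z| <= eps (st n).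
Proof.
by move=> iK zr; apply: (step_smooth (Hstep n) (l := [::])) => // v; rewrite in_nil.
Qed.

Lemma half_shift n j : 2 ^+ n * 2^-1 ^+ (n + j) = 2^-1 ^+ j :> R.
Proof. by rewrite exprD mulrA -exprMn divff ?expr1n ?mul1r. Qed.

(* A geometric tail: the perturbations from step [n] on add up to at most [2 eps_n]. *)
Lemma tail_bound (u : nat -> R) c n : 0 <= c ->
  (forall k, (n <= k)%N -> `|u k.+1 - u k| <= c * eps (st k)) ->
  u @ \oo --> limn u /\ `|limn u - u n| <= c * (2 * eps (st n)).
Proof.
move=> c0 hu; have [e0 _] := inv_eps (Hinv n).
have c1 : 0 <= c * (2 ^+ n.+1 * eps (st n)) by rewrite !mulr_ge0 // ?exprn_ge0 // ltW.
have [|cv hn] := @halving_cvg R u _ n c1.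
  move=> k nk; apply: le_trans (hu k nk) _.
  rewrite -mulrA ler_wpM2l // -(subnKC nk); apply: le_trans (eps_decay _ _) _.
  by rewrite -addSn mulrAC half_shift mulrC.
split=> //; have := hn n (leqnn n).
by rewrite exprS -!mulrA [eps _ * _]mulrC [2 ^+ n * _]mulrA -[X in 2^-1 ^+ X]addn0 half_shift expr0 mul1r.
Qed.

Lemma defn_tail i n z : (i < K)%N -> `|z| <= rad (st n) ->
  (fun k => defn (st k) i z) @ \oo --> rho i z /\ `|rho i z - defn (st n) i z| <= 2 * eps (st n).
Proof.
move=> iK zr; have [|h1 h2] := @tail_bound (fun k => defn (st k) i z) 1 n ler01.
  by move=> k nk; rewrite mul1r; apply: defn_step => //; exact: le_trans zr (rad_mono nk).
by split=> //; rewrite mul1r in h2.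
Qed.

Lemma diff_tail i n z v : (i < K)%N -> `|z| <= rad (st n) ->
  `|'d (rho i) z v - 'd (defn (st n) i) z v| <= 2 * eps (st n) * `|v|.
Proof.
move=> iK zr; have [|h1 h2] := @tail_bound (fun k => 'd (defn (st k) i) z v) `|v| n (normr_ge0 _).
  move=> k nk; rewrite mulrC; apply: (step_diff (Hstep k)) => //.
  exact: le_trans zr (rad_mono nk).
by have [_ ->] := rho_is_diff z iK; rewrite mulrC.
Qed.

Lemma rad_large (z : pt) n0 : exists n, (n0 <= n)%N /\ `|z| <= n%:R.
Proof.
exists (maxn n0 (Num.bound `|z|)); split; first exact: leq_maxl.
apply: le_trans (ltW (archi_boundP (normr_ge0 z))) _.
by rewrite ler_nat leq_maxr.
Qed.

Lemma norm_le_rad (z : pt) n : `|z| <= n%:R -> `|z| <= rad (st n).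
Proof. by move=> zn; apply: le_trans zn (inv_rad (Hinv n)). Qed.

(** * The domains D_i and their limit defining functions *)

Definition Dom i : set pt := [set z | (fun n => cmod (h n i z)) @ \oo --> (0 : R)].

(** The second condition keeps z in the ball where all later perturbations are controlled, so that
    membership in D_i is decided at stage n. It also makes the tube the preimage of a starshaped
    set, hence connected. *)
Definition tube n i : set pt :=
  [set z | cmod (h n i z) < 1 / 2 /\ forall j, (j < K.+1)%N -> cmod (h n j z) < scut (st n)].

Lemma tube_rad n i z : tube n i z -> `|z| <= rad (st n).
Proof.
move=> [_ hz]; have [_ _ pK _] := inv_auto (Hinv n).
by rewrite -(pK z); apply: (inv_cut_rad (Hinv n)) => j jK; apply/ltW/hz.
Qed.

(** With p = (3/4)^k, squaring gives at most (1/2)(1/2) p and the perturbation adds at most p/8; the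
    sum (3/8) p is (1/2)(3/4)^(k+1). *)
Lemma tube_decay n i z : (i < K)%N -> tube n i z ->
  forall k, cmod (h (n + k) i z) <= 1 / 2 * (3 / 4) ^+ k.
Proof.
move=> iK tz; have zr := tube_rad tz; case: tz => h1 _; elim=> [|k IH].
  by rewrite addn0 expr0 mulr1 ltW.
rewrite addnS; have zk : `|z| <= rad (st (n + k)) by apply: le_trans zr (rad_mono (leq_addr _ _)).
have := h_perturb iK zk; set x := h (n + k) i z in IH *; set y := h (n + k).+1 i z => hp.
have pk : 0 < (3 / 4 : R) ^+ k by apply: exprn_gt0.
have pn : (3 / 4 : R) ^+ n <= 1 by apply: exprn_ile1; lra.
have x0 := cmod_ge0 x.
have x1 : cmod x <= 1.
  have : (3 / 4 : R) ^+ k <= 1 by apply: exprn_ile1; lra.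
  lra.
have xd : cmod x ^+ dd (n + k) <= cmod x ^+ 2.
  by apply: ler_wiXn2l => //; have [] := dd_gt (n + k).
have := cmod_lbD y (- x ^+ dd (n + k)); rewrite cmodN cmodX => l1.
have xx : cmod x ^+ 2 <= 1 / 2 * (1 / 2 * (3 / 4) ^+ k).
  rewrite expr2; apply: ler_pM => //.
  have : (3 / 4 : R) ^+ k <= 1 by apply: exprn_ile1; lra.
  lra.
rewrite exprD in hp; rewrite exprS.
have : (3 / 4 : R) ^+ n * (3 / 4) ^+ k <= (3 / 4) ^+ k by rewrite ler_piMl // ltW.
lra.
Qed.

Lemma Dom_tube i z : Dom i z -> exists n0, forall n, (n0 <= n)%N -> tube n i z.
Proof.
move=> /cvgr0Pnorm_lt /(_ (1 / 2) ltac:(lra)) [n1 _ hn1].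
have [n2 [n12 zn]] := rad_large z n1.
exists n2 => n n2n; split.
  by have := hn1 n (leq_trans n12 n2n); rewrite ger0_norm ?cmod_ge0.
by move=> j jK; apply: (inv_cut (Hinv n)); apply: le_trans zn _; rewrite ler_nat.
Qed.

Lemma tube_Dom n i : (i < K)%N -> tube n i `<=` Dom i.
Proof.
move=> iK z tz; apply: (@geometric_cvg0 _ _ (1 / 2) (3 / 4) n); first lra.
  by move=> k; exact: cmod_ge0.
exact: tube_decay.
Qed.

Lemma wt_ge1 n i z : (i < K)%N -> 1 <= wt (st n) i z.
Proof. by move=> iK; have [_] := inv_wt (Hinv n) iK. Qed.

Lemma eps_small n : [/\ 0 < eps (st n), 1 <= ubd (st n),
  4 * eps (st n) * ubd (st n) <= 1 / 4 & eps (st n) * (8 * K%:R * ubd (st n) ^+ 2) <= 1].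
Proof.
have [e0 _] := inv_eps (Hinv n); have [M1 hM] := inv_ubd (Hinv n).
split=> //; have K2 : 2 <= K%:R :> R by rewrite ler_nat.
have M0 : 0 < ubd (st n) by lra.
have : 16 * ubd (st n) <= 8 * K%:R * ubd (st n) ^+ 2.
  have : ubd (st n) <= ubd (st n) ^+ 2 by rewrite expr2 ler_peMr //; lra.
  have := M0; nra.
move=> h16; have : eps (st n) * (16 * ubd (st n)) <= 1 by apply: le_trans hM; rewrite ler_pM2l.
lra.
Qed.

(** If rho_i < 0, weights at least 1 give |h_{n,i}|^2 <= 1 - c for large n, and from there the
    recursion decays geometrically. Conversely, in a tube the value at stage n is at most -3 / (4
    ubd), which the tail 2 eps cannot compensate. *)
Lemma rho_neg i : (i < K)%N -> [set z | rho i z < 0] = Dom i.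
Proof.
move=> iK; apply/seteqP; split => z /=.
  move=> rz; have [n0 [_ zn0]] := rad_large z 0.
  have [cv _] := defn_tail iK (norm_le_rad zn0).
  pose c := - rho i z / 2; have c0 : 0 < c by rewrite /c; lra.
  have [n1 _ hn1] := (cvgr_lt _ cv) (- c) ltac:(rewrite /c; lra).
  pose N := maxn n0 n1.
  have hx n : (N <= n)%N -> cmod (h n i z) ^+ 2 <= 1 - c.
    move=> Nn; have dn : defn (st n) i z < - c by exact: (hn1 n (leq_trans (leq_maxr _ _) Nn)).
    have w1 := wt_ge1 n z iK.
    rewrite /defn ltr_pdivrMr -/(h n i z) in dn; last lra.
    by move: (cmod _ ^+ 2) dn => x dn; nra.
  pose q := Num.sqrt (1 - c).
  have c1 : 0 <= 1 - c by apply: le_trans (hx N (leqnn _)); exact: sqr_ge0.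
  have q1 : q < 1 by rewrite /q -[ltRHS]sqrtr1 ltr_sqrt //; lra.
  have q0 : 0 <= q by exact: sqrtr_ge0.
  have hq n : (N <= n)%N -> cmod (h n i z) <= q.
    move=> Nn; rewrite -(ger0_norm (cmod_ge0 _)) -sqrtr_sqr ler_wsqrtr //; exact: hx.
  (* These are chosen so that q A + 1/8 <= A r with r >= 3/4, which is the inductive step for |h| <=
     A r^k. *)
  pose r := Num.max ((1 + q) / 2) (7 / 8); pose A := 1 + (1 - q)^-1.
  have r1 : r < 1 by rewrite /r gt_max; apply/andP; split; lra.
  have qr : (1 + q) / 2 <= r by rewrite le_max lexx.
  have r78 : 7 / 8 <= r by rewrite le_max lexx orbT.
  have iq : 0 < (1 - q)^-1 by rewrite invr_gt0; lra.
  have A1 : 1 <= A by rewrite /A; lra.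
  have Arq : q * A + 1 / 8 <= A * r.
    have : (1 - q) * A = (1 - q) + 1 by rewrite /A mulrDr mulr1 divff //; apply/eqP; lra.
    nra.
  apply: (@geometric_cvg0 _ _ A r N) => [|n|]; first by rewrite r1 andbT; lra.
    exact: cmod_ge0.
  elim=> [|k IH]; first by rewrite addn0 expr0 mulr1; apply: le_trans (hq N (leqnn _)) _; lra.
  rewrite addnS; have Nk : (N <= N + k)%N by exact: leq_addr.
  have zk : `|z| <= rad (st (N + k)).
    by apply: le_trans (norm_le_rad zn0) (rad_mono _); apply: leq_trans Nk; exact: leq_maxl.
  have := h_perturb iK zk; have := hq _ Nk.
  set x := h (N + k) i z in IH *; set y := h (N + k).+1 i z => xq hp.
  have xd : cmod x ^+ dd (N + k) <= cmod x ^+ 2.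
    by apply: ler_wiXn2l; [exact: cmod_ge0|lra|have [] := dd_gt (N + k)].
  have := cmod_lbD y (- x ^+ dd (N + k)); rewrite cmodN cmodX => l1.
  have xx : cmod x ^+ 2 <= q * (A * r ^+ k).
    by rewrite expr2; apply: ler_pM; rewrite ?cmod_ge0 //; lra.
  have rk : 0 <= r ^+ k by apply: exprn_ge0; lra.
  have p34 : 1 / 8 * (3 / 4) ^+ (N + k) <= 1 / 8 * r ^+ k.
    rewrite ler_wpM2l //.
    rewrite exprD; apply: (@le_trans _ _ ((3 / 4) ^+ k)).
      by rewrite ler_piMl ?exprn_ge0 ?exprn_ile1 //; lra.
    by apply: lerXn2r; rewrite ?nnegrE; lra.
  have : (q * A + 1 / 8) * r ^+ k <= A * r * r ^+ k by rewrite ler_wpM2r.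
  rewrite exprS; lra.
move=> Dz; have [n0 hn0] := Dom_tube Dz.
have tz := hn0 n0 (leqnn _); have zr := tube_rad tz.
have [_ tl] := defn_tail iK zr.
have [e0 M1 eM _] := eps_small n0.
have [w2 _ _] := inv_bound (Hinv n0) zr iK iK.
have w1 := wt_ge1 n0 z iK.
case: tz => h1 _.
have : defn (st n0) i z <= - (3 / 4) / wt (st n0) i z.
  rewrite /defn ler_pM2r ?invr_gt0; last lra.
  by have := cmod_ge0 (h n0 i z); rewrite -/(h n0 i z) expr2; nra.
have : - (3 / 4) / wt (st n0) i z <= - (3 / 4) / ubd (st n0).
  rewrite !mulNr lerN2 ler_wpM2l //.
  by rewrite lef_pV2 ?posrE //; lra.
have : 2 * eps (st n0) < (3 / 4) / ubd (st n0).
  by rewrite ltr_pdivlMr; lra.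
move: tl; rewrite ler_norml; lra.
Qed.

Definition center : pt := psi (st 0) 0.

Lemma co0 k j : co (0 : Cpt R k.+1) j = 0. Proof. by rewrite /co /= !mxE. Qed.

Lemma phi_center n : phi (st n) center = 0.
Proof.
elim: n => [|n IH]; first by have [_ _ _ pK] := inv_auto (Hinv 0); exact: pK.
by rewrite (step_phi (Hstep n)) IH stepmap0 //; have [_] := dd_gt n; exact: ltnW.
Qed.

Lemma phi_center_h n j : h n j center = 0.
Proof. by rewrite /h phi_center co0. Qed.

Lemma Dom_center i : Dom i center.
Proof.
have E : (fun n => cmod (h n i center)) = fun=> 0.
  by apply/funext => n; rewrite phi_center_h cmod0.
by rewrite /Dom /= E; exact: cvg_cst.
Qed.

Lemma tube_connected n i : (i < K)%N -> connected (tube n i).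
Proof.
move=> iK; have [_ ps pK qK] := inv_auto (Hinv n).
have -> : tube n i = psi (st n) @` [set w | cmod (co w i) < 1 / 2 /\ forall j, (j < K.+1)%N -> cmod (co w j) < scut (st n)].
  apply/seteqP; split => z; first by exists (phi (st n) z).
  by move=> [w hw <-]; rewrite /tube /= /h qK.
apply: connected_continuous_connected; last first.
  by apply: continuous_subspaceT; exact: polymap_continuous.
have s0 : 0 < scut (st n).
  apply: le_lt_trans (cmod_ge0 _) (inv_cut (Hinv n) (z := 0) 0%N _).
  by rewrite normr0.
have coZ (t : R) (w : pt) j : 0 <= t <= 1 -> cmod (co (t *: w) j) <= cmod (co w j).
  move=> /andP [t0 t1]; have -> : co (t *: w) j = t%:C%C * co w j.
    by apply: complex_ext; rewrite ?cReM ?cImM /co /= !mxE !mul0r ?subr0 ?addr0.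
  by rewrite cmodM cmod_real ger0_norm // ler_piMl // cmod_ge0.
apply: starshaped_connected.
  by split=> [|j _]; rewrite co0 cmod0 //; lra.
move=> t w t01 [h1 h2]; split=> [|j jK]; apply: le_lt_trans (coZ _ _ _ t01) _ => //.
exact: h2.
Qed.

Lemma tube_center n i : tube n i center.
Proof.
split=> [|j _]; rewrite phi_center_h cmod0 //.
apply: le_lt_trans (cmod_ge0 _) (inv_cut (Hinv n) (z := 0) 0%N _).
by rewrite normr0.
Qed.

Lemma Dom_connected i : (i < K)%N -> connected (Dom i).
Proof.
move=> iK; have -> : Dom i = \bigcup_(n in setT) tube n i.
  apply/seteqP; split=> z.
    by move=> /(Dom_tube) [n hn]; exists n => //; exact: hn.
  by move=> [n _]; apply: (tube_Dom).
apply: bigcup_connected; first by exists center => n _; exact: tube_center.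
by move=> n _; exact: tube_connected.
Qed.

Lemma Dom_near_tube i z : (i < K)%N -> Dom i z -> exists n, nbhs z (tube n i).
Proof.
move=> iK /(Dom_tube) [n0 hn0].
have [n [n0n zn]] := rad_large z n0.
exists n.+1; have [hz _] := hn0 n.+1 (leqW n0n).
have Fz : Filter (nbhs z) := nbhs_filter z.
have iK1 : (i < K.+1)%N by exact: ltnW.
have cz : (fun w => cmod (h n.+1 i w)) @ z --> cmod (h n.+1 i z).
  exact: (cpoly_cmod_continuous (h_cpoly n.+1 iK1)).
have n1 : nbhs z [set w | cmod (h n.+1 i w) < 1 / 2] by exact: (cvgr_lt _ cz).
have nz : (fun w : pt => `|w|) @ z --> `|z| by exact: norm_continuous.
have n2 : nbhs z [set w : pt | `|w| < n.+1%:R].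
  by apply: (cvgr_lt _ nz); apply: le_lt_trans zn _; rewrite ltr_nat.
apply: filterS (filterI n1 n2) => w [/= h1 h2]; split=> // j jK.
by apply: (inv_cut (Hinv n.+1)); exact: ltW.
Qed.

Lemma Dom_open i : (i < K)%N -> open (Dom i).
Proof.
move=> iK; rewrite -(rho_neg iK).
have [cr _] := rho_smooth iK [::].
by apply: (@open_comp _ _ (rho i) [set x | x < 0]); [move=> z _; exact: cr|exact: open_lt].
Qed.

(** * Exhaustion functions and pseudoconvexity of D_i *)

Definition exh_part i N : seq (pt -> C) :=
  coords R K ++ [seq (fun z => h n i z ^+ 2) | n <- iota 0 N].

Definition exhaustion i (z : pt) : R := limn (fun N => sqsum (exh_part i N) z).

Lemma exh_part_cpoly i N : (i < K)%N -> all_cpoly (exh_part i N).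
Proof.
move=> iK j; rewrite size_cat nth_cat => jN.
case: ltnP => [jk|jk]; first exact: coords_cpoly.
move: jN; rewrite -ltn_subLR // !size_map !size_iota => jN.
rewrite (nth_map 0%N) ?size_iota //.
by apply: cpolyX; apply: (h_cpoly); exact: ltnW.
Qed.

Lemma exh_part_next i N z :
  sqsum (exh_part i N.+1) z = sqsum (exh_part i N) z + cmod (h N i z) ^+ 4.
Proof.
by rewrite /sqsum /exh_part -[N.+1]addn1 iotaD map_cat catA big_cat /= big_seq1 add0n cmodX -exprM.
Qed.

Lemma exh_part_mono i z : nondecreasing_seq (fun N => sqsum (exh_part i N) z).
Proof.
apply/nondecreasing_seqP => N; rewrite exh_part_next lerDl exprn_ge0 // cmod_ge0 //.
Qed.

(** The fourth powers are taken because (3/4)^4 < 1/2 < (3/4)^2: the terms then decrease fast enough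
    for the halving criterion. *)
Lemma exhaustion_approx i n z : (i < K)%N -> tube n i z ->
  (fun N => sqsum (exh_part i N) z) @ \oo --> exhaustion i z /\
  forall N, (n <= N)%N -> `|exhaustion i z - sqsum (exh_part i N) z| <= 2 ^+ n * 2^-1 ^+ N.
Proof.
move=> iK tz; apply: halving_cvg; first by rewrite exprn_ge0.
move=> N nN; rewrite exh_part_next addrC addKr ger0_norm ?exprn_ge0 ?cmod_ge0 //.
rewrite -(subnKC nN) -addnS; set k := (N - n)%N.
rewrite [in leRHS]exprD mulrA -exprMn divff // expr1n mul1r.
have hk := tube_decay iK tz k.
apply: le_trans (_ : (1 / 2 * (3 / 4) ^+ k) ^+ 4 <= _).
  by apply: lerXn2r; rewrite ?nnegrE ?cmod_ge0 // (le_trans (cmod_ge0 _) hk).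
rewrite exprMn -exprM mulnC exprM [in leRHS]exprS; apply: ler_pM; rewrite ?exprn_ge0 //; try lra.
by apply: lerXn2r; rewrite ?nnegrE ?exprn_ge0 //; lra.
Qed.

Lemma exh_part_le i N z : (i < K)%N -> Dom i z -> sqsum (exh_part i N) z <= exhaustion i z.
Proof.
move=> iK /(Dom_tube) [n hn]; have [cv _] := exhaustion_approx iK (hn n (leqnn n)).
apply: (@nondecreasing_cvgn_le R (fun N => sqsum (exh_part i N) z)) => //; exact: exh_part_mono.
Qed.

Lemma half_pow_small (c e : R) n : 0 < e -> exists2 N, (n <= N)%N & c * 2^-1 ^+ N <= e.
Proof.
move=> e0; have cv : (fun N => c * 2^-1 ^+ N) @ \oo --> c * (0 : R).
  by apply: cvgM; [exact: cvg_cst|exact: cvg_half].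
rewrite mulr0 in cv; have [N0 _ hN0] := (cvgr_lt _ cv) e e0.
exists (maxn n N0); first exact: leq_maxl.
by apply: ltW; apply: hN0; exact: leq_maxr.
Qed.

Lemma exhaustion_continuous i z : (i < K)%N -> Dom i z -> {for z, continuous (exhaustion i)}.
Proof.
move=> iK Dz; apply: lim_uniform_continuous_at => e e0.
have [n hn] := Dom_near_tube iK Dz.
have [N nN hN] := half_pow_small (2 ^+ n) n e0.
exists (sqsum (exh_part i N)); split; first by apply: sqsum_continuous; exact: exh_part_cpoly.
have Fz : Filter (nbhs z) := nbhs_filter z.
apply: filterS hn => w tw; apply: le_trans hN.
by have [_] := exhaustion_approx iK tw; apply.
Qed.

(** The partial sums increase to the exhaustion, so on the circle they lie below it. An
    approximation is needed only at the centre. *)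
Lemma exhaustion_psh i : (i < K)%N -> psh (Dom i) (fun z => (exhaustion i z)%:E).
Proof.
move=> iK; apply: psh_from_means; first exact: Dom_open.
  by move=> z; exact: exhaustion_continuous.
move=> z b hD e e0 M0.
have Dz : Dom i z.
  by have := hD 0; rewrite cscale0 addr0; apply; rewrite /closed_disc /= hnorm2E big_ord1 co0 cmod0 expr0n.
have [n hn] := Dom_tube Dz; have [cv hz] := exhaustion_approx iK (hn n (leqnn n)).
have [N nN hN] := half_pow_small (2 ^+ n) n e0.
have [M1 hM1] := sqsum_mean z b (@exh_part_cpoly i N iK).
exists (maxn M0 M1).+1, 0; split=> //.
- by apply: leqW; exact: leq_maxl.
- by rewrite lexx divr_ge0 // mulr_ge0 // pi_ge0.
- apply: le_trans (_ : (maxn M0 M1).+1%:R * sqsum (exh_part i N) z <= _).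
    rewrite ler_wpM2l //; have := le_trans (hz N nN) hN; rewrite ler_norml; lra.
  apply: le_trans (hM1 _ _ _) _ => //; first by apply: leqW; exact: leq_maxr.
  apply: ler_sum => j _; rewrite add0r; apply: exh_part_le => //.
  by apply: hD; exact: circle_in_closed_disc.
Qed.

Lemma hnorm2_le_exh_part i N z : hnorm2 z <= sqsum (exh_part i N) z.
Proof.
rewrite hnorm2_sqsum /sqsum /exh_part big_cat /= lerDl big_map.
by apply: sumr_ge0 => n _; exact: sqr_ge0.
Qed.

(** A bounded series of nonnegative terms converges, so its terms |h_n|^4 tend to 0. This keeps
    limits of sublevel sets inside D_i. *)
Lemma bounded_exh_Dom i z c : (forall N, sqsum (exh_part i N) z <= c) -> Dom i z.
Proof.
move=> hc; have cv : cvgn (fun N => sqsum (exh_part i N) z).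
  apply: nondecreasing_is_cvgn; first exact: exh_part_mono.
  by exists c => _ [N _ <-].
have c4 : (fun n => cmod (h n i z) ^+ 4) @ \oo --> (0 : R).
  have -> : (fun n => cmod (h n i z) ^+ 4) =
      fun n => sqsum (exh_part i n.+1) z - sqsum (exh_part i n) z.
    by apply/funext => n; rewrite exh_part_next addrC addKr.
  rewrite -(subrr (limn (fun N => sqsum (exh_part i N) z))); apply: cvgB => //.
  by rewrite (cvg_shiftS (fun N => sqsum (exh_part i N) z)).
apply/cvgr0Pnorm_lt => e e0; have [n0 _ hn0] := (cvgr_lt _ c4) (e ^+ 4) (exprn_gt0 4 e0).
exists n0 => // n n0n; rewrite /= ger0_norm ?cmod_ge0 //.
have := hn0 n n0n; rewrite /= ltr_pXn2r // ?nnegrE ?cmod_ge0 //; exact: ltW.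
Qed.

Lemma Dom_pseudoconvex i : (i < K)%N -> pseudoconvex (Dom i).
Proof.
move=> iK; split.
  by split; [exact: Dom_open|split; [exact: Dom_connected|exists center; exact: Dom_center]].
exists (exhaustion i); split; last 2 first.
- exact: exhaustion_psh.
- move=> c; set S := [set z | _].
  (* Partial sums are continuous on the whole space, so a bound for them passes to the closure,
     where the exhaustion itself is not yet known to be finite. *)
  have hS z N : closure S z -> sqsum (exh_part i N) z <= c.
    move=> cz; have cl : closed [set z | sqsum (exh_part i N) z <= c].
      apply: (@preimage_closed _ _ (sqsum (exh_part i N)) [set x | x <= c]); last exact: closed_le.
      by move=> w _; apply: sqsum_continuous; exact: exh_part_cpoly.
    apply: cl; apply: closureS cz => w [Dw uw] /=.
    by apply: le_trans (ltW uw); exact: exh_part_le.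
  split; last by move=> z /hS hz; apply: (@bounded_exh_Dom i z c) => N; exact: hz.
  apply: (@closed_bounded_compact _ _ _ (Num.sqrt c)); first exact: closed_closure.
  move=> z /(hS z 0%N) hz; apply: le_trans (norm_le_sqrt_hnorm2 z) _.
  by apply: ler_wsqrtr; apply: le_trans hz; exact: hnorm2_le_exh_part.
rewrite continuous_open_subspace; last exact: Dom_open.
by move=> z /set_mem; exact: exhaustion_continuous.
Qed.

(** * Transversality of the limit defining functions *)

Lemma cder_dual n i j z : (i < K.+1)%N -> (j < K)%N ->
  cder (h n i) z (dual_field (st n) j z) = if i == j then h n i z else 0.
Proof.
move=> iK jK; have [pp ps pK qK] := inv_auto (Hinv n).
set v := mk K (fun l => if l == j then co (phi (st n) z) l else 0).
have := cder_comp (phi (st n) z) v ps (h_cpoly n iK).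
rewrite pK -/(dual_field _ _ _) => <-.
have -> : (fun w => h n i (psi (st n) w)) = (fun w => co w i) by apply/funext => w; rewrite /h qK.
by rewrite cder_co co_mk.
Qed.

Lemma diff_sqr_cmod (f : pt -> C) (z : pt) : cpoly f ->
  is_diff z (fun z : pt => cmod (f z) ^+ 2 - 1)
    (fun v : pt => 2 * (complex.Re (f z) * complex.Re (cder f z v) + complex.Im (f z) * complex.Im (cder f z v))).
Proof.
move=> pf; have [h1 h2] := cpoly_is_cder z pf.
have d1 := is_diffD (is_diffM h1 h1) (is_diffM h2 h2).
have d2 := is_diffD d1 (is_diff_cst (-1 : R) z).
apply: (is_diff_ext d2) => x; first by rewrite sqr_cmod !expr2 !fctE.
have E (p q s t : R) : p * q + p * q + (s * t + s * t) + 0 = 2 * (p * q + s * t) by ring.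
exact: E.
Qed.

(** The Leibniz rule for defn * wt = |h|^2 - 1 along the dual field. *)
Lemma defn_dual n i j z : (i < K)%N -> (j < K)%N ->
  wt (st n) i z * 'd (defn (st n) i) z (dual_field (st n) j z) =
  (if i == j then 2 * cmod (h n i z) ^+ 2 else 0)
    - defn (st n) i z * 'd (wt (st n) i) z (dual_field (st n) j z).
Proof.
move=> iK jK; set v := dual_field _ _ _.
have iK1 : (i < K.+1)%N by exact: ltnW.
have sw := (inv_wt (Hinv n) iK).1.
have dw : is_diff z (wt (st n) i) ('d (wt (st n) i) z).
  by apply: DiffDef => //; exact: sm_differentiable.
have dd' : is_diff z (defn (st n) i) ('d (defn (st n) i) z).
  by apply: DiffDef => //; apply: sm_differentiable; exact: (sm_defn_st).
have [_ e1] := diff_sqr_cmod z (h_cpoly n iK1).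
have [_ e2] := is_diffM dd' dw.
have E : (fun z => cmod (h n i z) ^+ 2 - 1) = defn (st n) i * wt (st n) i.
  apply/funext => x; rewrite /GRing.mul /= /defn divfK //.
  by apply/eqP; have := wt_ge1 n x iK; lra.
rewrite E e2 in e1.
have e3 : defn (st n) i z * 'd (wt (st n) i) z v + wt (st n) i z * 'd (defn (st n) i) z v =
    2 * (complex.Re (h n i z) * complex.Re (cder (h n i) z v) +
         complex.Im (h n i z) * complex.Im (cder (h n i) z v)).
  exact: (congr1 (fun f : pt -> R => f v) e1).
rewrite cder_dual // in e3.
have -> : (if i == j then 2 * cmod (h n i z) ^+ 2 else 0) =
  2 * (complex.Re (h n i z) * complex.Re (if i == j then h n i z else 0) +
       complex.Im (h n i z) * complex.Im (if i == j then h n i z else 0)).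
  by case: eqP => _; rewrite ?sqr_cmod ?(mulr0, addr0) // !expr2.
rewrite -e3; move: (_ * 'd (defn _ _) _ _) (_ * 'd (wt _ _) _ _) => p q; ring.
Qed.

(** Here x2 is |h|^2 and f the defining function of stage n at a zero of the limit, so f is within
    the tail 2e of 0. Then |h|^2 >= 7/8, and 2 |h|^2 yields the constant 7/4. *)
Lemma dual_estimate (r D W W' f e M x2 : R) : 0 < e -> 1 <= M -> 4 * e * M <= 1 / 4 ->
  1 <= W -> W <= M -> `|W'| <= M -> `|f| <= 2 * e -> `|r - D| <= 2 * e * M -> x2 - 1 = f * W ->
  (W * D = 2 * x2 - f * W' -> 7 / 4 / M - 4 * e * M <= r) /\ (W * D = - (f * W') -> `|r| <= 4 * e * M).
Proof.
move=> e0 M1 eM w0 w1 dw1 tl dt fW2.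
have fW : `|f * W'| <= 2 * e * M by rewrite normrM; apply: ler_pM.
have fW3 : `|f * W| <= 2 * e * M by rewrite normrM; apply: ler_pM => //; rewrite ger0_norm //; lra.
have W1 : 0 < W by lra.
split=> hW.
  have x78 : 7 / 8 <= x2 by move: fW3; rewrite ler_norml -fW2; lra.
  have DW : 7 / 4 / M <= D + 2 * e * M.
    have : 7 / 4 / W <= D + 2 * e * M.
      rewrite ler_pdivrMr //; move: fW; rewrite ler_norml => fW.
      have : 2 * e * M <= 2 * e * M * W by rewrite ler_peMr // mulr_ge0 //; lra.
      lra.
    apply: le_trans; rewrite ler_wpM2l ?lef_pV2 ?posrE //; lra.
  move: dt; rewrite ler_norml; lra.
have DW : `|D| <= 2 * e * M.
  rewrite -[leLHS]mul1r; apply: le_trans (_ : W * `|D| <= _); first by rewrite ler_wpM2r.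
  by rewrite -[W](gtr0_norm W1) -normrM hW normrN.
have -> : r = (r - D) + D by ring.
apply: le_trans (ler_normD _ _) _; lra.
Qed.

Lemma rho_dual n i j z : (i < K)%N -> (j < K)%N -> `|z| <= rad (st n) -> rho i z = 0 ->
  if i == j
  then 7 / 4 / ubd (st n) - 4 * eps (st n) * ubd (st n) <= 'd (rho i) z (dual_field (st n) j z)
  else `|'d (rho i) z (dual_field (st n) j z)| <= 4 * eps (st n) * ubd (st n).
Proof.
move=> iK jK zr r0; set r := 'd _ _ _.
have [w1 v1 dw1] := inv_bound (Hinv n) zr iK jK.
have [e0 M1 eM _] := eps_small n.
have w0 := wt_ge1 n z iK.
have [_ tl] := defn_tail iK zr.
have dt := diff_tail (dual_field (st n) j z) iK zr.
rewrite r0 sub0r normrN in tl.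
have hD := defn_dual n z iK jK.
have dt' : `|'d (rho i) z (dual_field (st n) j z) - 'd (defn (st n) i) z (dual_field (st n) j z)|
    <= 2 * eps (st n) * ubd (st n).
  by apply: le_trans dt _; rewrite ler_wpM2l // mulr_ge0 // ltW.
have fW2 : cmod (h n i z) ^+ 2 - 1 = defn (st n) i z * wt (st n) i z.
  by rewrite /defn divfK // gt_eqF // (lt_le_trans ltr01).
have [g1 g2] := dual_estimate e0 M1 eM w0 w1 dw1 tl dt' fW2.
by move: hD; rewrite /r; case: (i == j); [exact: g1|rewrite sub0r; exact: g2].
Qed.

Lemma finset_argmax (I : finType) (S : {set I}) (f : I -> R) i0 : i0 \in S ->
  exists2 j, j \in S & forall i, i \in S -> f i <= f j.
Proof.
by move=> i0S; case: (@arg_maxP _ R I i0 (fun i => i \in S) f i0S) => j jS hj; exists j.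
Qed.

(** After multiplication by M the hypotheses give (3/2) c <= c r M <= 4 k e M^2 c <= c / 2. *)
Lemma independence_estimate (c k e M r : R) : 0 <= c -> 2 <= k -> 0 < e -> 1 <= M ->
  e * (8 * k * M ^+ 2) <= 1 -> 7 / 4 / M - 4 * e * M <= r -> c * r <= k * (c * (4 * e * M)) -> c <= 0.
Proof.
move=> c0 k2 e0 M1 eK hr rS.
have M0 : 0 < M by lra.
have hM : 7 / 4 / M * M = 7 / 4 by rewrite divfK // gt_eqF.
pose q := e * M ^+ 2.
have q0 : 0 <= q by rewrite mulr_ge0 ?exprn_ge0 //; lra.
have Kq : 8 * k * q <= 1 by rewrite /q mulrCA.
have q16 : 16 * q <= 1 by apply: le_trans Kq; rewrite ler_wpM2r //; lra.
have rM : 3 / 2 <= r * M.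
  have : (7 / 4 / M - 4 * e * M) * M <= r * M by rewrite ler_pM2r.
  rewrite mulrBl hM -!mulrA -expr2 -/q; lra.
have h1 : c * (r * M) <= c * (4 * k * q).
  have -> : c * (4 * k * q) = k * (c * (4 * e * M)) * M by rewrite /q; ring.
  by rewrite mulrA ler_pM2r.
have h2 : c * (3 / 2) <= c * (r * M) by rewrite ler_wpM2l.
have h3 : c * (4 * k * q) <= c * (1 / 2) by rewrite ler_wpM2l //; lra.
lra.
Qed.

(** A relation is evaluated on the dual field of an index with the largest coefficient; diagonal
    dominance forces that coefficient to vanish. *)
Lemma rho_independent (I : {set 'I_K}) z : (forall i : 'I_K, i \in I -> rho i z = 0) ->
  forall c : 'I_K -> R, (forall w, \sum_(i in I) c i * 'd (rho i) z w = 0) ->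
  forall i, i \in I -> c i = 0.
Proof.
move=> hI c hc i0 i0I.
have [j jI hj] := finset_argmax (fun i => `|c i|) i0I.
suff cj : `|c j| <= 0.
  by apply/eqP; rewrite -normr_le0; apply: le_trans (hj _ i0I) cj.
have [n [_ zn]] := rad_large z 0; have zr := norm_le_rad zn.
have [e0 M1 eM eK] := eps_small n.
have := hc (dual_field (st n) j z); rewrite (bigD1 j) //=.
set S := \sum_(i in I | _) _ => hS.
have := rho_dual (ltn_ord j) (ltn_ord j) zr (hI j jI); rewrite eqxx /=.
set r := 'd _ _ _ in hS * => hr.
have SB : `|S| <= K%:R * (`|c j| * (4 * eps (st n) * ubd (st n))).
  apply: le_trans (ler_norm_sum _ _ _) _.
  apply: le_trans (_ : \sum_(i < K) (`|c j| * (4 * eps (st n) * ubd (st n))) <= _); last first.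
    by rewrite sumr_const card_ord -[leLHS]mulr_natl.
  rewrite big_mkcond /=; apply: ler_sum => i _.
  have b0 : 0 <= `|c j| * (4 * eps (st n) * ubd (st n)) by rewrite !mulr_ge0 //; lra.
  case: ifP => // /andP [iI ij]; rewrite normrM; apply: ler_pM => //; first exact: hj.
  have := rho_dual (ltn_ord i) (ltn_ord j) zr (hI i iI).
  by rewrite -[(i : nat) == j]/(i == j) (negbTE ij).
have rS : `|c j| * r <= `|S|.
  have -> : S = - (c j * r) by apply/eqP; rewrite -addr_eq0 addrC; apply/eqP.
  by rewrite normrN normrM ler_wpM2l // ler_norm.
have K2 : 2 <= K%:R :> R by rewrite ler_nat.
exact: independence_estimate (normr_ge0 _) K2 e0 M1 eK hr (le_trans rS SB).
Qed.

Lemma rho_neg_boundary i z : (i < K)%N -> boundary [set z | rho i z < 0] z -> rho i z = 0.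
Proof.
move=> iK [cz nz]; have [cr _] := rho_smooth iK [::].
have oD : open [set z | rho i z < 0].
  by rewrite (rho_neg iK); exact: Dom_open.
apply/eqP; rewrite eq_le; apply/andP; split; last first.
  by rewrite leNgt; apply/negP => rz; apply: nz; move: oD; rewrite openE; apply.
have cl : closed [set z | rho i z <= 0].
  by apply: (@preimage_closed _ _ (rho i) [set x | x <= 0]); [move=> w _; exact: cr|exact: closed_le].
by apply: cl; apply: closureS cz => w /ltW.
Qed.

Definition basin_dom : set pt := [set z | forall i, (i < K)%N -> Dom i z].

Lemma basin_dom_piecewise : domain basin_dom -> piecewise_smooth basin_dom.
Proof.
move=> dB; split=> //; exists K, (fun i : 'I_K => rho i); split=> //.
- apply/seteqP; split=> [z Bz i _|z Bz i iK].
    by rewrite (rho_neg (ltn_ord i)); exact: Bz.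
  by rewrite -(rho_neg iK); exact: (Bz (Ordinal iK) I).
- move=> i; split; first exact: (rho_smooth).
  split; first by rewrite (rho_neg) //; exact: Dom_pseudoconvex.
  (* A nonzero differential is the independence of the one-element family {i}. *)
  move=> z /(rho_neg_boundary (ltn_ord i)) rz; apply: contrapT => /forallNP nv.
  have hS : forall j : 'I_K, j \in [set i]%SET -> rho j z = 0 by move=> j; rewrite inE => /eqP ->.
  have h0 := rho_independent hS (c := fun=> 1).
  have /h0/(_ i) : forall w, \sum_(j in [set i]%SET) 1 * 'd (rho j) z w = 0.
    by move=> w; rewrite big_set1 mul1r; apply/eqP/negP/negP; have /negP := nv w; rewrite negbK.
  by rewrite inE eqxx => /(_ isT) /eqP; rewrite oner_eq0.
- by move=> I z _ hI c hc i; apply: rho_independent hI c hc i.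
Qed.

(** * The basin as an increasing union of balls *)

Definition ball_dom n : set pt := [set z | hnorm2 (phi (st n) z) < 1 / 4].

(** By (s/2 + t/4)^2 <= s^2/2 + t^2/8, each x_i^2 occurs at most once with factor 1/2 and once with
    factor 1/8. The estimate serves both for the maps and for their differentials. *)
Lemma contraction_sum (x y : nat -> R) : (forall i, 0 <= x i) -> (forall i, 0 <= y i) ->
  (forall i, (i < K)%N -> y i <= 1 / 2 * x i + 1 / 4 * x i.+1) -> y K <= 1 / 4 * x 0 ->
  \sum_(i < K.+1) y i ^+ 2 <= 5 / 8 * \sum_(i < K.+1) x i ^+ 2.
Proof.
move=> x0 y0 hy hK.
have sq i : (i < K)%N -> y i ^+ 2 <= 1 / 2 * x i ^+ 2 + 1 / 8 * x i.+1 ^+ 2.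
  move=> iK; apply: le_trans (_ : (1 / 2 * x i + 1 / 4 * x i.+1) ^+ 2 <= _).
    by rewrite ler_sqr ?nnegrE ?hy // addr_ge0 // mulr_ge0 //.
  have := sqr_ge0 (1 / 2 * x i - 1 / 4 * x i.+1); move: (x i) (x i.+1) => s t; rewrite !expr2; lra.
have sqK : y K ^+ 2 <= 1 / 8 * x 0 ^+ 2.
  apply: le_trans (_ : (1 / 4 * x 0) ^+ 2 <= _).
    by rewrite ler_sqr ?nnegrE ?hK // mulr_ge0.
  by have := sqr_ge0 (x 0%N); move: (x 0%N) => s; rewrite !expr2; lra.
have s1 : \sum_(i < K) y i ^+ 2 <= 1 / 2 * \sum_(i < K) x i ^+ 2 + 1 / 8 * \sum_(i < K) x i.+1 ^+ 2.
  by rewrite !mulr_sumr -big_split; apply: ler_sum => i _; exact: sq.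
rewrite big_ord_recr /=.
have e1 : \sum_(i < K.+1) x i ^+ 2 = \sum_(i < K) x i ^+ 2 + x K ^+ 2 by rewrite big_ord_recr.
have e2 : \sum_(i < K.+1) x i ^+ 2 = x 0 ^+ 2 + \sum_(i < K) x i.+1 ^+ 2 by rewrite big_ord_recl.
have := sqr_ge0 (x K); move: e1 e2 s1 sqK.
move: (\sum_(i < K.+1) _) (\sum_(i < K) x i ^+ 2) (\sum_(i < K) x i.+1 ^+ 2) => A B D.
move: (\sum_(i < K) _) (y K ^+ 2) (x K ^+ 2) (x 0%N ^+ 2) => E F G H; lra.
Qed.

Lemma ball_co n z j : ball_dom n z -> (j < K.+1)%N -> cmod (h n j z) <= 1 / 2.
Proof.
move=> bz jK; have := cmod_le_hnorm2 (phi (st n) z) jK; rewrite /ball_dom /= in bz.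
rewrite -/(h n j z) => hz; have : cmod (h n j z) ^+ 2 <= (1 / 2) ^+ 2.
  apply: le_trans hz _; apply: le_trans (ltW bz) _; rewrite expr2; lra.
by rewrite ler_sqr // nnegrE ?cmod_ge0.
Qed.

Lemma ball_step n z : ball_dom n z -> hnorm2 (phi (st n.+1) z) <= 5 / 8 * hnorm2 (phi (st n) z).
Proof.
move=> bz; rewrite !hnorm2E; have [a0 a4] : 0 < a n /\ a n <= 1 / 4 by split; [exact: a_gt0 n|exact: a_le n].
apply: (@contraction_sum (fun j => cmod (h n j z)) (fun j => cmod (h n.+1 j z))) => [i|i|i iK|]; try exact: cmod_ge0.
  rewrite (h_step) //; apply: le_trans (cmodD _ _) _; apply: lerD.
    rewrite cmodX; have [_ d1] := dd_gt n.
    have h2 := ball_co bz (ltnW iK : (i < K.+1)%N).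
    apply: le_trans (_ : cmod (h n i z) ^+ 2 <= _).
      by apply: ler_wiXn2l => //; [exact: cmod_ge0|lra].
    by rewrite expr2 ler_wpM2r // cmod_ge0.
  by rewrite cmodM cmod_real gtr0_norm // ler_wpM2r // cmod_ge0.
by rewrite (h_step_last) cmodM cmod_real gtr0_norm // ler_wpM2r // cmod_ge0.
Qed.

Lemma ball_decay n k z : ball_dom n z -> hnorm2 (phi (st (n + k)) z) <= 1 / 4 * (5 / 8) ^+ k.
Proof.
move=> bz; elim: k => [|k IH]; first by rewrite addn0 expr0 mulr1; exact: ltW.
have p1 : (5 / 8 : R) ^+ k <= 1 by apply: exprn_ile1; lra.
have bk : ball_dom (n + k) z.
  case: k IH p1 => [|k] IH p1; first by rewrite addn0.
  apply: le_lt_trans IH _; rewrite exprS; have : (5 / 8 : R) ^+ k <= 1 by apply: exprn_ile1; lra.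
  lra.
rewrite addnS; apply: le_trans (ball_step bk) _; rewrite exprS; lra.
Qed.

Lemma ball_mono n k z : (n <= k)%N -> ball_dom n z -> ball_dom k z.
Proof.
move=> /subnKC <- bz; set j := (k - n)%N; case: j => [|j]; first by rewrite addn0.
apply: le_lt_trans (ball_decay _ bz) _; rewrite exprS.
have : (5 / 8 : R) ^+ j <= 1 by apply: exprn_ile1; lra.
lra.
Qed.

Lemma cvg0_root (x : nat -> R) p : (forall n, 0 <= x n) ->
  (fun n => x n ^+ p.+1) @ \oo --> (0 : R) -> x @ \oo --> (0 : R).
Proof.
move=> x0 hx; apply/cvgr0Pnorm_lt => e e0.
have [n0 _ hn0] := (cvgr_lt _ hx) (e ^+ p.+1) (exprn_gt0 _ e0).
exists n0 => // n n0n; rewrite /= ger0_norm //.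
by have := hn0 n n0n; rewrite /= ltr_pXn2r // nnegrE // ltW.
Qed.

(** The last component follows the first one, since h_{n+1,K} = a_n h_{n,0}; this is why K domains
    suffice to cut out the basin. *)
Lemma hnorm2_cvg0 z : basin_dom z -> (fun n => hnorm2 (phi (st n) z)) @ \oo --> (0 : R).
Proof.
move=> bz; suff s l : (l <= K.+1)%N -> (fun n => \sum_(j < l) cmod (h n j z) ^+ 2) @ \oo --> (0 : R).
  by under eq_fun do rewrite hnorm2E; exact: (s K.+1).
have Kc : (fun n => cmod (h n K z)) @ \oo --> (0 : R).
  rewrite -(cvg_shiftS (fun n => cmod (h n K z))).
  apply: (@squeeze_cvgr _ _ _ _ (fun=> 0) (fun n => cmod (h n 0 z))); last first.
  - exact: (bz 0%N).
  - exact: cvg_cst.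
  apply: nearW => n; apply/andP; split; first exact: cmod_ge0.
  have hK : cmod (h n.+1 K z) = a n * cmod (h n 0 z).
    by rewrite (h_step_last) cmodM cmod_real gtr0_norm // (a_gt0).
  change (cmod (h n.+1 K z) <= cmod (h n 0 z)); rewrite hK ler_piMl ?cmod_ge0 //.
  by have := a_le n; lra.
elim: l => [_|l IH lK].
  by under eq_fun do rewrite big_ord0; exact: cvg_cst.
have hl : (fun n => cmod (h n l z)) @ \oo --> (0 : R).
  by move: lK; rewrite leq_eqVlt eqSS => /predU1P[->|] //; exact: bz.
under eq_fun do rewrite big_ord_recr /= expr2.
have := cvgD (IH (ltnW lK)) (cvgM hl hl); rewrite mulr0 addr0; exact.
Qed.

Lemma basin_domE : basin_dom = \bigcup_n ball_dom n.
Proof.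
apply/seteqP; split=> [z bz|z [n _ bz] i iK].
  have [n0 _ hn0] := (cvgr_lt _ (hnorm2_cvg0 bz)) (1 / 4) ltac:(lra).
  by exists n0 => //; exact: (hn0 n0 (leqnn n0)).
apply: (@cvg0_root (fun n => cmod (h n i z)) 1) => [k|]; first exact: cmod_ge0.
apply: (@geometric_cvg0 _ _ (1 / 4) (5 / 8) n) => [|k|k]; [lra|exact: sqr_ge0|].
by apply: le_trans (ball_decay _ bz); apply: cmod_le_hnorm2; exact: ltnW.
Qed.

Lemma ball_open n : open (ball_dom n).
Proof.
apply: (@open_comp _ _ (fun z => hnorm2 (phi (st n) z)) [set x | x < 1 / 4]); last exact: open_lt.
move=> z _; apply: (@continuous_comp _ _ _ (phi (st n)) (@hnorm2 R K.+1)).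
  by apply: polymap_continuous; exact: phi_polymap n.
exact: hnorm2_continuous.
Qed.

Lemma hnorm2_cs (c : C) (w : pt) : hnorm2 (cs c w) = cmod c ^+ 2 * hnorm2 w.
Proof. by rewrite !hnorm2E mulr_sumr; apply: eq_bigr => j _; rewrite co_cs // cmodM exprMn. Qed.

Lemma ball_biholomorphic n : biholomorphic (ball_dom n) (@unit_ball R K.+1).
Proof.
have [pp ps pK qK] := inv_auto (Hinv n).
have cs_poly (c : C) : polymap (@cs R K c).
  by apply: polymap_mk => j jK; apply: cpolyM; [exact: cpoly_cst|exact: cpoly_co].
have cs_inv (c d : C) (w : pt) : c * d = 1 -> cs c (cs d w) = w.
  by move=> cd; apply: co_inj => j jK; rewrite !co_cs // mulrA cd mul1r.
have c2 : 2%:C%C * (2^-1)%:C%C = 1 :> C by rewrite -rmorphM divff.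
have oB : open (@unit_ball R K.+1).
  apply: (@open_comp _ _ (@hnorm2 R K.+1) [set x | x < 1]); last exact: open_lt.
  by move=> z _; exact: hnorm2_continuous.
exists (fun z => cs 2%:C%C (phi (st n) z)), (fun w => psi (st n) (cs (2^-1)%:C%C w)); split.
- by apply: polymap_holomorphic; [exact: (polymap_comp pp (cs_poly _))|exact: ball_open].
- by apply: polymap_holomorphic; [exact: (polymap_comp (cs_poly _) ps)|].
- split=> [z|w]; rewrite /ball_dom /unit_ball /= ?qK hnorm2_cs cmod_real ger0_norm ?invr_ge0 // expr2; lra.
- by move=> z _; rewrite cs_inv ?pK // mulrC.
- by move=> w _; rewrite qK cs_inv.
Qed.

Lemma ball_center n : ball_dom n center.
Proof. by rewrite /ball_dom /= phi_center // hnorm2E big1 ?divr_gt0 // => j _; rewrite co0 cmod0 expr0n. Qed.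

Lemma ball_connected n : connected (ball_dom n).
Proof.
have [pp ps pK qK] := inv_auto (Hinv n).
have -> : ball_dom n = psi (st n) @` [set w | hnorm2 w < 1 / 4].
  apply/seteqP; split => z; first by exists (phi (st n) z).
  by move=> [w hw <-]; rewrite /ball_dom /= qK.
apply: connected_continuous_connected; last first.
  by apply: continuous_subspaceT; exact: polymap_continuous.
apply: starshaped_connected => [|t w /andP [t0 t1] /= hw].
  by rewrite /= hnorm2E big1 ?divr_gt0 // => j _; rewrite co0 cmod0 expr0n.
apply: le_lt_trans hw; have -> : t *: w = cs t%:C%C w.
  apply: co_inj => j jK; rewrite co_cs //; apply: complex_ext; by rewrite ?cReM ?cImM /co /= !mxE !mul0r ?subr0 ?addr0.
rewrite hnorm2_cs cmod_real ger0_norm // ler_piMl ?hnorm2_ge0 // exprn_ile1 //.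
Qed.

Lemma basin_dom_domain : domain basin_dom.
Proof.
rewrite basin_domE; split; first by apply: bigcup_open => n _; exact: ball_open.
split; last by exists center, 0%N => //; exact: ball_center.
apply: bigcup_connected; last by move=> n _; exact: ball_connected.
by exists center => n _; exact: ball_center.
Qed.

(** * Vanishing of the Kobayashi metric *)

Definition speed n (z v : pt) : R := \sum_(j < K.+1) cmod (cder (h n j) z v) ^+ 2.

Lemma pow_quarter n : n.+2%:R * (1 / 4) ^+ n.+1 <= 1 / 2 :> R.
Proof.
elim: n => [|n IH]; first lra.
have p0 : 0 < (1 / 4 : R) ^+ n.+1 by apply: exprn_gt0; lra.
rewrite exprS -natr1; have : 1 <= n.+2%:R :> R by rewrite ler1n.
move: (n.+2%:R : R) ((1 / 4 : R) ^+ n.+1) p0 IH => s t t0 IH s1; nra.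
Qed.

Lemma cder_step n i z v : (i < K)%N -> cder (h n.+1 i) z v =
  (dd n)%:R * h n i z ^+ (dd n).-1 * cder (h n i) z v + (a n)%:C%C * cder (h n i.+1) z v.
Proof.
move=> iK; have p1 := h_cpoly n (ltnW iK : (i < K.+1)%N); have p2 := h_cpoly n (iK : (i.+1 < K.+1)%N).
have -> : h n.+1 i = fun z => h n i z ^+ dd n + (a n)%:C%C * h n i.+1 z.
  by apply/funext => x; rewrite (h_step).
rewrite cderD; [|exact: cpolyX|by apply: cpolyM; [exact: cpoly_cst|]].
by rewrite cderX // cderMl.
Qed.

Lemma cder_step_last n z v : cder (h n.+1 K) z v = (a n)%:C%C * cder (h n 0) z v.
Proof.
have -> : h n.+1 K = fun z => (a n)%:C%C * h n 0 z.
  by apply/funext => x; rewrite (h_step_last).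
by rewrite cderMl //; exact: (h_cpoly).
Qed.

(** Where |h_i| <= 1/4, the derivative d |h_i|^(d-1) of the power is at most 1/2 for every d >= 2,
    so differentials contract as the maps do. *)
Lemma speed_step n z v : hnorm2 (phi (st n) z) <= 1 / 16 -> speed n.+1 z v <= 5 / 8 * speed n z v.
Proof.
move=> hz; have [a0 a4] : 0 < a n /\ a n <= 1 / 4 by split; [exact: a_gt0 n|exact: a_le n].
apply: (@contraction_sum (fun j => cmod (cder (h n j) z v)) (fun j => cmod (cder (h n.+1 j) z v))) => [i|i|i iK|]; try exact: cmod_ge0.
  rewrite cder_step //; apply: le_trans (cmodD _ _) _; apply: lerD.
    rewrite !cmodM ler_wpM2r ?cmod_ge0 // cmodX; have [_] := dd_gt n.
    have -> : cmod ((dd n)%:R : C) = (dd n)%:R by rewrite -[(dd n)%:R]/((dd n)%:R : C) -(rmorph_nat (real_complex R)) cmod_real ger0_norm.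
    case: (dd n) => [//|[//|d]] _; apply: le_trans (pow_quarter d).
    rewrite ler_wpM2l //= lerXn2r ?nnegrE ?cmod_ge0 ?divr_ge0 //.
    rewrite -ler_sqr ?nnegrE ?cmod_ge0 ?divr_ge0 //.
    apply: le_trans (cmod_le_hnorm2 _ (ltnW iK : (i < K.+1)%N)) _.
    by apply: le_trans hz _; rewrite expr2; lra.
  by rewrite cmodM cmod_real gtr0_norm // ler_wpM2r // cmod_ge0.
by rewrite cder_step_last cmodM cmod_real gtr0_norm // ler_wpM2r // cmod_ge0.
Qed.

(** Six contractions bring the squared norm from 1/4 below 1/32, where both [speed_step] and
    [kobayashi_disc] apply. *)
Lemma pow_five_eighths k : 1 / 4 * (5 / 8) ^+ (6 + k) <= 1 / 32 :> R.
Proof.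
have p1 : (5 / 8 : R) ^+ k <= 1 by apply: exprn_ile1; lra.
have p6 : (5 / 8 : R) ^+ 6 <= 1 / 8 by rewrite !exprS expr0; lra.
have p0 : 0 <= (5 / 8 : R) ^+ 6 by apply: exprn_ge0; lra.
rewrite exprD; move: (_ ^+ 6) (_ ^+ k) p1 p6 p0 => s t; nra.
Qed.

Lemma speed_decay n k z v : ball_dom n z -> speed (n + 6 + k) z v <= speed (n + 6) z v * (5 / 8) ^+ k.
Proof.
move=> bz; elim: k => [|k IH]; first by rewrite addn0 expr0 mulr1.
rewrite addnS; apply: le_trans (speed_step _ _) _.
  have hb : hnorm2 (phi (st (n + 6 + k)) z) <= 1 / 4 * (5 / 8) ^+ (6 + k).
    by rewrite -addnA; exact: (ball_decay).
  apply: le_trans hb (le_trans (pow_five_eighths k) _).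
  by rewrite ler_pM2l // lef_pV2 ?posrE // ler_nat.
by rewrite exprS mulrCA ler_pM2l.
Qed.

Lemma speed_cvg0 n z v (e : R) : ball_dom n z -> 0 < e -> exists N, (n + 6 <= N)%N /\ speed N z v <= e.
Proof.
move=> bz e0; have cv : (fun k => speed (n + 6) z v * (5 / 8) ^+ k) @ \oo --> speed (n + 6) z v * (0 : R).
  by apply: cvgM; [exact: cvg_cst|apply: cvg_expr; rewrite ger0_norm; lra].
rewrite mulr0 in cv; have [k _ hk] := (cvgr_lt _ cv) e e0.
exists (n + 6 + k)%N; split; first exact: leq_addr.
by apply: le_trans (speed_decay _ _ bz) _; apply/ltW/hk => /=.
Qed.

Lemma hnorm2D_le (x y : pt) : hnorm2 (x + y) <= 2 * (hnorm2 x + hnorm2 y).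
Proof.
rewrite !hnorm2E -big_split mulr_sumr; apply: ler_sum => j _; rewrite coD.
apply: le_trans (_ : (cmod (co x j) + cmod (co y j)) ^+ 2 <= _).
  by rewrite ler_sqr ?nnegrE ?addr_ge0 ?cmod_ge0 // cmodD.
have := sqr_ge0 (cmod (co x j) - cmod (co y j)); move: (cmod _) (cmod _) => s t /=; rewrite !expr2; lra.
Qed.

Lemma co_cone : co (cone R) 0 = 1 :> C.
Proof. by apply: complex_ext; rewrite /co /= !mxE. Qed.

(** Take the affine disc through phi_n(z) with velocity d phi_n(v) / e and pull it back by psi_n.
    Its squared norm stays below 2 (1/32 + 1/16) < 1/4, so it lies in [ball_dom n]. *)
Lemma kobayashi_disc n z v (e : R) : 0 < e -> hnorm2 (phi (st n) z) <= 1 / 32 ->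
  speed n z v <= e ^+ 2 / 16 -> exists (f : Cpt R 1 -> pt) (b : Cpt R 1),
    [/\ holomorphic (@unit_disc R) f, (forall l, unit_disc l -> basin_dom (f l)),
        f 0 = z, Defs.cscale b ('d f 0 (cone R)) = v & e = cabs b].
Proof.
move=> e0 hz hv; have [pp ps pK qK] := inv_auto (Hinv n).
pose w := 'd (phi (st n)) z v.
have cw j : (j < K.+1)%N -> co w j = cder (h n j) z v by move=> jK; rewrite co_diff.
have nw : hnorm2 w <= e ^+ 2 / 16.
  by rewrite hnorm2E; under eq_bigr do rewrite cw //.
pose T (l : Cpt R 1) : pt := phi (st n) z + Defs.cscale l (cs (e^-1)%:C%C w).
have coT l j : (j < K.+1)%N -> co (T l) j = co (phi (st n) z) j + co l 0 * ((e^-1)%:C%C * co w j).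
  by move=> jK; rewrite /T coD cscaleE !co_cs.
have pl : cpoly (fun l : Cpt R 1 => co l 0) by exact: cpoly_co.
have pT : polymap T.
  move=> j jK; have -> : (fun l => co (T l) j) = fun l => co (phi (st n) z) j + co l 0 * ((e^-1)%:C%C * co w j).
    by apply/funext => l; rewrite coT.
  by apply: cpolyD; [exact: cpoly_cst|apply: cpolyM => //; exact: cpoly_cst].
have oD : open (@unit_disc R).
  apply: (@open_comp _ _ (@hnorm2 R 1) [set x | x < 1]); last exact: open_lt.
  by move=> x _; exact: hnorm2_continuous.
have T0 : T 0 = phi (st n) z by rewrite /T cscale0 addr0.
exists (fun l => psi (st n) (T l)), (mk 0 (fun=> e%:C%C)); split.
- by apply: polymap_holomorphic => //; exact: (polymap_comp pT ps).
- move=> l dl; rewrite (basin_domE); exists n => //; rewrite /ball_dom /= qK.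
  apply: le_lt_trans (hnorm2D_le _ _) _; rewrite cscaleE !hnorm2_cs.
  have l1 : cmod (co l 0) ^+ 2 < 1 by move: dl; rewrite /unit_disc /unit_ball /= hnorm2E big_ord1.
  have w1 : cmod (e^-1)%:C%C ^+ 2 * hnorm2 w <= 1 / 16.
    rewrite cmod_real gtr0_norm ?invr_gt0 // exprVn mulrC ler_pdivrMr ?exprn_gt0 //; lra.
  have w0 : 0 <= cmod (e^-1)%:C%C ^+ 2 * hnorm2 w by rewrite mulr_ge0 ?sqr_ge0 ?hnorm2_ge0.
  have : cmod (co l 0) ^+ 2 * (cmod (e^-1)%:C%C ^+ 2 * hnorm2 w) <= 1 / 16.
    by apply: le_trans w1; rewrite ler_piMl // ltW.
  lra.
- by rewrite T0 pK.
- have dT : 'd T 0 (cone R) = cs (e^-1)%:C%C w.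
    apply: co_inj => j jK; rewrite co_diff // co_cs //.
    have -> : (fun l => co (T l) j) = fun l => co (phi (st n) z) j + ((e^-1)%:C%C * co w j) * co l 0.
      by apply/funext => l; rewrite coT // [co l 0 * _]mulrC.
    rewrite cderD ?cder_cst ?add0r; [|exact: cpoly_cst|by apply: cpolyM => //; exact: cpoly_cst].
    by rewrite cderMl // cder_co co_cone mulr1.
  apply: co_inj => j jK; rewrite cscaleE co_cs // co_mk //.
  rewrite co_diff //; last exact: (polymap_comp pT ps).
  rewrite (cder_comp (f := fun w => co (psi (st n) w) j)) // ?T0; last exact: ps.
  rewrite dT cder_cs; last exact: ps.
  rewrite mulrA -rmorphM divff ?gt_eqF // mul1r.
  rewrite /w -(cder_comp (f := fun w => co (psi (st n) w) j)) //; last exact: ps.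
  have -> : (fun z => co (psi (st n) (phi (st n) z)) j) = (fun z => co z j) by apply/funext => x; rewrite pK.
  by rewrite cder_co.
- rewrite /cabs hnorm2E big_ord1 co_mk // cmod_real sqrtr_sqr normr_id gtr0_norm //.
Qed.

Lemma kobayashi_zero z v : basin_dom z -> kobayashi basin_dom z v = 0.
Proof.
rewrite {1}(basin_domE) => -[n _ bz]; rewrite /kobayashi; set S := [set r | _].
have inS (e : R) : 0 < e -> S e.
  move=> e0; have [N [nN hN]] := speed_cvg0 v bz (e := e ^+ 2 / 16) ltac:(by rewrite divr_gt0 ?exprn_gt0).
  have hz : hnorm2 (phi (st N) z) <= 1 / 32.
    rewrite -(subnKC nN) -addnA.
    exact: le_trans (ball_decay _ bz) (pow_five_eighths _).
  by have [f [b h]] := kobayashi_disc e0 hz hN; exists f, b.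
have lb : lbound S 0 by move=> _ [f [b [_ _ _ _ ->]]]; exact: sqrtr_ge0.
have hS : has_inf S by split; [exists 1; exact: inS|exists 0].
apply/eqP; rewrite eq_le; apply/andP; split; last by apply: lb_le_inf => //; exists 1; exact: inS.
by apply/ler_addgt0Pl => e e0; rewrite addr0; apply: ge_inf; [exists 0|exact: inS].
Qed.

(** * The bounded plurisubharmonic function *)

Definition degree n : nat := \prod_(j < n) dd j.

Hypothesis capE : forall n, cap n = 16^-1 ^+ degree n.+1 / 2.

(** The floor keeps the logarithm finite and is compatible with the step: its d_n-th power is the
    next floor, so the normalised logarithm of the floor is always -ln 16. *)
Definition pot n (z : pt) : R := ln (Num.max (cmod (h n 0 z)) (16^-1 ^+ degree n)) / (degree n)%:R.
Definition potential (z : pt) : R := limn (fun n => pot n z).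

Lemma degreeS n : degree n.+1 = (degree n * dd n)%N.
Proof. by rewrite /degree big_ord_recr. Qed.

Lemma degree_ge n : (2 ^ n <= degree n)%N.
Proof.
elim: n => [|n IH]; first by rewrite /degree big_ord0.
rewrite degreeS expnSr; apply: leq_mul => //; by have [] := dd_gt n.
Qed.

Lemma degree_gt0 n : 0 < (degree n)%:R :> R.
Proof. by rewrite ltr0n; apply: leq_trans (degree_ge n); rewrite expn_gt0. Qed.

Lemma floor_gt0 n : 0 < 16^-1 ^+ n :> R. Proof. by rewrite exprn_gt0 // invr_gt0. Qed.

Lemma max_gt0 (x y : R) : 0 < y -> 0 < Num.max x y.
Proof. by move=> y0; rewrite lt_max y0 orbT. Qed.

(** Since F' = F^d, the d-th power of max(x, F) is max(x^d, F'). A perturbation by at most F'/2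
    changes this maximum by a factor of at most 2. *)
Lemma max_step (x y F F' : R) d : 0 <= x -> 0 <= y -> 0 < F -> F ^+ d = F' -> `|y - x ^+ d| <= F' / 2 ->
  (Num.max x F) ^+ d / 2 <= Num.max y F' /\ Num.max y F' <= 2 * (Num.max x F) ^+ d.
Proof.
move=> x0 y0 F0 E; rewrite ler_norml => /andP [h1 h2].
have Fd : 0 < F' by rewrite -E exprn_gt0.
have E' : (Num.max x F) ^+ d = Num.max (x ^+ d) F'.
  have [xF|Fx] := leP x F.
    by rewrite E; apply/esym/max_idPr; rewrite -E; apply: lerXn2r; rewrite ?nnegrE // ltW.
  by apply/esym/max_idPl; rewrite -E; apply: lerXn2r; rewrite ?nnegrE // ltW.
have xd : 0 <= x ^+ d by rewrite exprn_ge0.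
rewrite E'; move: (x ^+ d) xd h1 h2 => X X0 h1 h2.
have [XF|FX] := leP X F'; (split; [rewrite le_max; apply/orP|rewrite ge_max; apply/andP; split]); lra.
Qed.

(** The factor 2 of [max_step] changes the logarithm by at most ln 2 <= 1, and the normalisation
    divides by a degree of at least 2^(n+1). *)
Lemma pot_step n z : ball_dom n z -> `|pot n.+1 z - pot n z| <= 2^-1 ^+ n.+1.
Proof.
move=> bz; have D0 := degree_gt0 n; have D1 := degree_gt0 n.+1; have [_ d1] := dd_gt n.
have F0 := floor_gt0 (degree n).
have FE : (16^-1 ^+ degree n) ^+ dd n = 16^-1 ^+ degree n.+1 :> R by rewrite -exprM degreeS.
have close : `|cmod (h n.+1 0 z) - cmod (h n 0 z) ^+ dd n| <= 16^-1 ^+ degree n.+1 / 2.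
  rewrite -capE; apply: (le_trans _ (step_cap (Hstep n))).
  have hp : cmod (h n.+1 0 z - h n 0 z ^+ dd n) <= a n.
    rewrite (h_step) // addrC addKr cmodM cmod_real gtr0_norm ?(a_gt0) //.
    rewrite ler_piMr ?(ltW (a_gt0 n)) //.
    by apply: le_trans (ball_co bz (isT : (1 < K.+1)%N)) _; lra.
  rewrite -cmodX ler_norml lerBlDr lerNl opprB lerBlDr.
  have c1 := cmodD (h n.+1 0 z - h n 0 z ^+ dd n) (h n 0 z ^+ dd n); rewrite subrK in c1.
  have c2 := cmodB (h n.+1 0 z) (h n.+1 0 z - h n 0 z ^+ dd n).
  rewrite opprB addrC subrK in c2.
  by apply/andP; split; lra.
have [l1 l2] := max_step (cmod_ge0 _) (cmod_ge0 _) F0 FE close.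
rewrite /pot; set M := Num.max (cmod (h n 0 z)) _ in l1 l2 *; set M' := Num.max _ _ in l1 l2 *.
have M0 : 0 < M by exact: max_gt0.
have M'0 : 0 < M' by apply: max_gt0; exact: floor_gt0.
have Md : 0 < M ^+ dd n by rewrite exprn_gt0.
have k1 : ln M' <= ln 2 + (dd n)%:R * ln M.
  by rewrite mulr_natl -lnXn // -lnM ?posrE // ler_ln ?posrE ?mulr_gt0.
have k2 : (dd n)%:R * ln M <= ln 2 + ln M'.
  rewrite mulr_natl -lnXn // -lnM ?posrE // ler_ln ?posrE ?mulr_gt0 //; lra.
have ln2 : ln 2 <= 1 :> R by have := @le_ln1Dx R 1 ltac:(lra).
have -> : ln M' / (degree n.+1)%:R - ln M / (degree n)%:R =
    (ln M' - (dd n)%:R * ln M) / (degree n.+1)%:R.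
  have dn0 : (dd n)%:R != 0 :> R by rewrite pnatr_eq0 -lt0n ltnW.
  have E (x y D d : R) : D != 0 -> d != 0 -> x / (D * d) - y / D = (x - d * y) / (D * d).
    by move=> D_neq0 d0; field; rewrite d0 D_neq0.
  by rewrite degreeS natrM E // gt_eqF.
rewrite normrM [X in _ * X]gtr0_norm ?invr_gt0 // exprVn.
rewrite -[leRHS]mul1r; apply: ler_pM => //.
- by apply: le_trans ln2; rewrite ler_norml; lra.
- rewrite lef_pV2 ?posrE ?exprn_gt0 // -natrX ler_nat; exact: degree_ge.
Qed.

Lemma potential_approx n z : ball_dom n z ->
  (fun k => pot k z) @ \oo --> potential z /\
  forall k, (n <= k)%N -> `|potential z - pot k z| <= 2^-1 ^+ k.
Proof.
move=> bz; have [|cv hv] := @halving_cvg R (fun k => pot k z) 1 n ler01.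
  move=> k nk; rewrite mul1r; apply: pot_step; exact: (ball_mono) nk bz.
by split=> // k nk; rewrite -[leRHS]mul1r; exact: hv.
Qed.

Lemma pot_continuous n : continuous (pot n).
Proof.
move=> z; have F0 := floor_gt0 (degree n).
have c1 : {for z, continuous (fun z => cmod (h n 0 z))}.
  exact: (cpoly_cmod_continuous (h_cpoly n (isT : (0 < K.+1)%N))).
have c2 : {for z, continuous (fun z => Num.max (cmod (h n 0 z)) (16^-1 ^+ degree n))}.
  by apply: (continuous_max c1); exact: cvg_cst.
have c3 : {for z, continuous (fun z => ln (Num.max (cmod (h n 0 z)) (16^-1 ^+ degree n)))}.
  by apply: (continuous_comp c2); apply: continuous_ln; exact: max_gt0.
exact: (cvgM c3 (cvg_cst _)).
Qed.

Lemma potential_continuous z : basin_dom z -> {for z, continuous potential}.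
Proof.
rewrite (basin_domE) => -[n _ bz]; apply: lim_uniform_continuous_at => e e0.
have [N nN hN] := half_pow_small 1 n e0.
exists (pot N); split; first exact: pot_continuous.
have Fz : Filter (nbhs z) := nbhs_filter z.
have nb : nbhs z (ball_dom n) by apply: open_nbhs_nbhs; split=> //; exact: ball_open n.
apply: filterS nb => w bw; apply: le_trans hN; rewrite mul1r.
by have [_] := potential_approx bw; apply.
Qed.

Lemma closed_disc_compact : compact (@closed_disc R).
Proof.
apply: (@closed_bounded_compact R 0 _ 1).
  apply: (@preimage_closed _ _ (@hnorm2 R 1) [set x | x <= 1]); last exact: closed_le.
  by move=> x _; exact: hnorm2_continuous.
move=> z; rewrite /closed_disc /= => hz; apply: le_trans (norm_le_sqrt_hnorm2 z) _.
by rewrite -[leRHS]sqrtr1 ler_wsqrtr.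
Qed.

(** The [pot n] are not monotone, so their approximation has to be uniform on the circle;
    compactness of the disc puts it into a single ball. *)
Lemma disc_in_ball (z b : pt) : (forall l, closed_disc l -> basin_dom (z + Defs.cscale l b)) ->
  exists n, forall l, closed_disc l -> ball_dom n (z + Defs.cscale l b).
Proof.
move=> hD; have cD : continuous (fun l : Cpt R 1 => z + Defs.cscale l b).
  apply: polymap_continuous => j jK.
  have -> : (fun l => co (z + Defs.cscale l b) j) = fun l => co z j + co l 0 * co b j.
    by apply/funext => l; rewrite coD cscaleE co_cs.
  apply: cpolyD; [exact: cpoly_cst|apply: cpolyM; [exact: cpoly_co|exact: cpoly_cst]].
have /compact_near_coveringP/(_ _ (\oo : set_system nat) (fun n l => ball_dom n (z + Defs.cscale l b))) := closed_disc_compact.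
move=> /(_ _ _)[].
  move=> l dl; have := hD l dl; rewrite (basin_domE) => -[n _ bn].
  exists ((fun l => z + Defs.cscale l b) @^-1` ball_dom n, [set k | (n <= k)%N]) => /=.
    split; last by exists n.
    apply: cD; apply: open_nbhs_nbhs; split=> //; exact: ball_open n.
  by move=> [l' k] /= [h1 h2]; exact: (ball_mono) h2 h1.
by move=> n _ hn; exists n => l dl; exact: (hn n (leqnn n)).
Qed.

Lemma potential_psh : psh basin_dom (fun z => (potential z)%:E).
Proof.
have [oB _] := basin_dom_domain.
apply: psh_from_means => //; first exact: potential_continuous.
move=> z b hD e e0 M0; have [n hn] := disc_in_ball hD.
have e2 : 0 < e / 2 by rewrite divr_gt0.
have [N nN hN] := half_pow_small 1 n e2; rewrite mul1r in hN.
have [q hq] := cpoly_disc z b (h_cpoly N (isT : (0 < K.+1)%N)).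
have [t ht hm] := logmax_mean q (N := M0.+1) isT (floor_gt0 (degree N)).
exists M0.+1, t; split=> //.
have z0 : h N 0 z = q.[0] by rewrite -[z in LHS]addr0 -(cscale0 b) hq co0.
have bz : ball_dom n z.
  by have := hn 0; rewrite cscale0 addr0; apply; rewrite /closed_disc /= hnorm2E big_ord1 co0 cmod0 expr0n.
have pc s : pot N (circ z b s) - e / 2 <= potential (circ z b s).
  have [_ hp] := potential_approx (hn _ (circle_in_closed_disc s)).
  have := le_trans (hp N nN) hN; rewrite ler_norml /circ; lra.
apply: le_trans (_ : \sum_(j < M0.+1) (pot N (circ z b (t + 2 * pi * j%:R / M0.+1%:R)) - e / 2) <= _); last first.
  by apply: ler_sum => j _; exact: pc.
rewrite sumrB sumr_const card_ord -[X in _ <= _ - X]mulr_natl.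
have : M0.+1%:R * pot N z <= \sum_(j < M0.+1) pot N (circ z b (t + 2 * pi * j%:R / M0.+1%:R)).
  rewrite /pot -mulr_suml mulrA ler_pM2r ?invr_gt0 ?degree_gt0 // z0; apply: le_trans hm _.
  by apply: ler_sum => j _; rewrite /circ hq co_cexpi.
have : M0.+1%:R * (potential z - pot N z) <= M0.+1%:R * (e / 2).
  rewrite ler_wpM2l //; have [_ hp] := potential_approx bz.
  by have := le_trans (hp N nN) hN; rewrite ler_norml; lra.
have E (A B S M : R) : M * (A - B) <= M * (e / 2) -> M * B <= S -> M * (A - e) <= S - M * (e / 2) by lra.
exact: E.
Qed.

Lemma potential_le1 z : basin_dom z -> potential z <= 1.
Proof.
rewrite (basin_domE) => -[n _ bz]; have [_ hp] := potential_approx bz.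
have := hp n (leqnn n).
have p1 : 2^-1 ^+ n <= 1 :> R by rewrite exprn_ile1 // invf_le1 // ler1n.
have : pot n z <= 0.
  rewrite /pot pmulr_lle0 ?invr_gt0 ?degree_gt0 // -ln1 ler_ln ?posrE ?max_gt0 ?floor_gt0 //.
  rewrite ge_max exprn_ile1 ?invr_ge0 // ?invf_le1 // ?ler1n // andbT.
  by apply: le_trans (ball_co bz (isT : (0 < K.+1)%N)) _; lra.
rewrite ler_norml; lra.
Qed.

Lemma potential_center : potential center = - ln 16.
Proof.
have E n : pot n center = - ln 16.
  rewrite /pot /h phi_center co0 cmod0; have -> : Num.max 0 (16^-1 ^+ degree n) = 16^-1 ^+ degree n :> R.
    by apply/max_idPr; rewrite ltW // floor_gt0.
  rewrite lnXn ?invr_gt0 // -[X in X / _]mulr_natl mulrAC divff ?gt_eqF ?degree_gt0 // mul1r lnV // posrE //.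
rewrite /potential; under eq_fun do rewrite E; exact: lim_cst.
Qed.

Definition far_point : pt := psi (st 0) (mk K (fun j => if j == 0%N then (1 / 4)%:C%C else 0)).

Lemma far_point_ball : ball_dom 0 far_point.
Proof.
have [_ _ _ qK] := inv_auto (Hinv 0).
rewrite /ball_dom /= /far_point qK hnorm2E big_ord_recl big1 ?addr0 => [|j _]; last first.
  by rewrite co_mk // cmod0 expr0n.
by rewrite co_mk // cmod_real ger0_norm // expr2; lra.
Qed.

(** The factor 2 pays for the perturbation: raised to the power d >= 2 it is at least 4, of which
    the perturbation takes away at most 1. At n = 0 the bound is the chosen value 1/4. The base 8
    lies below 16, so the potential here exceeds its value at the center. *)
Lemma far_point_lower n : 2 * 8^-1 ^+ degree n <= cmod (h n 0 far_point).
Proof.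
elim: n => [|n IH].
  have [_ _ _ qK] := inv_auto (Hinv 0).
  rewrite /degree big_ord0 expr1 /h /far_point qK co_mk // cmod_real ger0_norm; lra.
have bn : ball_dom n far_point by apply: (ball_mono) (leq0n n) far_point_ball.
rewrite (h_step) //.
have c1 := cmod_lbD (h n 0 far_point ^+ dd n) ((a n)%:C%C * h n 1 far_point).
apply: le_trans c1; rewrite cmodX cmodM cmod_real gtr0_norm ?(a_gt0) //.
have E0 : 0 < 8^-1 ^+ degree n.+1 :> R by rewrite exprn_gt0 // invr_gt0.
have small : a n * cmod (h n 1 far_point) <= 8^-1 ^+ degree n.+1.
  apply: le_trans (_ : a n <= _).
    rewrite ler_piMr ?(ltW (a_gt0 n)) //.
    by apply: le_trans (ball_co bn (isT : (1 < K.+1)%N)) _; lra.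
  apply: le_trans (step_cap (Hstep n)) _; rewrite capE.
  apply: le_trans (_ : 16^-1 ^+ degree n.+1 <= _); first by have := floor_gt0 (degree n.+1); lra.
  by apply: lerXn2r; rewrite ?nnegrE ?invr_ge0 // lef_pV2 ?posrE // ler_nat.
have : (2 * 8^-1 ^+ degree n) ^+ dd n <= cmod (h n 0 far_point) ^+ dd n.
  by apply: lerXn2r => //; rewrite nnegrE ?cmod_ge0 // mulr_ge0 // exprn_ge0 // invr_ge0.
rewrite exprMn -exprM -degreeS.
have : 2 ^+ 2 <= 2 ^+ dd n :> R by apply: ler_weXn2l; [lra|have [] := dd_gt n].
move: E0 small; move: (8^-1 ^+ _) (2 ^+ dd n) (cmod _ ^+ _) (_ * cmod _) => s t x y; rewrite expr2; nra.
Qed.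

Lemma potential_nonconstant : potential center < potential far_point.
Proof.
have [cv _] := potential_approx far_point_ball.
apply: lt_le_trans (_ : - ln 8 <= _).
  by rewrite potential_center ltrN2 ltr_ln ?posrE // ltr_nat.
apply: (cvgr_to_ge cv); apply: nearW => n.
rewrite /pot ler_pdivlMr ?degree_gt0 // -lnV ?posrE // mulr_natr -lnXn ?invr_gt0 //.
rewrite ler_ln ?posrE ?max_gt0 ?floor_gt0 ?exprn_gt0 ?invr_gt0 //.
rewrite le_max; apply/orP; left; apply: le_trans (far_point_lower n).
have : 0 < 8^-1 ^+ degree n :> R by rewrite exprn_gt0 // invr_gt0.
lra.
Qed.

Lemma basin_dom_short : short_Ck basin_dom.
Proof.
split.
- exact: basin_dom_domain.
- exists ball_dom; split=> [j z|//|j]; last exact: (ball_biholomorphic).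
    exact: (ball_mono) (leqnSn j).
  exact: (basin_domE).
- by move=> z v; exact: (kobayashi_zero).
exists (fun z => (potential z)%:E); split; first exact: potential_psh.
  by exists 1 => z bz; rewrite lee_fin; exact: potential_le1.
have inB n z : ball_dom n z -> basin_dom z by rewrite (basin_domE) => bz; exists n.
exists center, far_point; split.
- exact: inB (ball_center 0).
- exact: inB far_point_ball.
- by move=> [E]; have := potential_nonconstant; rewrite E ltxx.
Qed.

(** * The automorphisms and their common attracting fixed point *)

Definition basin_map n (z : pt) : pt := psi (st 0) (stepmap (dd n) (a n) (phi (st 0) z)).

(** Each map is a step conjugated by the initial coordinates [phi (st 0)], so the inner coordinate
    changes cancel in the composition. *)
Lemma compose_basin_map n z : compose_seq basin_map n z = psi (st 0) (phi (st n.+1) z).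
Proof.
have [_ _ _ qK] := inv_auto (Hinv 0).
elim: n => [|n IH] /=; first by rewrite /basin_map (step_phi (Hstep 0)).
by rewrite IH /basin_map qK (step_phi (Hstep n.+1)).
Qed.

Lemma a_neq0 n : a n != 0. Proof. by rewrite gt_eqF // (a_gt0). Qed.

Lemma basin_map_auto n : polyauto (basin_map n)
  (fun w => psi (st 0) (stepinv (dd n) (a n) (phi (st 0) w))).
Proof.
have [pp ps pK qK] := inv_auto (Hinv 0).
have aphi : polyauto (phi (st 0)) (psi (st 0)) by [].
have apsi : polyauto (psi (st 0)) (phi (st 0)) by [].
exact: polyauto_comp (polyauto_comp aphi (stepmap_auto _ _ (a_neq0 n))) apsi.
Qed.

Lemma basin_map_hol n : hol_automorphism (basin_map n).
Proof.
have [pF pG FK GK] := basin_map_auto n.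
by exists (fun w => psi (st 0) (stepinv (dd n) (a n) (phi (st 0) w))); split=> //;
  apply: polymap_holomorphic => //; exact: openT.
Qed.

Lemma basin_map_center n : basin_map n center = center.
Proof.
by rewrite /basin_map phi_center stepmap0 //; have [_] := dd_gt n; exact: ltnW.
Qed.

Definition unit_pt (j : nat) : pt := mk K (fun l => (l == j)%:R).

Lemma cder_basis (f : pt -> C) (z w : pt) : cpoly f ->
  cder f z w = \sum_(j < K.+1) co w j * cder f z (unit_pt j).
Proof.
elim=> [c|j jK|{}f g pf IHf pg IHg|{}f g pf IHf pg IHg].
- by rewrite cder_cst big1 // => j _; rewrite cder_cst mulr0.
- rewrite cder_co (bigD1 (Ordinal jK)) //= big1 ?addr0 => [|l lj].
    by rewrite cder_co co_mk // eqxx mulr1.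
  rewrite cder_co co_mk //; case: eqP => [jl|_]; last by rewrite mulr0.
  by move: lj; rewrite -val_eqE /= jl eqxx.
- transitivity (cder f z w + cder g z w); first exact: cderD.
  rewrite IHf IHg -big_split; apply: eq_bigr => j _ /=.
  by rewrite -mulrDr; congr (_ * _); apply/esym; exact: cderD.
- transitivity (f z * cder g z w + g z * cder f z w); first exact: cderM.
  rewrite IHf IHg !mulr_sumr -big_split; apply: eq_bigr => j _ /=.
  rewrite mulrCA [g z * _]mulrCA -mulrDr; congr (_ * _); apply/esym; exact: cderM.
Qed.

Lemma cjacobian_co (F : pt -> pt) z i j : polymap F -> cjacobian F z i j = cder (fun z => co (F z) i) z (unit_pt j).
Proof.
move=> pF; rewrite mxE -co_diff // -toCE /toC.
suff -> : ((\row_(l < K.+1) (l == j)%:R, 0) : pt) = unit_pt j by [].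
apply: co_inj => l lK; rewrite co_mk //; apply: complex_ext; rewrite /co /= !mxE.
  by rewrite -val_eqE /= inordK //; case: eqP.
by case: eqP.
Qed.

Lemma cder_step_origin n i v : (i < K.+1)%N ->
  co ('d (stepmap (dd n) (a n) : pt -> pt) 0 v) i = (a n)%:C%C * co v (if i == K then 0%N else i.+1).
Proof.
move=> iK1; have [pf _ _ _] := stepmap_auto m (dd n) (a_neq0 n); rewrite co_diff //.
have [_ d1] := dd_gt n.
case: eqP => [->|/eqP iK].
  have -> : (fun z : pt => co (stepmap (dd n) (a n) z) K) = fun z => (a n)%:C%C * co z 0.
    by apply/funext => z; rewrite co_stepmap_last.
  by rewrite cderMl ?cder_co //; exact: cpoly_co.
have iK' : (i < K)%N by rewrite ltn_neqAle iK -ltnS.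
have -> : (fun z : pt => co (stepmap (dd n) (a n) z) i) = fun z => co z i ^+ dd n + (a n)%:C%C * co z i.+1.
  by apply/funext => z; rewrite co_stepmap.
have p1 : cpoly (fun z : pt => co z i) by exact: cpoly_co.
have p2 : cpoly (fun z : pt => co z i.+1) by exact: cpoly_co.
rewrite cderD; [|exact: cpolyX|by apply: cpolyM => //; exact: cpoly_cst].
rewrite cderX // cderMl // !cder_co co0 expr0n.
by case: (dd n) d1 => [//|[//|d]] _; rewrite mulr0 mul0r add0r.
Qed.

Lemma cder_sum n (f : nat -> pt -> C) (z v : pt) : (forall i, (i < n)%N -> cpoly (f i)) ->
  cpoly (fun z => \sum_(i < n) f i z) /\
  cder (fun z => \sum_(i < n) f i z) z v = \sum_(i < n) cder (f i) z v.
Proof.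
elim: n => [_|n IH pf].
  have -> : (fun z => \sum_(i < 0) f i z) = fun=> 0 by apply/funext => x; rewrite big_ord0.
  by rewrite big_ord0 cder_cst; split=> //; exact: cpoly_cst.
have [p1 e1] := IH (fun i iln => pf i (ltnW iln)).
have -> : (fun z => \sum_(i < n.+1) f i z) = fun z => \sum_(i < n) f i z + f n z.
  by apply/funext => x; rewrite big_ord_recr.
split; first by apply: cpolyD => //; exact: pf.
by rewrite big_ord_recr /= -e1; apply: cderD => //; exact: pf.
Qed.

(* A left eigenvector of the Jacobian is a linear functional [L] with [L o dF = lam L];
   in the coordinates [phi] the differential is [a] times a cyclic shift of the basis. *)
Lemma basin_map_attracting n : attracting_fixed_point (basin_map n) center.
Proof.
split; first exact: basin_map_center.
have [pp ps pK qK] := inv_auto (Hinv 0).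
have [pF _ _ _] := basin_map_auto n.
have [pf _ _ _] := stepmap_auto m (dd n) (a_neq0 n).
move=> lam /eigenvalueP [v vJ v0].
pose L (w : pt) : C := \sum_(i < K.+1) v 0 (inord i) * co w i.
have pLi i : (i < K.+1)%N -> cpoly (fun w : pt => v 0 (inord i) * co w i).
  by move=> iK; apply: cpolyM; [exact: cpoly_cst|exact: cpoly_co].
have [pL _] := cder_sum 0 0 pLi.
have dL z w : cder L z w = L w.
  rewrite (cder_sum z w pLi).2; apply: eq_bigr => i _.
  by rewrite cderMl ?cder_co //; exact: cpoly_co.
have LF w : L ('d (basin_map n) center w) = lam * L w.
  rewrite /L mulr_sumr.
  transitivity (\sum_(i < K.+1) \sum_(j < K.+1) co w j * (v 0 i * cjacobian (basin_map n) center i j)).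
    apply: eq_bigr => i _; rewrite inord_val co_diff // cder_basis; last exact: pF.
    by rewrite mulr_sumr; apply: eq_bigr => j _; rewrite cjacobian_co // mulrCA.
  rewrite exchange_big; apply: eq_bigr => j _.
  rewrite -mulr_sumr inord_val mulrA [RHS]mulrC; congr (_ * _).
  by have := congr1 (fun M : 'rV_K.+1 => M 0 j) vJ; rewrite !mxE.
pose G (w : pt) := L (psi (st 0) w).
have pG : cpoly G by exact: cpoly_comp.
have phi0 : phi (st 0) center = 0 by exact: phi_center.
have step0 : stepmap (dd n) (a n) (0 : pt) = 0 by rewrite stepmap0 //; have [_] := dd_gt n; exact: ltnW.
have dphi u : 'd (phi (st 0)) center ('d (psi (st 0)) 0 u) = u.
  apply: co_inj => j jK; rewrite co_diff //.
  rewrite -(cder_comp (f := fun w => co (phi (st 0) w) j)) //; last exact: pp.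
  have -> : (fun w => co (phi (st 0) (psi (st 0) w)) j) = fun w => co w j by apply/funext => w; rewrite qK.
  by rewrite cder_co.
have dpsi w : 'd (psi (st 0)) 0 ('d (phi (st 0)) center w) = w.
  apply: co_inj => j jK; rewrite co_diff // -phi0.
  rewrite -(cder_comp (f := fun w => co (psi (st 0) w) j)) //; last exact: ps.
  have -> : (fun w => co (psi (st 0) (phi (st 0) w)) j) = fun w => co w j by apply/funext => x; rewrite pK.
  by rewrite cder_co.
have GL u : cder G 0 u = L ('d (psi (st 0)) 0 u) by rewrite /G cder_comp.
have shift u : cder G 0 ('d (stepmap (dd n) (a n) : pt -> pt) 0 u) = lam * cder G 0 u.
  rewrite [in RHS]GL -LF -(dL (basin_map n center)) -(cder_comp center _ pF pL).
  have -> : (fun z => L (basin_map n z)) = fun z => (fun y => G (stepmap (dd n) (a n) y)) (phi (st 0) z) by [].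
  have pGs : cpoly (fun y : pt => G (stepmap (dd n) (a n) y)) by exact: cpoly_comp.
  rewrite (cder_comp center _ pp pGs).
  transitivity (cder (fun y : pt => G (stepmap (dd n) (a n) y)) 0 u).
    by rewrite (cder_comp 0 u pf pG) step0.
  by rewrite phi0; congr (cder _ 0 _); exact: (esym (dphi u)).
(* The differential of the step at 0 sends the basis vector of index j to a_n times that of index
   [prev j]; the powers contribute nothing because d_n > 1. *)
pose prev j := if j == 0%N then K else j.-1.
have shift_basis j : (j < K.+1)%N -> (a n)%:C%C * cder G 0 (unit_pt (prev j)) = lam * cder G 0 (unit_pt j).
  move=> jK; rewrite -shift -cder_cs //; congr (cder G 0 _); apply: co_inj => i iK.
  rewrite cder_step_origin // co_cs // !co_mk //; last by case: eqP => // /eqP iK'; rewrite ltnS ltn_neqAle iK' -ltnS.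
  congr (_ * (nat_of_bool _)%:R); rewrite /prev; case: (i =P K) => [->|iK'].
    case: j jK => [|j] jK; first by rewrite !eqxx.
    rewrite ltnS in jK; rewrite (gtn_eqF jK) //.
  case: j jK => [|j] _; last by rewrite eqSS.
  by apply: negbTE; apply/eqP.
(* At an index where the functional is largest on the basis, |lam| |G_j| = a_n |G_{prev j}| <= a_n
   |G_j|, so every eigenvalue has modulus at most a_n. *)
have [j jK hj] := exists_argmax K (fun j => cmod (cder G 0 (unit_pt j))).
have x0 : 0 < cmod (cder G 0 (unit_pt j)).
  rewrite lt0r cmod_ge0 andbT; apply/eqP => xj; move/eqP: v0; apply.
  have Gz i : (i < K.+1)%N -> cder G 0 (unit_pt i) = 0.
    move=> iK; apply/eqP; rewrite -cmod_eq0 eq_le cmod_ge0 andbT -xj; exact: hj.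
  have Lz w : L w = 0.
    rewrite -[w]dpsi -GL cder_basis // big1 // => i _; by rewrite Gz ?mulr0.
  apply/rowP => i; rewrite mxE -(Lz (unit_pt i)) /L (bigD1 i) //= big1 ?addr0 => [|l li].
    by rewrite inord_val co_mk // eqxx mulr1.
  by rewrite co_mk //; case: eqP => [il|_]; rewrite ?mulr0 //; move: li; rewrite -val_eqE /= il eqxx.
have pjK : (prev j <= K)%N by rewrite /prev; case: eqP => // _; apply: leq_trans jK; exact: leq_pred.
have e := congr1 (@cmod R) (shift_basis j jK).
rewrite !cmodM cmod_real gtr0_norm ?(a_gt0) // in e.
have la : cmod lam <= a n.
  by rewrite -(ler_pM2r x0) -e ler_pM2l ?(a_gt0) //; exact: hj.
have lam1 : cmod lam < 1 by have := a_le n; lra.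
have -> : `|lam| = (cmod lam)%:C%C by rewrite normc_def -cmodE.
rewrite (_ : (1 : C) = 1%:C%C) ?ltcR //.
Qed.

Lemma basin_basin_map : basin basin_map center = basin_dom.
Proof.
have [pp ps pK qK] := inv_auto (Hinv 0).
apply/seteqP; split=> z; rewrite /basin /=.
  move=> hz i iK; have iK1 : (i < K.+1)%N by exact: ltnW.
  have ci : continuous (fun w : pt => cmod (co (phi (st 0) w) i)).
    exact: (cpoly_cmod_continuous (pp i iK1)).
  rewrite /Dom /= -(cvg_shiftS (fun n => cmod (h n i z))).
  have hc : (fun n => cmod (co (phi (st 0) (compose_seq basin_map n z)) i)) @ \oo
      --> cmod (co (phi (st 0) center) i) by exact: (continuous_cvg _ (ci center) hz).
  rewrite phi_center co0 cmod0 in hc; apply: cvg_trans hc; apply: near_eq_cvg.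
  by apply: nearW => n; rewrite compose_basin_map qK.
move=> bz; have -> : (fun n => compose_seq basin_map n z) = fun n => psi (st 0) (phi (st n.+1) z).
  by apply/funext => n; exact: compose_basin_map.
have c0 : (fun n => phi (st n.+1) z) @ \oo --> (0 : pt).
  apply/cvgr0Pnorm_lt => e e0.
  have e2 : 0 < e ^+ 2 by rewrite exprn_gt0.
  have [n0 _ hn0] := (cvgr_lt _ (hnorm2_cvg0 bz)) (e ^+ 2) e2.
  exists n0 => // n n0n; apply: le_lt_trans (norm_le_sqrt_hnorm2 _) _.
  rewrite -[e]gtr0_norm // -sqrtr_sqr ltr_sqrt //; apply: hn0 => /=; exact: leqW.
have cp : {for (0 : pt), continuous (psi (st 0))} by exact: polymap_continuous.
have hc : (fun n => psi (st 0) (phi (st n.+1) z)) @ \oo --> psi (st 0) 0.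
  exact: (continuous_cvg _ cp c0).
exact: hc.
Qed.

Lemma basin_avoids : basin_dom `&` V = set0.
Proof.
apply/seteqP; split=> // z [bz Vz].
have hN l : (l <= K)%N -> exists N, forall n i, (N <= n)%N -> (i < l)%N -> cmod (h n i z) <= 2.
  elim: l => [|l IH] lK; first by exists 0%N.
  have [N hN] := IH (ltnW lK).
  have [n0 _ hn0] := (cvgr_lt _ (bz l lK)) 2 ltac:(lra).
  exists (maxn N n0) => n i; rewrite geq_max => /andP [Nn n0n].
  rewrite ltnS leq_eqVlt => /predU1P[->|il]; last exact: hN.
  by apply/ltW/hn0.
have [N hN'] := hN K (leqnn K); have [_ tm] := inv_tame (Hinv N).
by apply: (tm (co (phi (st N) z))) => [|j jK]; [exists z|exact: hN'].
Qed.

End LimitDomains.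

(** * Choice of the exponents and conclusion *)

Fixpoint tameness (E n : nat) : nat :=
  if n is n'.+1 then (2 * tameness E n' * (tameness E n' + 2) + 1)%N else E.

Lemma basin_exists (R : realType) m (V : set (Cpt R m.+3)) : alg_set V -> ~ has_chain V m.+2 ->
  exists (p : Cpt R m.+3) (F : nat -> Cpt R m.+3 -> Cpt R m.+3),
    [/\ (forall n, hol_automorphism (F n) /\ attracting_fixed_point (F n) p),
        short_Ck (basin F p), piecewise_smooth (basin F p) & basin F p `&` V = set0].
Proof.
move=> aV nV; have [T [S [E [aTS tV]]]] := good_coordinates aV nV.
(* The degree E_n + 2 exceeds both E_n and 1, and [tameness] is the exponent recursion of
   [tame_step] for this degree. *)
pose Ex := tameness E; pose dd n := (Ex n + 2)%N.
pose cap n : R := 16^-1 ^+ degree dd n.+1 / 2.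
have dd_gt n : (Ex n < dd n)%N /\ (1 < dd n)%N by rewrite /dd; split; lia.
have cap_gt0 n : 0 < cap n by rewrite divr_gt0 // exprn_gt0 // invr_gt0.
have half0 : 0 < (2^-1 : R) by rewrite invr_gt0.
have half1 : (2^-1 : R) <= 2^-1 ^+ 1 by rewrite expr1.
have w1 i : (i < m.+2)%N -> sm (fun _ : Cpt R m.+3 => 1 : R) /\ forall z : Cpt R m.+3, 1 <= (1 : R).
  by split; [exact: sm_cst|].
have [st0 [[I0 _ _ _] _]] := @complete_state R m V Ex 0 T S (fun _ _ => 1) 0 _ aTS w1 tV half0 half1.
have [st [a [_ Hinv Hstep]]] := exists_sequence dd_gt (fun n => erefl) cap_gt0 I0.
exists (center st), (basin_map dd st a).
rewrite (basin_basin_map dd_gt Hinv Hstep); split.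
- by move=> n; split; [exact: basin_map_hol Hinv Hstep n|exact: basin_map_attracting dd_gt Hinv Hstep n].
- exact: (basin_dom_short dd_gt Hinv Hstep).
- exact: (basin_dom_piecewise dd_gt Hinv Hstep (basin_dom_domain dd_gt Hinv Hstep)).
- exact: (basin_avoids Hinv).
Qed.

Local Close Scope ring_scope.

Theorem theorem1p6 (R : realType) (k : nat) (hk : (3 <= k)%N)
    (V : set (Cpt R k)) (hV : alg_set V) (hcodim : alg_dim V (k - 2)) :
  exists (p : Cpt R k) (F : nat -> Cpt R k -> Cpt R k),
    [/\ (forall n, hol_automorphism (F n) /\ attracting_fixed_point (F n) p),
        short_Ck (basin F p),
        piecewise_smooth (basin F p) &
        basin F p `&` V = set0].
Proof.
case: k hk V hV hcodim => [//|[//|[//|m]]] _ V aV [_ dimV].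
(* A chain of length k - 1 in [V] would exceed the dimension k - 2. *)
by apply: basin_exists => // /dimV; rewrite subn2 ltnn.
Qed.
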